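(* Let $d\ge2$, $g\in C(\mathbb{S}^{d-1};(0,+\infty))$ even, $s\ge1$, and let $\{E_r\}_{r>0}\subset\mathfrak{C}$ with $E_r\to E$ in $\mathfrak{C}$ as $r\to0^+$ for some $E\in\mathfrak{C}$. Then for every $x\in\partial E\cap\partial E_r$ for all $r>0$, $$\lim_{r\to0^+}\frac{\mathcal K^{g,s}_r(x,E_r)}{\sigma^s(r)}=\mathcal K^{g,1}(x,E).$$
   Context: $\mathfrak{C}$ is the class of subsets of $\mathbb{R}^d$ which are closures of open sets with compact $C^2$ boundary; $E_r\to E$ in $\mathfrak{C}$ means there are diffeomorphisms $\Phi_r$ converging to the identity in $C^2$ with $\Phi_r(E)=E_r$. $k^s_r(t)=r^{-d-s}$ for $0\le t\le r$ and $k^s_r(t)=t^{-d-s}$ for $t>r$; $k^{g,s}_r(x):=g(x/|x|)k^s_r(|x|)$; $\mathcal K^{g,s}_r(x,E):=\int_{\mathbb{R}^d}(\chi_{\mathbb{R}^d\setminus E}(y)-\chi_E(y))k^{g,s}_r(x-y)\,dy$. $\sigma^s(r):=|\log r|$ if $s=1$, $\sigma^s(r):=\frac{d+s}{d+1}\frac{r^{1-s}}{s-1}$ if $s>1$. Anisotropic mean curvature: for $E\in\mathfrak{C}$ and $x\in\partial E$ with outer normal $\nu=\nu_E(x)$, near $x$ the set $E$ is $\{x+z+t\nu: z\perp\nu,\ t\le f(z)\}$ for a $C^2$ function $f$ on the hyperplane $\nu^\perp$ with $f(0)=0$, $Df(0)=0$; then $\mathcal K^{g,1}(x,E):=-\int_{\{\xi\in\mathbb{S}^{d-1}:\xi\cdot\nu=0\}}g(\xi)\,\xi^*D^2f(0)\xi\,d\mathcal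 H^{d-2}(\xi)$. *)

(* Defs.v *)
From HB Require Import structures.
From mathcomp Require Import all_boot all_order all_algebra.
From mathcomp Require Import all_classical all_reals all_analysis.
Set Implicit Arguments. Unset Strict Implicit. Unset Printing Implicit Defensive.
Import Order.TTheory GRing.Theory Num.Theory.
Import numFieldNormedType.Exports.
Local Open Scope classical_set_scope.
Local Open Scope ring_scope.

Section Defs.
Context {R : realType} {d : nat}.
Notation V := 'rV[R]_d.

Definition edot (x y : V) : R := \sum_(i < d) x ord0 i * y ord0 i.
Definition eunorm (x : V) : R := Num.sqrt (edot x x).

Definition unit_sphere : set V := [set xi | eunorm xi = 1].

Definition ebase (i : 'I_d) : V := \row_(j < d) (i == j)%:R.

(* orthogonal projection onto nu^perp (nu a unit vector) *)
Definition projperp (nu z : V) : V := z - edot z nu *: nu.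

Definition bdry (E : set V) : set V := closure E `\` interior E.

Definition isC2 {W : normedModType R} (F : V -> W) : Prop :=
  continuous F /\
  forall i : 'I_d,
    (forall x, derivable F x (ebase i)) /\
    continuous (fun x => derive F x (ebase i)) /\
    forall j : 'I_d,
      (forall x, derivable (fun y => derive F y (ebase i)) x (ebase j)) /\
      continuous (fun x => derive (fun y => derive F y (ebase i)) x (ebase j)).

(* E is, inside the ball B(x,rho), the subgraph {x + z + t nu : z in nu^perp, t <= f z} *)
Definition local_subgraph (E : set V) (x nu : V) (rho : R) (f : V -> R) : Prop :=
  forall y : V, eunorm (y - x) < rho ->
    (E y <-> edot (y - x) nu <= f (projperp nu (y - x))).

Definition C2_boundary (E : set V) : Prop :=
  forall x, bdry E x ->
    exists nu : V, exists rho : R, exists f : V -> R,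
      eunorm nu = 1 /\ 0 < rho /\ isC2 f /\ local_subgraph E x nu rho f.

Definition class_frakC (E : set V) : Prop :=
  (exists U : set V, open U /\ E = closure U) /\ compact (bdry E) /\ C2_boundary E.

Definition C2_diffeo (Phi : V -> V) : Prop :=
  isC2 Phi /\ exists Psi : V -> V, isC2 Psi /\ cancel Phi Psi /\ cancel Psi Phi.

Definition conv_frakC (Er : R -> set V) (E : set V) : Prop :=
  exists Phi : R -> V -> V,
    (forall r, 0 < r -> C2_diffeo (Phi r) /\ Phi r @` E = Er r) /\
    (forall eps, 0 < eps -> exists delta, 0 < delta /\
       forall r, 0 < r -> r < delta -> forall x : V,
         eunorm (Phi r x - x) <= eps /\
         (forall i, eunorm (derive (Phi r) x (ebase i) - ebase i) <= eps) /\
         (forall i j, eunorm (derive (fun y => derive (Phi r) y (ebase i)) x (ebase j))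
                        <= eps)).

(* d-dimensional Lebesgue integral, as iterated one-dimensional Lebesgue integrals *)
Fixpoint iint (n : nat) : ('rV[R]_n -> R) -> R :=
  match n return ('rV[R]_n -> R) -> R with
  | 0 => fun F => F 0
  | n'.+1 => fun F =>
      Rintegral lebesgue_measure setT
        (fun t : R => iint (fun v : 'rV[R]_n' => F (row_mx (const_mx t : 'rV[R]_1) v)))
  end.

Definition kr (s r t : R) : R :=
  if t <= r then r `^ (- (d%:R + s)) else t `^ (- (d%:R + s)).

Definition kgs (g : V -> R) (s r : R) (z : V) : R :=
  g ((eunorm z)^-1 *: z) * kr s r (eunorm z).

Definition Kgs (g : V -> R) (s r : R) (x : V) (E : set V) : R :=
  iint (fun y => (\1_(~` E) y - \1_E y) * kgs g s r (x - y)).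

Definition sigmas (s r : R) : R :=
  if s == 1 then `|ln r|
  else (d%:R + s) / (d%:R + 1) * (r `^ (1 - s)) / (s - 1).

Fixpoint ball_vol (m : nat) : R :=
  match m with
  | 0 => 1
  | 1 => 2
  | m'.+2 as k => (2 * pi / k%:R) * ball_vol m'
  end.

Local Open Scope ereal_scope.

Definition ediam (C : set V) : \bar R :=
  ereal_sup [set (eunorm (x - y))%:E | x in C & y in C].

Definition haus_cost (m : nat) (C : set V) : \bar R :=
  if `[< C = set0 >] then 0 else (ball_vol m * (fine (ediam C) / 2) ^+ m)%:E.

Definition haus_delta (m : nat) (delta : R) (A : set V) : \bar R :=
  ereal_inf [set \sum_(0 <= i <oo) haus_cost m (C i) | C in
    [set C : nat -> set V | A `<=` \bigcup_i C i /\ forall i, ediam (C i) <= delta%:E]].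

Definition haus (m : nat) (A : set V) : \bar R :=
  ereal_sup [set haus_delta m delta A | delta in [set delta : R | (0 < delta)%R]].

(* integral of h over A w.r.t. H^m, via the layer-cake definition
   int h = int_0^oo H^m(A & {h > t}) dt - int_0^oo H^m(A & {-h > t}) dt *)
Definition haus_int (m : nat) (A : set V) (h : V -> R) : \bar R :=
  \int[lebesgue_measure]_(t in `[0%R, +oo[%classic)
      haus m (A `&` [set xi | (t < h xi)%R]) -
  \int[lebesgue_measure]_(t in `[0%R, +oo[%classic)
      haus m (A `&` [set xi | (t < - h xi)%R]).

End Defs.

(* Main.v *)
(* Translate by x and symmetrize: K_r(x, E_r) is the integral of g(w/|w|) k_r(|w|) om_r(w), where
   om_r(w) averages the values of the sign function 1 - 2 chi_(E_r) at x + w and x - w. Since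
   E_r -> E in C^2, the point x + w lies in E_r iff l_r.w + q(w) <= 0, up to an error eps |w|^2;
   here l_r -> nu and q(w) = - D^2 f(0)(Pw, Pw) / 2 with P the projection onto nu^perp. So om_r is
   squeezed between signed indicators of slabs |l_r.w| < +-q(w) +- eps |w|^2. As q is homogeneous of
   degree 2, the g-weighted volume of such a slab in the ball of radius a is asymptotic to
   J a^(d+1) with J = 2 int_(nu^perp, |z| <= 1) g(z/|z|) q(z) dz. Writing k_r as a superposition of
   indicators of balls gives K_r ~ (d+1) J sigma(r).
   To read J as an integral for the covering-based H^(d-2), one shows that on a unit sphere
   H^m(A) = (m+1) |cone A|: the lower bound is the isodiametric inequality (from Prekopa-Leindler),
   applied to gnomonic projections of the covering sets, and the upper bound is a greedy Vitali
   packing by caps. *)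
Require Import Defs.
From HB Require Import structures.
From mathcomp Require Import all_boot all_order all_algebra.
From mathcomp Require Import all_classical all_reals all_analysis.
From mathcomp Require Import measurable_realfun ring lra.
Set Implicit Arguments. Unset Strict Implicit. Unset Printing Implicit Defensive.
Import Order.TTheory GRing.Theory Num.Theory.
Import numFieldNormedType.Exports.
Local Open Scope classical_set_scope.
Local Open Scope ring_scope.

(** * Lebesgue measure on row vectors *)

(** The obstacle is the linear term: l_r.w dominates the curvature term q(w) near 0, yet only the
    latter may be seen in the limit. Averaging over w and -w removes it, because away from the slab
    the two signs are opposite and cancel. The direction l_r depends on r, since Phi_r need not fix
    x: the expansion is made at the preimage of x, and the slab volumes have to be asymptotic
    uniformly for l near nu. Whatever comes from outside a fixed small ball, and every constant
    created by its radius, stays bounded in r and is absorbed by sigma, which diverges. Only a lower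
    bound for K_r is proved; the upper bound is the same statement with sign -1, that is, for the
    complementary set. As [iint] is an iterated integral, a measure [mu] is built by the same
    recursion, and translations, dilations and rotations are studied for [mu]. On the Hausdorff side
    it is enough to treat relatively open subsets of the sphere, because the layer-cake formula only
    sees superlevel sets of a continuous function. *)

Definition rV_display : measure_display.
Proof. exact: default_measure_display. Qed.

Section rV_measurable.
Context {R : realType}.
Variable n : nat.

(** The coordinates generate the sigma-algebra, so that measurability of maps into row vectors is
    tested coordinate by coordinate; that open sets belong to it is [open_measurable_rV]. *)
Let coors : 'I_n -> 'rV[R]_n -> measurableTypeR R := fun i v => v ord0 i.

Let rV_set0 : g_sigma_preimage coors set0.
Proof. exact: sigma_algebra0. Qed.

Let rV_setC A : g_sigma_preimage coors A -> g_sigma_preimage coors (~` A).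
Proof. exact: sigma_algebraC. Qed.

Let rV_bigcup (F : _^nat) : (forall i, g_sigma_preimage coors (F i)) ->
  g_sigma_preimage coors (\bigcup_i (F i)).
Proof. exact: sigma_algebra_bigcup. Qed.

HB.instance Definition _ := @isMeasurable.Build rV_display
  'rV[R]_n (g_sigma_preimage coors) rV_set0 rV_setC rV_bigcup.
End rV_measurable.

Notation rVm R n := (@matrix_matrix__canonical__measurable_structure_Measurable R n).

Lemma measurable_coord (R : realType) n (i : 'I_n) :
  measurable_fun [set: 'rV[R]_n] (fun v : 'rV[R]_n => v ord0 i).
Proof.
move=> _ Y mY; rewrite setTI; apply: sub_sigma_algebra => /=.
rewrite -bigcup_seq/=; exists i => /=; first by rewrite mem_index_enum.
by exists Y => //; rewrite setTI.
Qed.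

Lemma measurable_fun_rVP (R : realType) d1 (T1 : measurableType d1) n
    (f : T1 -> 'rV[R]_n) :
  measurable_fun [set: T1] f <->
  forall i, measurable_fun [set: T1] (fun x => f x ord0 i).
Proof.
split=> [mf i|mf].
  by apply: (measurableT_comp (measurable_coord i)).
move=> _ A mA; rewrite setTI.
have : (g_sigma_preimage (fun (i : 'I_n) x => f x ord0 i)) (f @^-1` A).
  by rewrite (g_sigma_preimage_comp (fun i (v : 'rV[R]_n) => v ord0 i));
    exists A => //; rewrite setTI.
apply: smallest_sub; first exact: sigma_algebra_measurable.
case: n => [|n] in f mf A mA *; first by rewrite big_ord0.
rewrite -bigcup_mkord_ord; apply: bigcup_sub => i Ii.
by move=> _ [B mB <-]; exact: mf.
Qed.

(** The expression by which [iint] prepends a coordinate, so that [iint] unfolds to it by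
    conversion. *)
Definition vcons (R : realType) n (t : R) (v : 'rV[R]_n) : 'rV[R]_n.+1 :=
  row_mx (const_mx t : 'rV[R]_1) v.

Lemma vcons0 (R : realType) n (t : R) (v : 'rV[R]_n) : vcons t v ord0 ord0 = t.
Proof.
rewrite /vcons; have -> : ord0 = lshift n (ord0 : 'I_1) by apply: val_inj.
by rewrite (row_mxEl (const_mx t : 'rV[R]_1) v) mxE.
Qed.

Lemma vconsS (R : realType) n (t : R) (v : 'rV[R]_n) i :
  vcons t v ord0 (lift ord0 i) = v ord0 i.
Proof.
rewrite /vcons; have -> : lift ord0 i = rshift 1 i by apply: val_inj.
by rewrite (row_mxEr (const_mx t : 'rV[R]_1) v).
Qed.

Definition vtail (R : realType) n (v : 'rV[R]_n.+1) : 'rV[R]_n :=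
  \row_i v ord0 (lift ord0 i).

Lemma vcons_eta (R : realType) n (v : 'rV[R]_n.+1) : vcons (v ord0 ord0) (vtail v) = v.
Proof.
apply/rowP => i; case: (unliftP ord0 i) => [j|] ->; first by rewrite vconsS mxE.
by rewrite vcons0.
Qed.

Lemma measurable_vcons (R : realType) n :
  measurable_fun setT (fun p : R * 'rV[R]_n => vcons p.1 p.2).
Proof.
apply/measurable_fun_rVP => i; case: (unliftP ord0 i) => [j|] ->.
  under [X in measurable_fun _ X]eq_fun do rewrite vconsS.
  exact: (measurableT_comp (measurable_coord j)).
by under [X in measurable_fun _ X]eq_fun do rewrite vcons0; exact: measurable_fst.
Qed.

(** Products of the two exhausting sequences work because these are increasing: coordinates caught
    at different stages are both caught at the later one. *)
Lemma product_sigma_finite d1 d2 (T1 : measurableType d1) (T2 : measurableType d2)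
    (R : realType) (m1 : {sigma_finite_measure set T1 -> \bar R})
    (m2 : {sigma_finite_measure set T2 -> \bar R}) : sigma_finite setT (m1 \x m2)%E.
Proof.
have /sigma_finiteP[F [TF ndF Fy]] := sigma_finiteT m1.
have /sigma_finiteP[G [TG ndG Gy]] := sigma_finiteT m2.
exists (fun k => F k `*` G k) => [|k]; last first.
  have [mF Fk] := Fy k; have [mG Gk] := Gy k; split; first exact: measurableX.
  by rewrite product_measure1E// lte_mul_pinfty// ge0_fin_numE.
apply/esym; rewrite -subTset => -[x y] _.
have [i _ Fx] : (\bigcup_k F k) x by rewrite -TF.
have [j _ Gy'] : (\bigcup_k G k) y by rewrite -TG.
exists (maxn i j) => //; split => /=.
  by move/subsetPset: (ndF _ _ (leq_maxl i j)); apply.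
by move/subsetPset: (ndG _ _ (leq_maxr i j)); apply.
Qed.

Section mu_succ.
Context {R : realType} (n : nat).
Variable m : {sigma_finite_measure set (rVm R n) -> \bar R}.

Definition mu_succ : set 'rV[R]_n.+1 -> \bar R :=
  pushforward (@lebesgue_measure R \x m)%E (fun p : measurableTypeR R * 'rV[R]_n => vcons p.1 p.2).

HB.instance Definition _ := Measure.copy mu_succ
  (measure_function_pushforward__canonical__measure_function_Measure
     (@lebesgue_measure R \x m)%E (@measurable_vcons R n)).

Let mu_succ_sigma_finite : sigma_finite setT mu_succ.
Proof.
have [F TF Foo] := product_sigma_finite (@lebesgue_measure R) m.
pose un (v : 'rV[R]_n.+1) : measurableTypeR R * 'rV[R]_n := (v ord0 ord0, vtail v).
have mun : measurable_fun setT un.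
  apply/measurable_fun_pair; first exact: measurable_coord.
  apply/measurable_fun_rVP => i; rewrite /vtail.
  under [X in measurable_fun _ X]eq_fun do rewrite mxE.
  exact: measurable_coord.
exists (fun k => un @^-1` F k).
  by rewrite -preimage_bigcup -TF preimage_setT.
move=> k; have [mF Fk] := Foo k; split.
  by rewrite -[X in measurable X]setTI; exact: mun.
rewrite /mu_succ /pushforward (_ : _ @^-1` _ = F k)//.
apply/seteqP; split => -[t v] /=; rewrite /un vcons0; congr (F k (_, _));
  by apply/rowP => i; rewrite mxE vconsS.
Qed.

HB.instance Definition _ := Measure_isSigmaFinite.Build _ _ _ mu_succ
  mu_succ_sigma_finite.
End mu_succ.

(** Lebesgue measure, by the recursion of [iint]: each step takes the product with the line and
    carries it over by [vcons]. The single point of dimension zero has mass one. *)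
Fixpoint mu (R : realType) (n : nat) : {sigma_finite_measure set (rVm R n) -> \bar R} :=
  match n with
  | 0 => dirac (0 : 'rV[R]_0)
  | n'.+1 => mu_succ (mu R n')
  end.

(** * Tonelli and Fubini for [mu], and its comparison with [iint] *)

Section tonelli.
Context {R : realType}.
Local Open Scope ereal_scope.

Lemma integral_mu_succ n (F : 'rV[R]_n.+1 -> \bar R) :
  measurable_fun setT F -> (forall v, 0 <= F v) ->
  \int[mu R n.+1]_v F v =
  \int[lebesgue_measure]_t \int[mu R n]_v F (vcons t v).
Proof.
move=> mF F0.
rewrite [LHS](_ : _ = \int[pushforward (@lebesgue_measure R \x mu R n)
  (fun p : measurableTypeR R * 'rV[R]_n => vcons p.1 p.2)]_v F v)//.
rewrite ge0_integral_pushforward//; last exact: measurable_vcons.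
rewrite preimage_setT fubini_tonelli1//; first last.
  by move=> x; apply: F0.
by apply: (measurableT_comp mF); exact: measurable_vcons.
Qed.

Lemma integral_mu_succ2 n (F : 'rV[R]_n.+1 -> \bar R) :
  measurable_fun setT F -> (forall v, 0 <= F v) ->
  \int[mu R n.+1]_v F v =
  \int[mu R n]_v \int[lebesgue_measure]_t F (vcons t v).
Proof.
move=> mF F0; rewrite integral_mu_succ//.
apply: (@fubini_tonelli _ _ (measurableTypeR R) (rVm R n) _ _ _ (fun p => F (vcons p.1 p.2))) => [|p]; last exact: F0.
by apply: (measurableT_comp mF); exact: measurable_vcons.
Qed.

Lemma integrable_mu_succ n (F : 'rV[R]_n.+1 -> R) :
  (mu R n.+1).-integrable setT (EFin \o F) ->
  (@lebesgue_measure R \x mu R n).-integrable setT (fun p => (F (vcons p.1 p.2))%:E).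
Proof.
move=> /integrableP[mF iF]; apply/integrableP; split.
  by apply: (measurableT_comp mF); exact: measurable_vcons.
rewrite integral_mu_succ// in iF; last exact: measurableT_comp.
rewrite fubini_tonelli1//; apply: measurableT_comp => //.
by apply: (measurableT_comp mF); exact: measurable_vcons.
Qed.

(** The integrals of the positive and negative parts are measurable in the parameter by Tonelli, and
    [fine] is measurable, so slices whose integral is infinite do no harm. *)
Lemma measurable_Rintegral_param d1 d2 (T1 : measurableType d1)
    (T2 : measurableType d2) (m : {sigma_finite_measure set T2 -> \bar R})
    (G : T1 * T2 -> R) : measurable_fun setT G ->
  measurable_fun setT (fun x => Rintegral m setT (fun y => G (x, y))).
Proof.
move=> mG; rewrite /Rintegral; apply: (@measurableT_comp _ _ _ _ _ _ fine _ (fun x => integral m setT (EFin \o (fun y => G (x, y))))) => //.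
have mE : measurable_fun setT (EFin \o G) by exact/measurable_EFinP.
have mp : measurable_fun setT ((EFin \o G)^\+)%E by exact: measurable_funepos.
have mn : measurable_fun setT ((EFin \o G)^\-)%E by exact: measurable_funeneg.
rewrite (_ : (fun x => _) = (fubini_F m ((EFin \o G)^\+)%E \- fubini_F m ((EFin \o G)^\-)%E)); last first.
  apply/funext => x; rewrite [LHS]integralE /fubini_F /=; congr (_ - _)%E; by apply: eq_integral => y _; rewrite ?funeposE ?funenegE.
apply: emeasurable_funB.
  exact: (measurable_fun_fubini_tonelli_F (m2 := m) _ mp (fun p => funepos_ge0 _ p)).
exact: (measurable_fun_fubini_tonelli_F (m2 := m) _ mn (fun p => funeneg_ge0 _ p)).
Qed.

(** The parameter space is arbitrary because, in the induction, the outermost integration variable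
    joins the parameter. *)
Lemma measurable_iint_param n d1 (T1 : measurableType d1) (G : T1 * 'rV[R]_n -> R) :
  measurable_fun setT G -> measurable_fun setT (fun x => iint (fun v => G (x, v))).
Proof.
elim: n d1 T1 G => [|n IH] d1 T1 G mG /=.
  exact: (measurableT_comp mG).
apply: (@measurable_Rintegral_param _ _ _ _ _ (fun p : T1 * measurableTypeR R =>
  iint (fun v => G (p.1, vcons p.2 v)))).
apply: (IH _ (T1 * measurableTypeR R)%type (fun p => G (p.1.1, vcons p.1.2 p.2))).
apply: (measurableT_comp mG); apply/measurable_fun_pair => //=.
  exact: (measurableT_comp (measurable_fst)).
apply: (@measurableT_comp _ _ _ _ _ _ (fun p : R * 'rV[R]_n => vcons p.1 p.2) _ (fun x : T1 * measurableTypeR R * 'rV[R]_n => (x.1.2, x.2)) (@measurable_vcons R n)).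
apply/measurable_fun_pair => //=.
exact: (measurableT_comp (measurable_snd)).
Qed.

(** Fubini, one coordinate at a time. A slice is integrable only for almost every [t], so the
    induction hypothesis yields an almost everywhere equality, and measurability of the inner
    iterated integral has to come from [measurable_iint_param]. *)
Lemma iintE n (F : 'rV[R]_n -> R) : (mu R n).-integrable setT (EFin \o F) ->
  iint F = Rintegral (mu R n) setT F.
Proof.
elim: n F => [|n IH] F iF.
  rewrite /= /Rintegral integral_dirac ?diracT ?mul1e//.
  by case/integrableP : iF.
have iFp := integrable_mu_succ iF.
rewrite /= /Rintegral.
have -> : \int[mu R n.+1]_v (F v)%:E =
    \int[lebesgue_measure \x mu R n]_p (F (vcons p.1 p.2))%:E.
  rewrite [LHS](_ : _ = \int[pushforward (@lebesgue_measure R \x mu R n)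
    (fun p : measurableTypeR R * 'rV[R]_n => vcons p.1 p.2)]_v (F v)%:E)//.
  rewrite integral_pushforward//; first exact: measurable_vcons.
  by case/integrableP : iF.
rewrite -integral12_prod_meas1//; congr fine.
apply: ae_eq_integral => //.
- apply/measurable_EFinP; apply: (@measurable_iint_param _ _ (measurableTypeR R) (fun p => F (vcons p.1 p.2))).
  by case/integrableP : iFp => /measurable_EFinP.
- exact: (measurable_fubini_F iFp).
- have := ae_integrable1 iFp.
  apply: filterS => t iFt _ /=.
  rewrite -/(vcons t) IH// /Rintegral fineK//.
  exact: integrable_fin_num.
Qed.
End tonelli.

(** * Euclidean norm and orthogonal invariance *)

Section euclid.
Context {R : realType} {n : nat}.
Implicit Types x y z : 'rV[R]_n.

Lemma edotC x y : edot x y = edot y x.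
Proof. by apply: eq_bigr => i _; rewrite mulrC. Qed.

Lemma edotDl x y z : edot (x + y) z = edot x z + edot y z.
Proof. by rewrite /edot -big_split; apply: eq_bigr => i _; rewrite mxE mulrDl. Qed.

Lemma edotZl (a : R) x y : edot (a *: x) y = a * edot x y.
Proof. by rewrite /edot mulr_sumr; apply: eq_bigr => i _; rewrite mxE mulrA. Qed.

Lemma edotDr x y z : edot z (x + y) = edot z x + edot z y.
Proof. by rewrite edotC edotDl !(edotC z). Qed.

Lemma edotZr (a : R) x y : edot x (a *: y) = a * edot x y.
Proof. by rewrite edotC edotZl edotC. Qed.

Lemma edotNl x y : edot (- x) y = - edot x y.
Proof. by rewrite -scaleN1r edotZl mulN1r. Qed.

Lemma edotNr x y : edot x (- y) = - edot x y.
Proof. by rewrite edotC edotNl edotC. Qed.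

Lemma edotBl x y z : edot (x - y) z = edot x z - edot y z.
Proof. by rewrite edotDl edotNl. Qed.

Lemma edotBr x y z : edot z (x - y) = edot z x - edot z y.
Proof. by rewrite edotDr edotNr. Qed.

Lemma edot0l x : edot 0 x = 0.
Proof. by rewrite -(scale0r 0) edotZl mul0r. Qed.

Lemma edot_ge0 x : 0 <= edot x x.
Proof. by apply: sumr_ge0 => i _; rewrite -expr2 sqr_ge0. Qed.

Lemma edot_eq0 x : edot x x = 0 -> x = 0.
Proof.
move=> /eqP; rewrite psumr_eq0; last by move=> i _; rewrite -expr2 sqr_ge0.
move=> /allP h; apply/rowP => i; rewrite mxE; apply/eqP.
by have := h i; rewrite mem_index_enum mulf_eq0 orbb; apply.
Qed.

Lemma eunorm_ge0 x : 0 <= eunorm x.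
Proof. exact: sqrtr_ge0. Qed.

Lemma eunormE x : eunorm x ^+ 2 = edot x x.
Proof. by rewrite sqr_sqrtr// edot_ge0. Qed.

Lemma eunorm_eq0 x : eunorm x = 0 -> x = 0.
Proof. by move=> h; apply: edot_eq0; rewrite -eunormE h expr0n. Qed.

Lemma eunorm0 : eunorm (0 : 'rV[R]_n) = 0.
Proof. by rewrite /eunorm edot0l sqrtr0. Qed.

Lemma eunormZ (a : R) x : eunorm (a *: x) = `|a| * eunorm x.
Proof. by rewrite /eunorm edotZl edotZr mulrA -expr2 sqrtrM ?sqr_ge0// sqrtr_sqr. Qed.

Lemma eunormN x : eunorm (- x) = eunorm x.
Proof. by rewrite /eunorm edotNl edotNr opprK. Qed.

Lemma eunorm_gt0 x : x != 0 -> 0 < eunorm x.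
Proof.
by move=> x0; rewrite lt_def eunorm_ge0 andbT; apply: contra x0 => /eqP/eunorm_eq0->.
Qed.

Lemma CauchySchwarz_eu x y : `|edot x y| <= eunorm x * eunorm y.
Proof.
rewrite -(@ler_pXn2r _ 2)// ?nnegrE ?mulr_ge0 ?eunorm_ge0//.
rewrite real_normK ?num_real// exprMn !eunormE.
have [->|y0] := eqVneq y 0; first by rewrite edotC !edot0l expr0n mulr0.
have yy : 0 < edot y y by rewrite -eunormE exprn_gt0// eunorm_gt0.
have := edot_ge0 (edot y y *: x - edot x y *: y).
rewrite !(edotBl, edotBr, edotZl, edotZr) (edotC y x) => h.
rewrite -subr_ge0 -(pmulr_rge0 _ yy); apply: le_trans h _.
by rewrite le_eqVlt; apply/orP; left; apply/eqP; ring.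
Qed.

Lemma ler_eunormD x y : eunorm (x + y) <= eunorm x + eunorm y.
Proof.
rewrite -(@ler_pXn2r _ 2)// ?nnegrE ?addr_ge0 ?eunorm_ge0//.
rewrite sqrrD !eunormE edotDl !edotDr (edotC y x).
have := le_trans (ler_norm _) (CauchySchwarz_eu x y); lra.
Qed.

Lemma ler_eunorm_dist x y : `|eunorm x - eunorm y| <= eunorm (x - y).
Proof.
have := ler_eunormD (x - y) y; have := ler_eunormD (y - x) x.
rewrite !subrK -(opprB x y) eunormN => h1 h2.
by rewrite ler_norml; apply/andP; split; lra.
Qed.

Lemma ler_coord_eunorm x i : `|x ord0 i| <= eunorm x.
Proof.
rewrite -sqrtr_sqr ler_wsqrtr// /edot (bigD1 i)//= -expr2 lerDl.
by apply: sumr_ge0 => j _; rewrite -expr2 sqr_ge0.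
Qed.

Lemma ler_norm_eunorm x : `|x| <= eunorm x.
Proof.
rewrite -[`|x|]/(mx_norm x) mx_normrE.
apply/bigmax_leP; split => [|[i j] _ /=]; first exact: eunorm_ge0.
by rewrite (ord1 i) ler_coord_eunorm.
Qed.

Lemma ler_eunorm_sum x : eunorm x <= \sum_(i < n) `|x ord0 i|.
Proof.
have S0 : 0 <= \sum_(i < n) `|x ord0 i| by apply: sumr_ge0.
rewrite -(@ler_pXn2r _ 2)// ?nnegrE ?eunorm_ge0// eunormE expr2 mulr_suml.
apply: ler_sum => i _; rewrite -expr2 -real_normK ?num_real// expr2 ler_wpM2l//.
by rewrite (bigD1 i)//= lerDl sumr_ge0.
Qed.

Lemma ler_eunorm_norm x : eunorm x <= n%:R * `|x|.
Proof.
apply: le_trans (ler_eunorm_sum x) _.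
rewrite -[n in n%:R]card_ord mulrC mulr_natr -sumr_const; apply: ler_sum => i _.
rewrite -[`|x|]/(mx_norm x) mx_normrE.
by apply: (le_bigmax_cond 0 (fun ij : 'I_1 * 'I_n => `|x ij.1 ij.2|) (j := (ord0, i))).
Qed.

(** The topology on row vectors is that of the maximum norm; passing to it from [eunorm] costs the
    factor [n]. *)
Lemma lipschitz_continuous_rV (f : 'rV[R]_n -> R) (C : R) :
  (forall x y, `|f x - f y| <= C * eunorm (x - y)) -> continuous f.
Proof.
move=> fC x; apply/(@cvgrPdist_le _ _ _ _ (nbhs_filter x)) => e e0.
have C0 : 0 <= n%:R * `|C| by rewrite mulr_ge0.
have ne : 0 < e / (n%:R * `|C| + 1) by rewrite divr_gt0// ltr_wpDl.
have : \forall y \near x, `|x - y| < e / (n%:R * `|C| + 1).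
  by apply/nbhs_ballP; exists (e / (n%:R * `|C| + 1)) => // y; rewrite mx_norm_ball.
apply: filterS => y; rewrite ltr_pdivlMr ?ltr_wpDl// => h.
apply: le_trans (fC x y) _.
apply: (@le_trans _ _ (`|C| * (n%:R * `|x - y|))).
  by apply: le_trans (ler_wpM2r (eunorm_ge0 _) (ler_norm C)) _; apply: ler_wpM2l; rewrite ?ler_eunorm_norm.
by apply: le_trans (ltW h); rewrite mulrDr mulr1 (_ : `|C| * _ = `|x - y| * (n%:R * `|C|)) ?lerDl//; ring.
Qed.

Lemma eunorm_continuous : continuous (@eunorm R n).
Proof.
by apply: (@lipschitz_continuous_rV _ 1) => x y; rewrite mul1r ler_eunorm_dist.
Qed.

Lemma measurable_edot d1 (T : measurableType d1) (f h : T -> 'rV[R]_n) :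
  measurable_fun setT f -> measurable_fun setT h ->
  measurable_fun setT (fun t => edot (f t) (h t)).
Proof.
move=> /measurable_fun_rVP mf /measurable_fun_rVP mh.
by apply: measurable_sum => i; apply: measurable_funM.
Qed.

Lemma measurable_eunorm : measurable_fun setT (@eunorm R n).
Proof.
apply: (@measurableT_comp _ _ _ _ _ _ (@Num.sqrt R) _ (fun x => edot x x)).
  by apply: continuous_measurable_fun; exact: sqrt_continuous.
by apply: measurable_edot; exact: measurable_id.
Qed.

Lemma measurable_rVD d1 (T : measurableType d1) (f h : T -> 'rV[R]_n) :
  measurable_fun setT f -> measurable_fun setT h ->
  measurable_fun setT (fun t => f t + h t).
Proof.
move=> /measurable_fun_rVP mf /measurable_fun_rVP mh; apply/measurable_fun_rVP => i.
by under eq_fun do rewrite mxE; exact: measurable_funD.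
Qed.

Lemma measurable_rVZ d1 (T : measurableType d1) (f : T -> R) (h : T -> 'rV[R]_n) :
  measurable_fun setT f -> measurable_fun setT h ->
  measurable_fun setT (fun t => f t *: h t).
Proof.
move=> mf /measurable_fun_rVP mh; apply/measurable_fun_rVP => i.
by under eq_fun do rewrite mxE; exact: measurable_funM.
Qed.

Lemma measurable_mulmx m (M : 'M[R]_(n, m)) :
  measurable_fun setT (fun x : 'rV[R]_n => x *m M).
Proof.
apply/measurable_fun_rVP => i; under eq_fun do rewrite mxE.
by apply: measurable_sum => j; apply: measurable_funM => //; exact: measurable_coord.
Qed.

End euclid.

Lemma edot_vcons (R : realType) n (t u : R) (v w : 'rV[R]_n) :
  edot (vcons t v) (vcons u w) = t * u + edot v w.
Proof.
rewrite /edot big_ord_recl !vcons0; congr (_ + _).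
by apply: eq_bigr => i _; rewrite !vconsS.
Qed.

(** An open set is the union of the boxes with rational centre and radius 1/(k+1) that it contains,
    and there are countably many of them. *)
Lemma open_measurable_rV (R : realType) n (U : set 'rV[R]_n) : open U -> measurable U.
Proof.
move=> oU.
pose bx (q : 'rV[rat]_n * nat) : set 'rV[R]_n :=
  [set v | forall i, `|v ord0 i - ratr (q.1 ord0 i)| < (q.2.+1%:R)^-1].
have mbx q : measurable (bx q).
  have -> : bx q = \bigcap_(i in [set: 'I_n]) ((fun v : 'rV[R]_n => v ord0 i) @^-1`
      [set t | `|t - ratr (q.1 ord0 i)| < (q.2.+1%:R)^-1]).
    by apply/seteqP; split => [v h i _|v h i]; [exact: h | exact: (h i I)].
  apply: fin_bigcap_measurable => [|i _]; first exact: finite_finset.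
  rewrite -[X in measurable X]setTI; apply: measurable_coord => //.
  rewrite (_ : [set t | _] = `](ratr (q.1 ord0 i) - (q.2.+1%:R)^-1), (ratr (q.1 ord0 i) + (q.2.+1%:R)^-1)[%classic).
    exact: measurable_itv.
  by apply/seteqP; split => t /=; rewrite in_itv/= ltr_distl.
have -> : U = \bigcup_(q in [set q | bx q `<=` U]) bx q.
  apply/seteqP; split => [v Uv|v [q]]; last by move=> /= h; exact: h.
  have /nbhs_ballP[e /= e0 eU] : nbhs v U by exact: open_nbhs_nbhs.
  have [k ke] : exists k : nat, (k.+1%:R)^-1 + (k.+1%:R)^-1 < e.
    have e20 : 0 < e / 2 by rewrite divr_gt0.
    have [k _ /(_ _ (leqnn _))/= h] := near_infty_natSinv_lt (PosNum e20).
    by exists k; rewrite (splitr e) ltrD.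
  have rt0 (a t : R) : 0 < a -> exists q : rat, `|t - ratr q| < a.
    move=> a0; have [|q] := @rat_in_itvoo R (t - a) (t + a); first by lra.
    by rewrite in_itv/= => /andP[q1 q2]; exists q; rewrite ltr_norml; apply/andP; split; lra.
  have rt i : {q : rat | `|v ord0 i - ratr q| < (k.+1%:R)^-1}.
    by apply/cid/rt0; rewrite invr_gt0.
  exists (\row_i sval (rt i), k) => /=.
    move=> w wb; apply: eU; split => // i j; rewrite [i](_ : _ = ord0); last by rewrite !ord1.
    have := wb j; have := svalP (rt j); rewrite /= mxE => h1 h2.
    rewrite -ball_normE /=.
    apply: le_lt_trans (ler_distD (ratr (sval (rt j))) _ _) _.
    by apply: lt_trans ke; rewrite (distrC (ratr _)); exact: ltrD.
  by move=> i; rewrite /= mxE; exact: svalP (rt i).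
(* Boxes that leave [U] are replaced by the empty set, which makes the union range over a whole
   countable type. *)
rewrite (_ : \bigcup_(q in _) _ = \bigcup_q (if `[< bx q `<=` U >] then bx q else set0)).
  by apply: countable_bigcupT_measurable => // q; case: asboolP.
apply/seteqP; split => [v [q /= qU qv]|v [q _]]; first by exists q => //; case: asboolP.
by case: asboolP => // qU qv; exists q.
Qed.

Lemma continuous_measurable_rV (R : realType) n (f : 'rV[R]_n -> R) :
  continuous f -> measurable_fun setT f.
Proof.
move=> cf; apply: (measurability _ (RGenOpens.measurableE R)) => _ [_ [a [b ->] <-]].
rewrite setTI; apply: open_measurable_rV.
by apply: open_comp => [x _|]; [exact: cf | exact: interval_open].
Qed.

Lemma measurable_fun_b2r d (T : measurableType d) (R : realType) (b : T -> bool) :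
  measurable_fun setT b -> measurable_fun setT (fun x => (b x)%:R : R).
Proof.
by move=> mb; apply: (@measurableT_comp _ _ _ _ _ _ (fun c : bool => c%:R : R)).
Qed.

Section affine.
Context {R : realType}.
Local Notation leb := (@lebesgue_measure R).
Local Open Scope ereal_scope.

(** Both sides are measures in [A], so by uniqueness half-open intervals suffice; a negative [a]
    pulls them back to intervals closed on the other side. *)
Lemma lebesgue_affine (a b : R) (A : set R) : a != 0%R -> measurable A ->
  leb A = `|a|%:E * leb ((fun t => a * t + b)%R @^-1` A).
Proof.
move=> a0 mA.
have mphi : measurable_fun setT (fun t : measurableTypeR R => a * t + b : measurableTypeR R)%R.
  by apply: measurable_funD => //; exact: measurable_funM.
pose m' := mscale (NngNum (normr_ge0 a))
  (measure_function_pushforward__canonical__measure_function_Measure leb mphi).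
have -> : `|a|%:E * leb ((fun t => a * t + b)%R @^-1` A) = m' A by [].
apply: lebesgue_measure_unique => // _ [[x y] _ <-].
rewrite -[RHS]/(`|a|%:E * leb ((fun t => a * t + b)%R @^-1` `]x, y])).
rewrite lebesgue_measure_itv/= lte_fin.
have [a_gt0|a_lt0|/eqP] := ltgtP 0%R a; last by rewrite eq_sym (negbTE a0).
  rewrite (_ : _ @^-1` _ = [set` `](x - b) / a, (y - b) / a]%R]); last first.
    apply/seteqP; split => t /=; rewrite !in_itv/= ltr_pdivrMr// ler_pdivlMr// mulrC;
      rewrite ltrBlDr lerBrDr//.
  rewrite lebesgue_measure_itv/= lte_fin ltr_pM2r ?invr_gt0// ltrBrDr subrK.
  case: ltP => xy; last by rewrite mule0.
  by rewrite gtr0_norm// -!EFinD -EFinM; congr EFin; field.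
rewrite (_ : _ @^-1` _ = [set` `[(y - b) / a, (x - b) / a[%R]); last first.
  apply/seteqP; split => t /=; rewrite !in_itv/= ltr_ndivlMr// ler_ndivrMr// mulrC;
    by rewrite ltrBlDr lerBrDr// andbC.
rewrite lebesgue_measure_itv/= lte_fin ltr_nM2r ?invr_lt0// ltrBrDr subrK.
case: ltP => xy; last by rewrite mule0.
by rewrite ltr0_norm// -!EFinD -EFinM; congr EFin; field.
Qed.

Lemma ge0_integral_affine (a b : R) (F : R -> \bar R) : a != 0%R ->
  measurable_fun setT F -> (forall t, 0 <= F t) ->
  \int[leb]_t F (a * t + b)%R = `|a|^-1%:E * \int[leb]_t F t.
Proof.
move=> a0 mF F0.
have mphi : measurable_fun setT (fun t : measurableTypeR R => a * t + b : measurableTypeR R)%R.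
  by apply: measurable_funD => //; exact: measurable_funM.
have na : (0 <= `|a|^-1)%R by [].
transitivity (\int[mscale (NngNum na) leb]_t F t).
  transitivity (\int[pushforward leb (fun t : measurableTypeR R => a * t + b : measurableTypeR R)%R]_t F t).
    by rewrite ge0_integral_pushforward.
  apply: eq_measure_integral => A mA _.
  rewrite -[RHS]/(`|a|^-1%:E * leb A) (@lebesgue_affine a b) // muleA -EFinM.
  by rewrite mulVf ?mul1e// normr_eq0.
by rewrite ge0_integral_mscale.
Qed.

End affine.

Lemma scale_vcons (R : realType) n (c t : R) (v : 'rV[R]_n) :
  c *: vcons t v = vcons (c * t) (c *: v).
Proof.
apply/rowP => i; case: (unliftP ord0 i) => [j|] ->; rewrite mxE ?vconsS ?vcons0//.
by rewrite mxE.
Qed.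

Lemma add_vcons (R : realType) n (t u : R) (v w : 'rV[R]_n) :
  vcons t v + vcons u w = vcons (t + u) (v + w).
Proof.
apply/rowP => i; case: (unliftP ord0 i) => [j|] ->; rewrite mxE ?vconsS ?vcons0//.
by rewrite mxE.
Qed.

Section mu_invariance.
Context {R : realType}.
Local Open Scope ereal_scope.

Lemma measurable_vconsr n (t : R) : measurable_fun setT (fun v : 'rV[R]_n => vcons t v).
Proof.
apply: (@measurableT_comp _ _ _ _ _ _ (fun p : R * 'rV[R]_n => vcons p.1 p.2) _
  (fun v => (t, v)) (@measurable_vcons R n)).
exact: measurable_fun_pair.
Qed.

Lemma measurable_vconsl n (v : 'rV[R]_n) : measurable_fun setT (fun t : R => vcons t v).
Proof.
apply: (@measurableT_comp _ _ _ _ _ _ (fun p : R * 'rV[R]_n => vcons p.1 p.2) _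
  (fun t => (t, v)) (@measurable_vcons R n)).
exact: measurable_fun_pair.
Qed.

Lemma mu_affine n (a : R) (w : 'rV[R]_n) (F : 'rV[R]_n -> \bar R) : a != 0%R ->
  measurable_fun setT F -> (forall v, 0 <= F v) ->
  \int[mu R n]_v F (a *: v + w)%R = (`|a| ^- n)%:E * \int[mu R n]_v F v.
Proof.
elim: n w F => [|n IH] w F a0 mF F0.
  rewrite expr0 invr1 mul1e; apply: eq_integral => v _; congr F.
  by apply/rowP => -[].
have mG : measurable_fun setT (fun v : 'rV[R]_n.+1 => F (a *: v + w)%R).
  apply: (measurableT_comp mF); apply: measurable_rVD => //.
  by apply: measurable_rVZ => //; exact: measurable_id.
rewrite integral_mu_succ// integral_mu_succ//.
pose G t := \int[mu R n]_v F (vcons t v).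
have mGG : measurable_fun setT (G : measurableTypeR R -> _).
  apply: (@measurable_fun_fubini_tonelli_F _ _ (measurableTypeR R) (rVm R n) R (mu R n) (fun p => F (vcons p.1 p.2))) => [|p]; last exact: F0.
  by apply: (measurableT_comp mF); exact: measurable_vcons.
have G0 t : 0 <= G t by exact: integral_ge0.
transitivity (\int[lebesgue_measure]_t ((`|a| ^- n)%:E * G (a * t + w ord0 ord0)%R)).
  apply: eq_integral => t _.
  transitivity (\int[mu R n]_v F (vcons (a * t + w ord0 ord0) (a *: v + vtail w))%R).
    by apply: eq_integral => v _; rewrite scale_vcons -{1}(vcons_eta w) add_vcons.
  rewrite (IH (vtail w) (fun v => F (vcons (a * t + w ord0 ord0)%R v)))//.
  exact: (measurableT_comp mF (@measurable_vconsr n _)).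
have mGa : measurable_fun setT (fun t : measurableTypeR R => G (a * t + w ord0 ord0)%R).
  apply: (@measurableT_comp _ _ _ _ _ _ G _ (fun t : measurableTypeR R => a * t + w ord0 ord0 : measurableTypeR R)%R mGG).
  by apply: measurable_funD => //; exact: measurable_funM.
rewrite (ge0_integralZl_EFin _ measurableT (fun t _ => G0 _) mGa); last first.
  by rewrite invr_ge0 exprn_ge0.
rewrite ge0_integral_affine// muleA -EFinM; congr (_%:E * _).
by rewrite exprSr invfM mulrC.
Qed.

Lemma mu_translation n (w : 'rV[R]_n) (F : 'rV[R]_n -> \bar R) :
  measurable_fun setT F -> (forall v, 0 <= F v) ->
  \int[mu R n]_v F (v + w)%R = \int[mu R n]_v F v.
Proof.
move=> mF F0; have := @mu_affine n 1 w F (oner_neq0 _) mF F0.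
by under eq_integral do rewrite scale1r; rewrite normr1 expr1n invr1 mul1e.
Qed.

Lemma mu_scale n (a : R) (F : 'rV[R]_n -> \bar R) : a != 0%R ->
  measurable_fun setT F -> (forall v, 0 <= F v) ->
  \int[mu R n]_v F (a *: v)%R = (`|a| ^- n)%:E * \int[mu R n]_v F v.
Proof.
move=> a0 mF F0; rewrite -(@mu_affine n a 0)//.
by under [RHS]eq_integral do rewrite addr0.
Qed.

Lemma mu_opp n (F : 'rV[R]_n -> \bar R) :
  measurable_fun setT F -> (forall v, 0 <= F v) ->
  \int[mu R n]_v F (- v)%R = \int[mu R n]_v F v.
Proof.
move=> mF F0; have := @mu_scale n (-1) F; rewrite normrN1 expr1n invr1 mul1e.
rewrite oppr_eq0 oner_eq0 => /(_ isT mF F0) <-.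
by apply: eq_integral => v _; rewrite scaleN1r.
Qed.

(** The Gaussian serves three times: as the weight in the rotation argument, as the majorant behind
    [bvol_fin], and for the area of the disc. *)
Lemma mu_gauss n :
  \int[mu R n]_v (expR (- edot v v))%:E = (Num.sqrt pi ^+ n)%:E.
Proof.
elim: n => [|n IH].
  rewrite integral_dirac ?diracT ?mul1e//; first by rewrite edot0l oppr0 expR0.
  apply/measurable_EFinP; apply: measurableT_comp => //.
  by apply: measurableT_comp => //; apply: measurable_edot; exact: measurable_id.
have mE m : measurable_fun setT (fun v : 'rV[R]_m => (expR (- edot v v))%:E).
  apply/measurable_EFinP; apply: measurableT_comp => //.
  by apply: measurableT_comp => //; apply: measurable_edot; exact: measurable_id.
rewrite integral_mu_succ//.
transitivity (\int[@lebesgue_measure R]_t ((gauss_fun t)%:E * (Num.sqrt pi ^+ n)%:E)).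
  apply: eq_integral => t _; rewrite -IH -ge0_integralZl_EFin//.
  - by apply: eq_integral => v _; rewrite -EFinM -expRD edot_vcons opprD expr2.
  - exact: mE.
  - exact: gauss_fun_ge0.
rewrite ge0_integralZr//; first by rewrite integralT_gauss -EFinM exprS.
- by apply/measurable_EFinP; exact: measurable_gauss_fun.
- by move=> t _; rewrite lee_fin gauss_fun_ge0.
Qed.

End mu_invariance.

Opaque integral.

Lemma edot_mxE (R : realType) n (v w : 'rV[R]_n) : edot v w = (v *m w^T) ord0 ord0.
Proof. by rewrite mxE; apply: eq_bigr => i _; rewrite mxE. Qed.

Lemma edot_orth (R : realType) n (M : 'M[R]_n) (v w : 'rV[R]_n) :
  M *m M^T = 1%:M -> edot (v *m M) (w *m M) = edot v w.
Proof. by move=> hM; rewrite !edot_mxE trmx_mul mulmxA -(mulmxA v) hM mulmx1. Qed.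

Lemma eunorm_orth (R : realType) n (M : 'M[R]_n) (v : 'rV[R]_n) :
  M *m M^T = 1%:M -> eunorm (v *m M) = eunorm v.
Proof. by move=> hM; rewrite /eunorm edot_orth. Qed.

Lemma tonelli_swap d1 d2 (T1 : measurableType d1) (T2 : measurableType d2) (R : realType)
    (m1 : {sigma_finite_measure set T1 -> \bar R})
    (m2 : {sigma_finite_measure set T2 -> \bar R}) (f : T1 -> T2 -> \bar R) :
  measurable_fun setT (fun p : T1 * T2 => f p.1 p.2) -> (forall x y, (0 <= f x y)%E) ->
  (\int[m1]_x \int[m2]_y f x y = \int[m2]_y \int[m1]_x f x y)%E.
Proof. by move=> mf f0; exact: (fubini_tonelli (fun p : T1 * T2 => f p.1 p.2)). Qed.

Lemma measurable_rVB (R : realType) n d1 (T : measurableType d1) (f h : T -> 'rV[R]_n) :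
  measurable_fun setT f -> measurable_fun setT h ->
  measurable_fun setT (fun t => f t - h t).
Proof.
move=> /measurable_fun_rVP mf /measurable_fun_rVP mh; apply/measurable_fun_rVP => i.
by under eq_fun do rewrite !mxE; exact: measurable_funB.
Qed.

Section orth.
Context {R : realType}.
Local Open Scope ereal_scope.

(* Uniqueness of Haar measure by Tonelli: with F rotation invariant, the double
   integral of F(xM) G(xM + y) equals both (int F)(int G) and (int F)(int G o M). *)
Let mu_orth_aux n (M : 'M[R]_n) (F G : 'rV[R]_n -> \bar R) (c : R) : M *m M^T = 1%:M ->
  measurable_fun setT F -> (forall v, 0 <= F v) ->
  (forall v, F (v *m M) = F v) -> \int[mu R n]_v F v = c%:E -> (0 < c)%R ->
  measurable_fun setT G -> (forall v, 0 <= G v) ->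
  \int[mu R n]_v G (v *m M) = \int[mu R n]_v G v.
Proof.
move=> hM mF F0 FM IF c0 mG G0; have hM' := mulmx1C hM.
have mM1 : measurable_fun setT (fun p : rVm R n * rVm R n => p.1 *m M).
  exact: (measurableT_comp (measurable_mulmx M) (@measurable_fst _ _ (rVm R n) (rVm R n))).
have mM2 : measurable_fun setT (fun p : rVm R n * rVm R n => p.2 *m M).
  exact: (measurableT_comp (measurable_mulmx M) (@measurable_snd _ _ (rVm R n) (rVm R n))).
have s1 : measurable_fun setT (@fst (rVm R n) (rVm R n)) by exact: measurable_fst.
have mMG : measurable_fun setT (fun v : 'rV[R]_n => G (v *m M)).
  exact: (measurableT_comp mG (measurable_mulmx M)).
have s2 : measurable_fun setT (@snd (rVm R n) (rVm R n)) by exact: measurable_snd.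
have E1 : \int[mu R n]_x \int[mu R n]_y (F (x *m M) * G (y + x *m M)%R) =
    c%:E * \int[mu R n]_v G v.
  transitivity (\int[mu R n]_x (F x * \int[mu R n]_v G v)).
    apply: eq_integral => x _; rewrite FM ge0_integralZl//.
    - by rewrite mu_translation.
    - apply: (measurableT_comp mG); apply: measurable_rVD; first exact: measurable_id.
      exact: measurable_cst.
  by rewrite ge0_integralZr ?IF// integral_ge0.
have E2 : \int[mu R n]_x \int[mu R n]_y (F (x *m M) * G (y + x *m M)%R) =
    \int[mu R n]_y \int[mu R n]_x (F (x *m M - y)%R * G (x *m M)).
  have sw := @tonelli_swap _ _ (rVm R n) (rVm R n) R (mu R n) (mu R n)
    (fun x y => F (x *m M) * G (y + x *m M)%R).
  rewrite {}sw; last 2 first.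
  - apply: emeasurable_funM; first exact: (measurableT_comp mF mM1).
    exact: (measurableT_comp mG (measurable_rVD s2 mM1)).
  - by move=> x y; rewrite mule_ge0.
  apply: eq_integral => y _ /=.
  (* Shifting [x] by [- (y *m M^T)] shifts [x *m M] by [- y], since [M^T *m M = 1%:M]. *)
  rewrite -(@mu_translation _ _ (- (y *m M^T))%R (fun x => F (x *m M) * G (y + x *m M)%R)).
  - by apply: eq_integral => x _; rewrite mulmxBl -mulmxA hM' mulmx1 (addrC y) subrK.
  - apply: emeasurable_funM; first exact: (measurableT_comp mF (measurable_mulmx M)).
    apply: (measurableT_comp mG); apply: measurable_rVD; first exact: measurable_cst.
    exact: measurable_mulmx.
  - by move=> x; rewrite mule_ge0.
have E3 : \int[mu R n]_y \int[mu R n]_x (F (x *m M - y)%R * G (x *m M)) =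
    c%:E * \int[mu R n]_v G (v *m M).
  have sw := @tonelli_swap _ _ (rVm R n) (rVm R n) R (mu R n) (mu R n)
    (fun y x => F (x *m M - y)%R * G (x *m M)).
  rewrite {}sw; last 2 first.
  - apply: emeasurable_funM; last exact: (measurableT_comp mG mM2).
    exact: (measurableT_comp mF (measurable_rVB mM2 s1)).
  - by move=> x y; rewrite mule_ge0.
  transitivity (\int[mu R n]_x (\int[mu R n]_v F v * G (x *m M))).
    apply: eq_integral => x _ /=.
    have mFy : measurable_fun setT (fun y : rVm R n => F (x *m M - y)%R).
      apply: (measurableT_comp mF).
      by apply: measurable_rVB; [exact: measurable_cst | exact: measurable_id].
    have mFy' : measurable_fun setT (fun y : rVm R n => F (y + x *m M)%R).
      apply: (measurableT_comp mF).
      by apply: measurable_rVD; [exact: measurable_id | exact: measurable_cst].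
    rewrite (ge0_integralZr _ measurableT mFy (fun y _ => F0 _) (G0 _)).
    congr (_ * _); rewrite -(mu_translation (x *m M) mF F0) -(mu_opp mFy' (fun y => F0 _)).
    by apply: eq_integral => y _; rewrite addrC.
  rewrite (ge0_integralZl _ measurableT mMG (fun y _ => G0 _)) IF//.
  by rewrite lee_fin ltW.
have : c%:E * \int[mu R n]_v G (v *m M) = c%:E * \int[mu R n]_v G v by rewrite -E1 E2 E3.
move=> /(congr1 (fun z => c^-1%:E * z)).
by rewrite !muleA -EFinM mulVf ?(gt_eqF c0) // !mul1e.
Qed.

(** The Gaussian is the rotation-invariant weight of finite positive integral that the argument asks
    for. *)
Lemma mu_orth n (M : 'M[R]_n) (G : 'rV[R]_n -> \bar R) : M *m M^T = 1%:M ->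
  measurable_fun setT G -> (forall v, 0 <= G v) ->
  \int[mu R n]_v G (v *m M) = \int[mu R n]_v G v.
Proof.
move=> hM; apply: (@mu_orth_aux _ M (fun v => (expR (- edot v v))%:E) G _ hM).
- apply/measurable_EFinP; apply: measurableT_comp => //.
  by apply: measurableT_comp => //; apply: measurable_edot; exact: measurable_id.
- by move=> v; rewrite lee_fin expR_ge0.
- by move=> v; rewrite edot_orth.
- exact: mu_gauss.
- by rewrite exprn_gt0// sqrtr_gt0 pi_gt0.
Qed.

(** Tonelli for a radial weight written as a superposition of indicators of balls. It replaces polar
    coordinates throughout: for the ball volumes, for the second moment of a homogeneous function,
    and for the truncated kernel. *)
Lemma integral_balls n (H : 'rV[R]_n -> R) (ka : R -> R) :
  measurable_fun setT H -> (forall v, 0 <= H v)%R ->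
  measurable_fun setT ka -> (forall a, 0 <= ka a)%R ->
  \int[mu R n]_v ((H v)%:E * \int[lebesgue_measure]_a (ka a * (eunorm v <= a)%R%:R)%:E) =
  \int[lebesgue_measure]_a ((ka a)%:E * \int[mu R n]_v (H v * (eunorm v <= a)%R%:R)%:E).
Proof.
move=> mH H0 mka ka0.
have mi : measurable_fun setT (fun p : rVm R n * measurableTypeR R => (eunorm p.1 <= p.2)%R%:R : R).
  apply: measurable_fun_b2r; apply: measurable_fun_ler => //.
  by apply: (measurableT_comp measurable_eunorm).
have mil (v : rVm R n) : measurable_fun setT (fun a : measurableTypeR R => (eunorm v <= a)%R%:R : R).
  by apply: measurable_fun_b2r; apply: measurable_fun_ler.
have mir (a : R) : measurable_fun setT (fun v : rVm R n => (eunorm v <= a)%R%:R : R).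
  by apply: measurable_fun_b2r; apply: measurable_fun_ler => //; exact: measurable_eunorm.
transitivity (\int[mu R n]_v \int[@lebesgue_measure R]_a (H v * (ka a * (eunorm v <= a)%R%:R))%:E).
  apply: eq_integral => v _; rewrite -ge0_integralZl//.
  - by apply/measurable_EFinP; apply: measurable_funM.
  - by move=> a _; rewrite lee_fin mulr_ge0.
  - by rewrite lee_fin.
rewrite (@fubini_tonelli _ _ (rVm R n) (measurableTypeR R) R (mu R n) (@lebesgue_measure R)
  (fun p => (H p.1 * (ka p.2 * (eunorm p.1 <= p.2)%R%:R))%:E)); last 2 first.
- apply/measurable_EFinP; apply: measurable_funM; first exact: (measurableT_comp mH).
  by apply: measurable_funM => //; exact: (measurableT_comp mka).
- by move=> p; rewrite lee_fin !mulr_ge0.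
apply: eq_integral => a _; rewrite -ge0_integralZl//.
- by apply: eq_integral => v _; rewrite -EFinM /=; congr EFin; ring.
- by apply/measurable_EFinP; apply: measurable_funM.
- by move=> v _; rewrite lee_fin mulr_ge0.
- by rewrite lee_fin.
Qed.

End orth.

(** * Volume of the ball *)

Section FTC.
Context {R : realType}.
Local Notation leb := (@lebesgue_measure R).

Lemma FTC_segment (F f : R -> R) (x y : R) : x <= y ->
  (forall t, x <= t <= y -> is_derive t 1 F (f t)) ->
  (forall t, x <= t <= y -> {for t, continuous f}) ->
  (\int[leb]_(t in `[x, y]) (f t)%:E = (F y - F x)%:E)%E.
Proof.
rewrite le_eqVlt => /orP[/eqP <- _ _|xy dF cf].
  by rewrite set_itv1 integral_set1 subrr.
have dF' t : x <= t <= y -> derivable F t 1 by move=> /dF[].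
have cF t : x <= t <= y -> {for t, continuous F}.
  by move=> /dF' /derivable1_diffP /differentiable_continuous.
rewrite (@continuous_FTC2 _ f F)//.
- by apply: continuous_in_subspaceT => t; rewrite inE/= in_itv/=; exact: cf.
- split.
  + by move=> t; rewrite in_itv/= => /andP[xt ty]; apply: dF'; rewrite !ltW.
  + by apply: cvg_at_right_filter; apply: cF; rewrite lexx ltW.
  + by apply: cvg_at_left_filter; apply: cF; rewrite lexx ltW.
- move=> t; rewrite in_itv/= => /andP[xt ty]; rewrite derive1E.
  have /dF[] : x <= t <= y by rewrite !ltW.
  by [].
Qed.

Lemma FTC_halfline (F f : R -> R) (x l : R) :
  (forall t, x <= t -> is_derive t 1 F (f t)) ->
  (forall t, x <= t -> {for t, continuous f}) ->
  (forall t, x <= t -> 0 <= f t) ->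
  F t @[t --> +oo] --> l ->
  (\int[leb]_(t in `[x, +oo[) (f t)%:E = (l - F x)%:E)%E.
Proof.
move=> dF cf f0 Fl.
have dF' t : x <= t -> derivable F t 1 by move=> /dF[].
rewrite (@ge0_continuous_FTC2y _ f F x l)//.
- by apply: continuous_in_subspaceT => t; rewrite inE/= in_itv/= andbT; exact: cf.
- by move=> t /ltW; exact: dF'.
- apply: cvg_at_right_filter.
  by have /derivable1_diffP /differentiable_continuous := dF' x (lexx _).
- move=> t; rewrite in_itv/= andbT => xt; rewrite derive1E.
  by have /dF[] : x <= t by rewrite ltW.
Qed.

Lemma is_derive_continuous (f : R -> R) (x df : R) :
  is_derive x 1 f df -> {for x, continuous f}.
Proof. by case => /derivable1_diffP /differentiable_continuous. Qed.

End FTC.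

Lemma is_derive_expn (R : realType) n (t : R) :
  is_derive t (1 : R) (fun t : R => t ^+ n.+1) (n.+1%:R * t ^+ n).
Proof.
apply: DeriveDef; first exact: exprn_derivable.
by rewrite exp_derive /GRing.scale/= mulr1.
Qed.

Section ball_volume.
Context {R : realType}.
Local Notation leb := (@lebesgue_measure R).
Local Open Scope ereal_scope.

(** The actual volume of the unit ball, as opposed to the recursively defined constant [ball_vol];
    [bvolE] identifies the two. *)
Definition bvol n : \bar R := \int[mu R n]_v ((eunorm v <= 1)%R%:R)%:E.

Lemma measurable_cball n (a : R) :
  measurable_fun setT (fun v : 'rV[R]_n => (eunorm v <= a)%R%:R : R).
Proof.
by apply: measurable_fun_b2r; apply: measurable_fun_ler => //; exact: measurable_eunorm.
Qed.

Lemma int_cball n (a : R) : (0 < a)%R ->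
  \int[mu R n]_v ((eunorm v <= a)%R%:R)%:E = (a ^+ n)%:E * bvol n.
Proof.
move=> a0.
have a'0 : (0 < a^-1)%R by rewrite invr_gt0.
have := @mu_scale R n a^-1 (fun v => ((eunorm v <= 1)%R%:R)%:E).
rewrite gt_eqF// => /(_ isT).
rewrite -/(bvol n) gtr0_norm// -exprVn invrK => <-.
- by apply: eq_integral => v _; rewrite eunormZ gtr0_norm// ler_pdivrMl// mulr1.
- by apply/measurable_EFinP; exact: measurable_cball.
- by move=> v; rewrite lee_fin.
Qed.

(** On the unit ball, 1 <= exp(1 - |v|^2), and the right-hand side has finite integral. *)
Lemma bvol_fin n : bvol n \is a fin_num.
Proof.
rewrite ge0_fin_numE; last by apply: integral_ge0 => v _; rewrite lee_fin.
apply: (@le_lt_trans _ _ (\int[mu R n]_v ((expR 1)%:E * (expR (- edot v v))%:E))).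
  apply: ge0_le_integral => //.
  - by apply/measurable_EFinP; exact: measurable_cball.
  - apply/measurable_EFinP; apply: measurable_funM => //; apply: measurableT_comp => //.
    by apply: measurableT_comp => //; apply: measurable_edot; exact: measurable_id.
  - move=> v _; rewrite -EFinM lee_fin -expRD; have [h|h] := boolP (eunorm v <= 1)%R; last by rewrite expR_ge0.
    by rewrite -[leLHS]expR0 ler_expR subr_ge0 -eunormE exprn_ile1 ?eunorm_ge0.
rewrite ge0_integralZl_EFin ?expR_ge0//; first by rewrite mu_gauss -EFinM ltry.
apply/measurable_EFinP; apply: measurableT_comp => //.
by apply: measurableT_comp => //; apply: measurable_edot; exact: measurable_id.
Qed.

(** Scaling only reaches positive radii. For radius [a <= 1] the volume is at most [a] times a
    constant, which is made smaller than [e]. *)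
Lemma int_cball0 n : \int[mu R n.+1]_v ((eunorm v <= 0)%R%:R)%:E = 0.
Proof.
apply/eqP; rewrite eq_le; apply/andP; split; last first.
  by apply: integral_ge0 => v _; rewrite lee_fin.
apply/lee_addgt0Pr => e e0; rewrite add0e.
have b0 : (0 <= fine (bvol n.+1))%R.
  by rewrite fine_ge0//; apply: integral_ge0 => v _; rewrite lee_fin.
pose a := Num.min 1%R (e / (fine (bvol n.+1) + 1))%R.
have a0 : (0 < a)%R by rewrite lt_min ltr01 divr_gt0// ltr_wpDl.
apply: (@le_trans _ _ (\int[mu R n.+1]_v ((eunorm v <= a)%R%:R)%:E)).
  apply: ge0_le_integral => //.
  - by apply/measurable_EFinP; exact: measurable_cball.
  - by apply/measurable_EFinP; exact: measurable_cball.
  - move=> v _; rewrite lee_fin; have [h|h] := boolP (eunorm v <= 0)%R => //.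
    by rewrite (le_trans h (ltW a0)).
rewrite int_cball// -(fineK (bvol_fin _)) -EFinM lee_fin.
have a1 : (a <= 1)%R by rewrite ge_min lexx.
have : (a <= e / (fine (bvol n.+1) + 1))%R by rewrite ge_min lexx orbT.
rewrite ler_pdivlMr ?ltr_wpDl// => h; apply: le_trans h.
apply: ler_pM => //; first by rewrite exprn_ge0// ltW.
  by rewrite exprS ler_piMr ?exprn_ile1// ltW.
by rewrite lerDl.
Qed.

Lemma bvol0 : bvol 0 = 1.
Proof.
rewrite /bvol integral_dirac ?diracT ?mul1e//; first by rewrite eunorm0 ler01.
by apply/measurable_EFinP; exact: measurable_cball.
Qed.

Lemma eunorm_vcons n (t : R) (v : 'rV[R]_n) :
  eunorm (vcons t v) = Num.sqrt (t ^+ 2 + eunorm v ^+ 2).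
Proof. by rewrite eunormE {1}/eunorm edot_vcons expr2. Qed.

Lemma ler_sqrt_sqr (a r : R) : (0 <= a)%R -> (0 <= r)%R -> (Num.sqrt a <= r)%R = (a <= r ^+ 2)%R.
Proof. by move=> a0 r0; rewrite -{2}(sqr_sqrtr a0) ler_sqr ?nnegrE ?sqrtr_ge0. Qed.

Lemma rV0E (v : 'rV[R]_0) : v = 0%R. Proof. by apply/rowP => -[]. Qed.

Lemma bvol1 : bvol 1 = 2%:E.
Proof.
rewrite /bvol integral_mu_succ; last 2 first.
- by apply/measurable_EFinP; exact: measurable_cball.
- by move=> v; rewrite lee_fin.
transitivity (\int[leb]_t (\1_(`[(-1)%R, 1%R]) t)%:E).
  apply: eq_integral => t _.
  transitivity (\int[mu R 0]_v cst ((`|t| <= 1)%R%:R)%:E v).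
    by apply: eq_integral => v _; rewrite (rV0E v) eunorm_vcons eunorm0 expr0n addr0 sqrtr_sqr.
  rewrite integral_cst// -[X in _ * X]/(dirac (0%R : 'rV[R]_0) setT) diracT mule1 indicE.
  congr (_%:R%:E).
  by rewrite mem_setE in_itv/= ler_norml.
rewrite integral_indic// setIT.
have := @lebesgue_measure_itv R `[(-1)%R, 1%R]; rewrite /= lte_fin => ->.
rewrite ifT; last by lra.
by rewrite -EFinD; congr EFin; lra.
Qed.

Lemma integral_ler_ind (k : R -> R) (x : R) :
  \int[leb]_a (k a * (x <= a)%R%:R)%:E = \int[leb]_(a in `[x, +oo[) (k a)%:E.
Proof.
rewrite [RHS]integral_mkcond; apply: eq_integral => a _; rewrite patchE mem_setE in_itv/= andbT.
by case: leP => _; rewrite ?mulr1 ?mulr0.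
Qed.

(** Its integral over [[x, +oo[] is exp(-x^2) for x >= 0, so it writes the Gaussian as a
    superposition of balls. *)
Let ka2 (a : R) : R := (if 0 <= a then 2 * a * expR (- a ^+ 2) else 0)%R.

Let ka2_ge0 a : (0 <= ka2 a)%R.
Proof. by rewrite /ka2; case: ifPn => // a0; rewrite !mulr_ge0 ?expR_ge0. Qed.

Let d1 (t : R) : is_derive t (1%R : R) (fun t : R => - expR (- t ^+ 2))%R (2 * t * expR (- t ^+ 2))%R.
Proof.
apply: is_derive_eq; rewrite /GRing.scale/=; ring.
Qed.

Let d2 (t : R) : is_derive t (1%R : R) (fun t : R => - ((t ^+ 2 + 1) * expR (- t ^+ 2)))%R
   (2 * t * expR (- t ^+ 2) * t ^+ 2)%R.
Proof.
apply: is_derive_eq; rewrite /GRing.scale/=; ring.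
Qed.

Let cvg_sqr_gauss : ((t ^+ 2 + 1) * expR (- t ^+ 2))%R @[t --> (+oo)%R] --> (0 : R)%R.
Proof.
apply/cvgr0Pnorm_le => e e0; near=> t.
have t1 : (1 <= t)%R by near: t; apply: nbhs_pinfty_ge; exact: num_real.
have te : (4 / e <= t)%R by near: t; apply: nbhs_pinfty_ge; exact: num_real.
have t0 : (0 <= t ^+ 2)%R by rewrite sqr_ge0.
rewrite ger0_norm; last by rewrite mulr_ge0 ?expR_ge0 ?addr_ge0.
rewrite expRN ler_pdivrMr ?expR_gt0//.
apply: (@le_trans _ _ (e * (1 + (t ^+ 2) ^+ 2 / 2))%R).
  have : (4 <= e * t)%R by move: te; rewrite ler_pdivrMr// mulrC.
  set y := (t ^+ 2)%R; have ty : (t <= y)%R by rewrite /y expr2 ler_peMl// (le_trans ler01).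
  move=> et; have ey : (4 <= e * y)%R by apply: le_trans et _; rewrite ler_wpM2l// ltW.
  have -> : (e * (1 + y ^+ 2 / 2) = e + (e * y) * y / 2)%R by rewrite expr2; field.
  have : (4 * y <= e * y * y)%R by rewrite ler_wpM2r.
  by have := le_trans t1 ty; lra.
by apply: ler_wpM2l; [exact: ltW | exact: (expR_ge1Dxn 1 t0)].
Unshelve. all: by end_near. Qed.

(** The Gaussian has integral pi over the plane. As a superposition of discs of radius t it has
    integral [bvol 2] times that of 2 t^3 exp(-t^2) over the half-line, which is 1. *)
Lemma bvol2 : bvol 2 = pi%:E.
Proof.
have ge0 v : (0 <= @eunorm R 2 v)%R := eunorm_ge0 v.
have mka : measurable_fun setT ka2.
  apply: measurable_fun_ifT.
  - exact: measurable_fun_ler.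
  - apply: measurable_funM; first exact: measurable_funM.
    apply: measurableT_comp => //; apply: measurableT_comp => //; exact: measurable_funX.
  - exact: measurable_cst.
have e2 : (Num.sqrt pi ^+ 2)%R = pi :> R by rewrite sqr_sqrtr// pi_ge0.
rewrite -e2 -mu_gauss.
have H := @integral_balls R 2 (cst 1%R) ka2 (@measurable_cst _ _ _ _ _ _) (fun=> ler01) mka ka2_ge0.
transitivity (\int[leb]_a ((ka2 a)%:E * \int[mu R 2]_v (cst 1 v * (eunorm v <= a)%R%:R)%:E)); last first.
  rewrite -H; apply: eq_integral => v _; rewrite mul1e integral_ler_ind.
  transitivity (\int[leb]_(t in `[eunorm v, +oo[) (2 * t * expR (- t ^+ 2))%:E).
    apply: eq_integral => t; rewrite inE/= in_itv/= andbT => vt.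
    by rewrite /ka2 (le_trans (ge0 v) vt).
  rewrite (@FTC_halfline _ (fun t : R => - expR (- t ^+ 2))%R _ (eunorm v) 0 (fun t _ => d1 t)).
  - by rewrite sub0r opprK eunormE.
  - by move=> t _; apply: is_derive_continuous; apply: is_derive_eq.
  - by move=> t vt; rewrite !mulr_ge0 ?expR_ge0// (le_trans (ge0 v) vt).
  - by rewrite -oppr0; apply: cvgN; exact: cvg_gauss_fun.
transitivity (\int[leb]_(t in `[0%R, +oo[) (2 * t * expR (- t ^+ 2) * t ^+ 2)%:E * bvol 2).
  rewrite (@FTC_halfline _ (fun t : R => - ((t ^+ 2 + 1) * expR (- t ^+ 2)))%R _ 0%R 0 (fun t _ => d2 t)).
  - by rewrite expr0n/= !add0r oppr0 expR0 mulr1 opprK mul1e.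
  - by move=> t _; apply: is_derive_continuous; apply: is_derive_eq.
  - by move=> t vt; rewrite !mulr_ge0 ?expR_ge0// ?sqr_ge0.
  - by rewrite -oppr0; apply: cvgN; exact: cvg_sqr_gauss.
rewrite -ge0_integralZr//; last 3 first.
- apply/measurable_funTS/measurable_EFinP; apply: measurable_funM; last exact: measurable_funX.
  apply: measurable_funM; first exact: measurable_funM.
  apply: measurableT_comp => //; apply: measurableT_comp => //; exact: measurable_funX.
- by move=> t; rewrite /= in_itv/= andbT => vt; rewrite lee_fin !mulr_ge0 ?expR_ge0// ?sqr_ge0.
- by apply: integral_ge0 => v _; rewrite lee_fin.
rewrite integral_mkcond; apply: eq_integral => t _.
rewrite patchE mem_setE in_itv/= andbT /ka2.
case: ifPn => t0; last by rewrite mul0e.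
under eq_integral do rewrite mul1r.
have [->|t0'] := eqVneq t 0%R; first by rewrite mulr0 !mul0r !mul0e.
by rewrite int_cball ?muleA ?EFinM// lt_def t0'.
Qed.

Lemma measurable_slicel n (F : 'rV[R]_n.+1 -> \bar R) :
  measurable_fun setT F -> (forall v, 0 <= F v) ->
  measurable_fun setT (fun w : rVm R n => \int[leb]_t F (vcons t w)).
Proof.
move=> mF F0.
apply: (@measurable_fun_fubini_tonelli_G _ _ (measurableTypeR R) (rVm R n) R leb (fun p => F (vcons p.1 p.2))) => [|p]; last exact: F0.
exact: (measurableT_comp mF (@measurable_vcons R n)).
Qed.

Lemma measurable_slicer n (F : 'rV[R]_n.+1 -> \bar R) :
  measurable_fun setT F -> (forall v, 0 <= F v) ->
  measurable_fun setT (fun t : measurableTypeR R => \int[mu R n]_w F (vcons t w)).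
Proof.
move=> mF F0.
apply: (@measurable_fun_fubini_tonelli_F _ _ (measurableTypeR R) (rVm R n) R (mu R n) (fun p => F (vcons p.1 p.2))) => [|p]; last exact: F0.
exact: (measurableT_comp mF (@measurable_vcons R n)).
Qed.

Let ka1 (a : R) : R := (if (0 <= a) && (a <= 1) then 2 * a else 0)%R.

Let dsqr (t : R) : is_derive t (1%R : R) (fun t : R => t ^+ 2)%R (2 * t)%R.
Proof. by apply: is_derive_eq; rewrite /GRing.scale/=; ring. Qed.

Let int_ka1 (x : R) : (0 <= x)%R ->
  \int[leb]_a (ka1 a * (x <= a)%R%:R)%:E = (if (x <= 1)%R then 1 - x ^+ 2 else 0)%R%:E.
Proof.
move=> x0; rewrite integral_ler_ind; case: ifPn => x1.
  transitivity (\int[leb]_(t in `[x, 1%R]) (2 * t)%:E).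
    rewrite integral_mkcond [RHS]integral_mkcond; apply: eq_integral => t _.
    rewrite !patchE !mem_setE !in_itv/= andbT /ka1.
    have [xt|] //= := leP x t; rewrite (le_trans x0 xt)/=.
    by case: ifP.
  rewrite (@FTC_segment _ (fun t => t ^+ 2)%R _ x 1%R x1 (fun t _ => dsqr t)) ?expr1n//.
  by move=> t _; apply: is_derive_continuous; apply: is_derive_eq.
rewrite integral0_eq// => t /=; rewrite in_itv/= andbT => xt.
by rewrite /ka1 (leNgt t) (lt_le_trans _ xt) ?andbF// ltNge.
Qed.

Let int_disc (r : R) : (0 <= r)%R ->
  \int[leb]_u \int[leb]_t ((t ^+ 2 + u ^+ 2 <= r ^+ 2)%R%:R)%:E = (pi * r ^+ 2)%:E.
Proof.
move=> r0; have mF : measurable_fun setT (fun v : rVm R 2 => ((eunorm v <= r)%R%:R : R)%:E).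
  by apply/measurable_EFinP; exact: measurable_cball.
have F0 (v : rVm R 2) : (0 <= ((eunorm v <= r)%R%:R)%:E :> \bar R) by rewrite lee_fin.
transitivity (\int[mu R 2]_v ((eunorm v <= r)%R%:R)%:E).
  rewrite (integral_mu_succ2 mF F0) integral_mu_succ; last 2 first.
  - exact: (measurable_slicel mF F0).
  - by move=> v; exact: integral_ge0.
  apply: eq_integral => u _.
  rewrite -[RHS]/(\int[dirac (0%R : rVm R 0)]_w \int[leb]_t ((eunorm (vcons t (vcons u w)) <= r)%R%:R)%:E).
  rewrite integral_dirac//; last first.
    by apply: (measurableT_comp (measurable_slicel mF F0)); exact: measurable_vconsr.
  rewrite diracT mul1e; apply: eq_integral => t _; congr (_%:R%:E).
  rewrite !eunorm_vcons eunorm0 expr0n/= addr0 sqr_sqrtr ?sqr_ge0//.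
  by rewrite ler_sqrt_sqr// addr_ge0 ?sqr_ge0.
have [->|rn0] := eqVneq r 0%R; first by rewrite int_cball0 expr0n mulr0.
by rewrite int_cball ?lt_def ?rn0// bvol2 -EFinM mulrC.
Qed.

Let dpow n (t : R) :
  is_derive t (1%R : R) (fun t : R => 2 / n.+2%:R * t ^+ n.+2)%R (2 * t ^+ n.+1)%R.
Proof.
have H := is_derive_expn n.+1 t; apply: is_derive_eq; rewrite /GRing.scale/=.
by rewrite mulrA divfK// pnatr_eq0.
Qed.

(** With two coordinates split off, the slice over v is a disc of area pi (1 - |v|^2). Writing 1 -
    |v|^2 as the integral of 2 a over [|v|, 1] and exchanging the integrals leaves pi [bvol n] times
    the integral of 2 a^(n+1) over [0, 1]. *)
Lemma bvolSS n : bvol n.+2 = (2 * pi / n.+2%:R)%:E * bvol n.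
Proof.
have mF : measurable_fun setT (fun v : rVm R n.+2 => ((eunorm v <= 1)%R%:R : R)%:E).
  by apply/measurable_EFinP; exact: measurable_cball.
have F0 (v : rVm R n.+2) : (0 <= ((eunorm v <= 1)%R%:R)%:E :> \bar R) by rewrite lee_fin.
have mka1 : measurable_fun setT ka1.
  apply: measurable_fun_ifT; last exact: measurable_cst.
  - by apply: measurable_and; exact: measurable_fun_ler.
  - exact: measurable_funM.
have ka1_ge0 a : (0 <= ka1 a)%R.
  by rewrite /ka1; case: ifPn => // /andP[a0 _]; rewrite mulr_ge0.
have pi0 : (0 <= pi :> R)%R by exact: pi_ge0.
rewrite /bvol (integral_mu_succ2 mF F0) integral_mu_succ2; last 2 first.
- exact: (measurable_slicel mF F0).
- by move=> v; exact: integral_ge0.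
transitivity (\int[mu R n]_v ((cst pi v)%:E * \int[leb]_a (ka1 a * (eunorm v <= a)%R%:R)%:E)).
  apply: eq_integral => v _; rewrite int_ka1 ?eunorm_ge0// -EFinM.
  case: ifPn => v1.
    have v2 : (0 <= 1 - eunorm v ^+ 2)%R by rewrite subr_ge0 exprn_ile1 ?eunorm_ge0.
    rewrite -(sqr_sqrtr v2) -int_disc ?sqrtr_ge0//.
    apply: eq_integral => u _; apply: eq_integral => t _; congr (_%:R%:E).
    rewrite sqr_sqrtr// !eunorm_vcons (@sqr_sqrtr _ (u ^+ 2 + _)%R) ?addr_ge0 ?sqr_ge0//.
    by rewrite ler_sqrt_sqr ?addr_ge0 ?sqr_ge0// expr1n addrA lerBrDr.
  rewrite mulr0 integral0_eq// => u _; rewrite integral0_eq// => t _.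
  rewrite (_ : (_ <= _)%R = false)//; apply/negbTE; rewrite -ltNge.
  rewrite -ltNge in v1; apply: (lt_le_trans v1).
  rewrite !eunorm_vcons (@sqr_sqrtr _ (u ^+ 2 + _)%R) ?addr_ge0 ?sqr_ge0//.
  by rewrite {1}/eunorm -eunormE ler_wsqrtr// addrA lerDr addr_ge0 ?sqr_ge0.
rewrite integral_balls//.
transitivity (\int[leb]_(a in `[0%R, 1%R]) (2 * a ^+ n.+1)%:E * (pi%:E * bvol n)); last first.
  rewrite (@FTC_segment _ (fun t => 2 / n.+2%:R * t ^+ n.+2)%R _ 0%R 1%R ler01 (fun t _ => dpow n t)); last first.
    by move=> t _; have H := is_derive_expn n t; apply: is_derive_continuous; apply: is_derive_eq.
  by rewrite expr1n expr0n/= mulr0 subr0 mulr1 muleA -EFinM mulrAC.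
rewrite -ge0_integralZr//; last 3 first.
- by apply/measurable_funTS/measurable_EFinP; apply: measurable_funM => //; exact: measurable_funX.
- by move=> t; rewrite /= in_itv/= => /andP[t0 _]; rewrite lee_fin mulr_ge0// exprn_ge0.
- by rewrite mule_ge0 ?lee_fin//; apply: integral_ge0 => v _; rewrite lee_fin.
rewrite [RHS]integral_mkcond; apply: eq_integral => t _.
rewrite patchE mem_setE in_itv/= /ka1; case: ifPn => [/andP[t0 t1]|_]; last by rewrite mul0e.
transitivity ((2 * t)%:E * (pi%:E * \int[mu R n]_v ((eunorm v <= t)%R%:R)%:E)).
  congr (_ * _); under eq_integral do rewrite EFinM.
  by rewrite ge0_integralZl_EFin//; apply/measurable_EFinP; exact: measurable_cball.
have [->|t0'] := eqVneq t 0%R; first by rewrite expr0n/= !mulr0 !mul0e.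
rewrite int_cball ?lt_def ?t0'// exprS.
by rewrite -(fineK (bvol_fin n)) -!EFinM; congr EFin; ring.
Qed.

Lemma bvolE n : bvol n = (ball_vol n)%:E.
Proof.
elim/ltn_ind: n => -[|[|n]] IH.
- by rewrite bvol0.
- by rewrite bvol1.
- by rewrite bvolSS IH//= -EFinM.
Qed.

Lemma volume_cball n (a : R) : (0 < a)%R ->
  \int[mu R n]_v ((eunorm v <= a)%R%:R)%:E = (ball_vol n * a ^+ n)%:E.
Proof. by move=> a0; rewrite int_cball// bvolE -EFinM mulrC. Qed.

End ball_volume.

(** * The isodiametric inequality *)

Lemma layer_cake d (T : measurableType d) (R : realType)
    (m : {sigma_finite_measure set T -> \bar R}) (phi : T -> R) :
  measurable_fun setT phi -> (forall x, 0 <= phi x) ->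
  (\int[m]_x (phi x)%:E = \int[@lebesgue_measure R]_(u in `[0%R, +oo[) m [set x | (u < phi x)%R])%E.
Proof.
move=> mphi phi0.
have mlt : measurable_fun setT (fun p : T * measurableTypeR R => (p.2 < phi p.1)).
  by apply: measurable_fun_ltr; [exact: measurable_snd | exact: (measurableT_comp mphi measurable_fst)].
have mge : measurable_fun setT (fun p : T * measurableTypeR R => (0 <= p.2)).
  by apply: measurable_fun_ler; [exact: measurable_cst | exact: measurable_snd].
have mu_ (u : R) : measurable [set x | u < phi x].
  rewrite -[X in measurable X]setTI; apply: (measurable_fun_ltr (measurable_cst u) mphi measurableT).
  by [].
transitivity (\int[m]_x \int[@lebesgue_measure R]_u (((0 <= u) && (u < phi x))%:R)%:E)%E.
  apply: eq_integral => x _.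
  transitivity (\int[@lebesgue_measure R]_u (\1_(`[0%R, phi x[) u)%:E)%E.
    rewrite integral_indic// setIT.
    have := @lebesgue_measure_itv R `[0%R, phi x[; rewrite /= lte_fin sube0 => ->.
    by case: ltgtP (phi0 x) => // <-.
  by apply: eq_integral => u _; rewrite indicE mem_setE in_itv/=.
rewrite tonelli_swap; last 2 first.
- by apply/measurable_EFinP; apply: measurable_fun_b2r; apply: measurable_and.
- by move=> x u; rewrite lee_fin.
rewrite [RHS]integral_mkcond; apply: eq_integral => u _.
rewrite patchE mem_setE in_itv/= andbT; case: ifPn => u0; last by rewrite integral0_eq// => x _.
rewrite -(setIT [set x | _]) -integral_indic//; apply: eq_integral => x _.
by rewrite indicE mem_setE.
Qed.

Lemma measurable_superlevel d (T : measurableType d) (R : realType)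
    (m : {sigma_finite_measure set T -> \bar R}) (phi : T -> R) :
  measurable_fun setT phi ->
  measurable_fun setT (fun u : measurableTypeR R => m [set x | (u < phi x)%R]).
Proof.
move=> mphi.
have mlt : measurable_fun setT (fun p : T * measurableTypeR R => (p.2 < phi p.1)).
  by apply: measurable_fun_ltr; [exact: measurable_snd | exact: (measurableT_comp mphi measurable_fst)].
have mu_ (u : R) : measurable [set x | u < phi x].
  by rewrite -[X in measurable X]setTI; apply: (measurable_fun_ltr (measurable_cst u) mphi measurableT).
have := @measurable_fun_fubini_tonelli_G _ _ T (measurableTypeR R) R m
  (fun p => ((p.2 < phi p.1)%R%:R : R)%:E) _ _.
rewrite (_ : fubini_G _ _ = (fun u : measurableTypeR R => m [set x | (u < phi x)%R])).
  by apply => [|p]; [apply/measurable_EFinP; exact: measurable_fun_b2r | rewrite lee_fin].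
apply/funext => u; rewrite /fubini_G -(setIT [set x | _]) -integral_indic//.
by apply: eq_integral => x _; rewrite indicE mem_setE.
Qed.

(** * The Prekopa-Leindler inequality, from the line to all dimensions *)

Section PrekopaLeindler.
Context {R : realType}.
Local Notation leb := (@lebesgue_measure R).

(** Take [a] in [A] near its supremum and [b] in [B] near its infimum. The part of [A] below [a],
    averaged with [b], and the part of [B] above [b], averaged with [a], both lie in [C], on
    different sides of (a + b)/2. The parts cut away have measure at most [e / 2] each;
    near-extremal points stand in for bounds that need not be attained. *)
Lemma brunn_minkowski_line (A B C : set R) (r : R) :
  measurable A -> measurable B -> measurable C -> A !=set0 -> B !=set0 ->
  (forall t, A t -> `|t| <= r) -> (forall t, B t -> `|t| <= r) ->
  (forall s t, A s -> B t -> C ((s + t) / 2)) ->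
  (leb A + leb B <= 2%:E * leb C)%E.
Proof.
move=> mA mB mC A0 B0 Ar Br ABC.
have supA : has_sup A.
  by split => //; exists r => t /Ar; rewrite ler_norml => /andP[].
have infB : has_inf B.
  by split => //; exists (- r) => t /Br; rewrite ler_norml => /andP[].
apply/lee_addgt0Pr => e e0.
have e20 : 0 < e / 2 by rewrite divr_gt0.
have [a Aa ae] := sup_adherent e20 supA.
have [b Bb be] := inf_adherent e20 infB.
pose A' := A `&` `]-oo, a]; pose B' := B `&` `]b, +oo[.
have mA' : measurable A' by apply: measurableI => //; exact: measurable_itv.
have mB' : measurable B' by apply: measurableI => //; exact: measurable_itv.
have lA : (leb A <= leb A' + (e / 2)%:E)%E.
  apply: (@le_trans _ _ (leb (A' `|` `]a, (sup A)]))).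
    apply: le_measure; rewrite ?inE//; first by apply: measurableU => //; exact: measurable_itv.
    move=> t At /=; have [ta|ta] := leP t a; first by left; split => //=; rewrite in_itv.
    by right; rewrite in_itv/= ta/=; apply: sup_ubound => //; case: supA.
  apply: (@le_trans _ _ (leb A' + leb `]a, (sup A)])%E).
    by apply: measureU2 => //; exact: measurable_itv.
  rewrite leeD2l// lebesgue_measure_itv/= lte_fin; case: ifPn => _; last by rewrite lee_fin ltW.
  by rewrite -EFinD lee_fin; lra.
have lB : (leb B <= leb B' + (e / 2)%:E)%E.
  apply: (@le_trans _ _ (leb (B' `|` `[(inf B), b]))).
    apply: le_measure; rewrite ?inE//; first by apply: measurableU => //; exact: measurable_itv.
    move=> t Bt /=; have [ta|ta] := ltP b t; first by left; split => //=; rewrite in_itv/= ta.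
    by right; rewrite in_itv/= ta andbT; apply: ge_inf => //; case: infB.
  apply: (@le_trans _ _ (leb B' + leb `[(inf B), b])%E).
    by apply: measureU2 => //; exact: measurable_itv.
  rewrite leeD2l// lebesgue_measure_itv/= lte_fin; case: ifPn => _; last by rewrite lee_fin ltW.
  by rewrite -EFinD lee_fin; lra.
pose P := (fun t : R => 2 * t + - b) @^-1` A'.
pose Q := (fun t : R => 2 * t + - a) @^-1` B'.
have maff (c : R) : measurable_fun setT (fun t : measurableTypeR R => 2 * t + c : measurableTypeR R).
  by apply: measurable_funD => //; exact: measurable_funM.
have mP : measurable P by rewrite -[P]setTI; exact: maff.
have mQ : measurable Q by rewrite -[Q]setTI; exact: maff.
have two0 : (2 : R) != 0 by [].
have EP : leb A' = (2%:E * leb P)%E by rewrite (lebesgue_affine (- b) two0 mA') ger0_norm.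
have EQ : leb B' = (2%:E * leb Q)%E by rewrite (lebesgue_affine (- a) two0 mB') ger0_norm.
have PQC : (leb P + leb Q <= leb C)%E.
  rewrite -measureU//; last first.
    apply/seteqP; split => // t [[_ /=]]; rewrite /P /Q /= in_itv/= => h1 [_ /=].
    by rewrite in_itv/= andbT => h2; lra.
  apply: le_measure; rewrite ?inE//; first exact: measurableU.
  move=> t [[At _]|[Bt _]].
    by have := ABC _ _ At Bb; congr C; field.
  by have := ABC _ _ Aa Bt; congr C; field.
apply: (@le_trans _ _ ((leb A' + (e / 2)%:E) + (leb B' + (e / 2)%:E))%E); first exact: leeD.
rewrite addeACA -EFinD -splitr leeD2r// EP EQ -muleDr//; last first.
  by rewrite ge0_adde_def// inE measure_ge0.
by rewrite lee_pmul2l.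
Qed.

(** For u < 1, points of [f > u] and [g > u] average into [h > u]. Having supremum 1 keeps both
    superlevel sets nonempty at all these levels, as the one-dimensional Brunn-Minkowski inequality
    demands; then integrate over u. *)
Let norm_pl (f g h : R -> R) (r : R) :
  measurable_fun setT f -> measurable_fun setT g -> measurable_fun setT h ->
  (forall t, 0 <= f t <= 1) -> (forall t, 0 <= g t <= 1) -> (forall t, 0 <= h t) ->
  (forall u, u < 1 -> exists t, u < f t) -> (forall u, u < 1 -> exists t, u < g t) ->
  (forall t, r < `|t| -> f t = 0) -> (forall t, r < `|t| -> g t = 0) ->
  (forall s t, f s * g t <= h ((s + t) / 2) ^+ 2) ->
  (\int[leb]_t (f t)%:E + \int[leb]_t (g t)%:E <= 2%:E * \int[leb]_t (h t)%:E)%E.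
Proof.
move=> mf mg mh f01 g01 h0 f1 g1 fr gr fgh.
have f0 t : 0 <= f t by case/andP: (f01 t).
have g0 t : 0 <= g t by case/andP: (g01 t).
have mls (k : R -> R) (u : R) : measurable_fun setT k -> measurable [set t | u < k t].
  move=> mk; rewrite -[X in measurable X]setTI.
  by apply: (measurable_fun_ltr (measurable_cst u) mk measurableT).
have mdf (k : R -> R) D : measurable D -> measurable_fun setT k ->
    measurable_fun D (fun u : R => leb [set t | u < k t]).
  by move=> mD mk; apply: measurable_funTS; exact: (measurable_superlevel leb mk).
rewrite !(layer_cake leb)//.
have cut (k : R -> R) : (forall t, 0 <= k t <= 1) ->
    (\int[leb]_(u in `[0%R, +oo[) leb [set x | (u < k x)%R] =
     \int[leb]_(u in `[0%R, 1%R[) leb [set x | (u < k x)%R])%E.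
  move=> k01; rewrite integral_mkcond [RHS]integral_mkcond; apply: eq_integral => u _.
  rewrite !patchE !mem_setE !in_itv/= andbT; case: (leP 0 u) => //= u0; case: ltP => // u1.
  rewrite (_ : [set x | _] = set0) ?measure0//; apply/seteqP; split => // t /=.
  by rewrite ltNge (le_trans _ u1) //; case/andP: (k01 t).
rewrite (cut f f01) (cut g g01).
rewrite -ge0_integralD//=; last 2 first.
- by apply: mdf.
- by apply: mdf.
apply: (@le_trans _ _ (\int[leb]_(u in `[0%R, 1%R[) (2%:E * leb [set x | (u < h x)%R]))%E).
  apply: ge0_le_integral => //.
  - by move=> u _; rewrite adde_ge0.
  - by apply: emeasurable_funD; apply: mdf.
  - by apply: measurable_funeM; apply: mdf.
  - move=> u; rewrite /= in_itv/= => /andP[u0 u1].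
    apply: (@brunn_minkowski_line _ _ _ r).
    + exact: mls.
    + exact: mls.
    + exact: mls.
    + exact: (f1 u u1).
    + exact: (g1 u u1).
    + by move=> t /= ut; rewrite leNgt; apply/negP => /fr ft; move: ut; rewrite ft ltNge u0.
    + by move=> t /= ut; rewrite leNgt; apply/negP => /gr ft; move: ut; rewrite ft ltNge u0.
    + move=> s t /= us ut; rewrite -ltr_sqr ?nnegrE//.
      by apply: lt_le_trans (fgh s t); rewrite expr2 ltr_pM.
rewrite ge0_integralZl//; last by apply: mdf.
rewrite lee_pmul2l//; apply: ge0_subset_integral => //; first exact: mdf.
by move=> u /=; rewrite !in_itv/= => /andP[->].
Qed.

(** Dividing [f] and [g] by their suprema [a] and [b], and [h] by the square root of [a * b],
    reduces to the normalised case; the additive inequality obtained there becomes multiplicative by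
    the arithmetic-geometric mean. *)
Let pl_line (f g h : R -> R) (M r : R) :
  measurable_fun setT f -> measurable_fun setT g -> measurable_fun setT h ->
  (forall t, 0 <= f t <= M) -> (forall t, 0 <= g t <= M) -> (forall t, 0 <= h t) ->
  (forall t, r < `|t| -> f t = 0) -> (forall t, r < `|t| -> g t = 0) ->
  (forall s t, f s * g t <= h ((s + t) / 2) ^+ 2) ->
  (\int[leb]_t (f t)%:E * \int[leb]_t (g t)%:E <= (\int[leb]_t (h t)%:E) * (\int[leb]_t (h t)%:E))%E.
Proof.
move=> mf mg mh f0M g0M h0 fr gr fgh.
have int0 (k : R -> R) : (forall t, 0 <= k t <= M) -> ~ (exists t, 0 < k t) ->
    (\int[leb]_t (k t)%:E = 0)%E.
  move=> k0 nk; apply: integral0_eq => t _; congr EFin; apply/eqP; rewrite eq_le.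
  by case/andP: (k0 t) => -> _; rewrite andbT leNgt; apply/negP => kt; apply: nk; exists t.
have hh : (0 <= (\int[leb]_t (h t)%:E) * (\int[leb]_t (h t)%:E))%E.
  by apply: mule_ge0; apply: integral_ge0 => t _; rewrite lee_fin.
have [[t0 ft0]|/(int0 _ f0M)->] := pselect (exists t, 0 < f t); last by rewrite mul0e.
have [[t1 gt1]|/(int0 _ g0M)->] := pselect (exists t, 0 < g t); last by rewrite mule0.
have sup_pos (k : R -> R) t : (forall t, 0 <= k t <= M) -> 0 < k t ->
    [/\ 0 < sup (range k), forall t, k t <= sup (range k) &
      forall u, u < sup (range k) -> exists t, u < k t].
  move=> k0 kt; have sk : has_sup (range k).
    by split; [exists (k t); exists t | exists M => _ [u _ <-]; case/andP: (k0 u)].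
  have ub u : k u <= sup (range k) by apply: sup_ubound; [case: sk | exists u].
  split => //; first exact: lt_le_trans (ub t).
  by move=> u /(sup_gt _)[|_ [v _ <-] uv]; [case: sk | exists v].
have [a0 fa fu] := sup_pos f t0 f0M ft0; have [b0 gb gu] := sup_pos g t1 g0M gt1.
set a := sup (range f) in a0 fa fu; set b := sup (range g) in b0 gb gu.
pose c := Num.sqrt (a * b).
have c0 : 0 < c by rewrite sqrtr_gt0 mulr_gt0.
have c2 : c ^+ 2 = a * b by rewrite sqr_sqrtr// ltW// mulr_gt0.
have f0 t : 0 <= f t by case/andP: (f0M t).
have g0 t : 0 <= g t by case/andP: (g0M t).
have := @norm_pl (fun t => a^-1 * f t) (fun t => b^-1 * g t) (fun t => c^-1 * h t) r.
have iZ (k : R -> R) e : measurable_fun setT k -> (forall t, 0 <= k t) -> 0 < e ->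
    (\int[leb]_t (e^-1 * k t)%:E = e^-1%:E * \int[leb]_t (k t)%:E)%E.
  move=> mk k0 e0; under eq_integral do rewrite EFinM.
  rewrite ge0_integralZl_EFin ?invr_ge0 ?(ltW e0)//; last exact/measurable_EFinP.
  by move=> t _; rewrite lee_fin.
rewrite !iZ// => H.
have {H} : (a^-1%:E * \int[leb]_t (f t)%:E + b^-1%:E * \int[leb]_t (g t)%:E <=
    2%:E * (c^-1%:E * \int[leb]_t (h t)%:E))%E.
  apply: H.
  - exact: measurable_funM.
  - exact: measurable_funM.
  - exact: measurable_funM.
  - by move=> t; rewrite mulr_ge0 ?invr_ge0 ?(ltW a0)//= ler_pdivrMl// mulr1.
  - by move=> t; rewrite mulr_ge0 ?invr_ge0 ?(ltW b0)//= ler_pdivrMl// mulr1.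
  - by move=> t; rewrite mulr_ge0 ?invr_ge0 ?(ltW c0).
  - move=> u u1; have [|t ut] := fu (a * u); first by rewrite gtr_pMr.
    by exists t; rewrite ltr_pdivlMl.
  - move=> u u1; have [|t ut] := gu (b * u); first by rewrite gtr_pMr.
    by exists t; rewrite ltr_pdivlMl.
  - by move=> t /fr ->; rewrite mulr0.
  - by move=> t /gr ->; rewrite mulr0.
  - move=> u t; rewrite exprMn exprVn c2 mulrACA -invfM ler_wpM2l//.
    by rewrite invr_ge0 ltW// mulr_gt0.
have If0 : (0 <= \int[leb]_t (f t)%:E)%E by apply: integral_ge0 => t _; rewrite lee_fin.
have Ig0 : (0 <= \int[leb]_t (g t)%:E)%E by apply: integral_ge0 => t _; rewrite lee_fin.
have Ih0 : (0 <= \int[leb]_t (h t)%:E)%E by apply: integral_ge0 => t _; rewrite lee_fin.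
move: If0 Ig0 Ih0; set F := integral _ _ _; set G := integral _ _ _; set H := integral _ _ _.
have cV0 : 0 < c^-1 by rewrite invr_gt0.
(* An infinite integral of [h] leaves nothing to prove; a finite one forces those of [f] and [g] to
   be finite. *)
move=> F0 G0 H0; have [Hy|Hy] := eqVneq H +oo%E; first by rewrite Hy => _; rewrite mulyy leey.
have Hf : H \is a fin_num by rewrite ge0_fin_numE// lt_neqAle Hy leey.
rewrite -(fineK Hf) -!EFinM => FGH.
have fin_of (x y : \bar R) (e : R) : (0 <= x)%E -> (0 <= y)%E -> 0 < e ->
    (e^-1%:E * x + y <= (2 * (c^-1 * fine H))%:E)%E -> x \is a fin_num.
  move=> x0 y0 e0 xy; rewrite ge0_fin_numE//.
  have : (e^-1%:E * x <= (2 * (c^-1 * fine H))%:E)%E by apply: le_trans xy; exact: leeDl.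
  rewrite lee_pdivrMl// => /le_lt_trans; apply.
  by rewrite -EFinM ltry.
have Ff : F \is a fin_num.
  apply: (fin_of F (b^-1%:E * G)%E a) => //.
  by rewrite mule_ge0// lee_fin invr_ge0 ltW.
have Gf : G \is a fin_num.
  apply: (fin_of G (a^-1%:E * F)%E b) => //; last by rewrite addeC.
  by rewrite mule_ge0// lee_fin invr_ge0 ltW.
move: FGH F0 G0 H0; rewrite -(fineK Ff) -(fineK Gf) -(fineK Hf) -!EFinM -EFinD !lee_fin /=.
move: (fine F) (fine G) (fine H) => x y z xyz x0 y0 z0.
(* AM-GM: 4 x y / (a b) <= (x/a + y/b)^2 <= 4 z^2 / c^2 *)
have h1 : (a^-1 * x + b^-1 * y) ^+ 2 <= (2 * (c^-1 * z)) ^+ 2.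
  by rewrite ler_sqr ?nnegrE// ?addr_ge0 ?mulr_ge0 ?invr_ge0 ?(ltW a0) ?(ltW b0) ?(ltW c0).
have h2 : 4 * ((a^-1 * x) * (b^-1 * y)) <= (a^-1 * x + b^-1 * y) ^+ 2.
  by rewrite -subr_ge0; have := sqr_ge0 (a^-1 * x - b^-1 * y); nra.
have := le_trans h2 h1; rewrite !exprMn exprVn c2 mulrACA -invfM.
rewrite (_ : (2 : R) ^+ 2 = 4) ?ler_pM2l//; last by ring.
by rewrite invr_gt0 mulr_gt0.
Qed.

(** The support is confined to a cube, not a ball, so that slices inherit the same [M] and [r]. *)
Definition bounded_support n (F : 'rV[R]_n -> R) (M r : R) :=
  [/\ measurable_fun setT F, forall v, 0 <= F v <= M &
     forall (v : 'rV[R]_n) i, r < `|v ord0 i| -> F v = 0].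

Lemma bounded_support_slice n (F : 'rV[R]_n.+1 -> R) (M r t : R) :
  bounded_support F M r -> bounded_support (fun v => F (vcons t v)) M r.
Proof.
move=> [mF F0 Fr]; split => // [|v i vr].
  exact: (measurableT_comp mF (@measurable_vconsr R n t)).
by apply: (Fr _ (lift ord0 i)); rewrite vconsS.
Qed.

Lemma integral_bounded_support n (F : 'rV[R]_n -> R) (M r : R) :
  0 <= r -> bounded_support F M r ->
  (\int[mu R n]_v (F v)%:E <= (M * (2 * r) ^+ n)%:E)%E.
Proof.
move=> r0; elim: n F => [|n IH] F.
  move=> [mF F0 Fr]; rewrite integral_dirac//; last exact/measurable_EFinP.
  by rewrite diracT mul1e mulr1 lee_fin; case/andP: (F0 0).
move=> bF; have [mF F0 Fr] := bF.
have mFE : measurable_fun setT (EFin \o F) by exact/measurable_EFinP.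
have FE0 v : (0 <= (F v)%:E)%E by rewrite lee_fin; case/andP: (F0 v).
have M0 : 0 <= M by case/andP: (F0 0) => a b; exact: le_trans a b.
rewrite integral_mu_succ//.
apply: (@le_trans _ _ (\int[leb]_t ((M * (2 * r) ^+ n)%:E * (\1_(`[(- r), r]) t)%:E))%E).
  apply: ge0_le_integral => //.
  - by move=> t _; exact: integral_ge0.
  - exact: (measurable_slicer mFE FE0).
  - by apply: measurable_funeM; apply/measurable_EFinP; exact: measurable_indic.
  - move=> t _; rewrite indicE mem_setE in_itv/= -ler_norml; case: (leP `|t| r) => tr.
      by rewrite mule1; apply: IH; exact: bounded_support_slice.
    rewrite mule0 integral0_eq// => v _; congr EFin; apply: (Fr _ ord0).
    by rewrite vcons0.
rewrite ge0_integralZl_EFin; [|exact: measurableT|by move=> t _; rewrite lee_fin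
  |by apply/measurable_EFinP; exact: measurable_indic
  |by rewrite !mulr_ge0// exprn_ge0// mulr_ge0].
rewrite integral_indic// setIT.
have := @lebesgue_measure_itv R `[(- r), r]; rewrite /= lte_fin => ->; case: ifPn => _.
  rewrite -EFinD -EFinM lee_fin opprK exprS (_ : r + r = 2 * r); last by ring.
  by rewrite le_eqVlt; apply/orP; left; apply/eqP; ring.
by rewrite mule0 lee_fin !mulr_ge0// exprn_ge0// mulr_ge0.
Qed.

(** Induction on the dimension: for fixed first coordinates s, t and (s + t)/2, the slices satisfy
    the hypothesis in one dimension less, and the resulting inequality is the hypothesis of the
    one-dimensional case for the slice integrals. *)
Theorem prekopa_leindler n (F G H : 'rV[R]_n -> R) (M r : R) : 0 <= r ->
  bounded_support F M r -> bounded_support G M r -> bounded_support H M r ->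
  (forall v w, F v * G w <= H (2^-1 *: (v + w)) ^+ 2) ->
  (\int[mu R n]_v (F v)%:E * \int[mu R n]_v (G v)%:E <=
   \int[mu R n]_v (H v)%:E * \int[mu R n]_v (H v)%:E)%E.
Proof.
move=> r0; elim: n F G H => [|n IH] F G H.
  move=> [mF F0 Fr] [mG G0 Gr] [mH H0 Hr] FGH.
  rewrite !integral_dirac; do ?exact/measurable_EFinP; do ?exact: measurableT.
  rewrite !diracT !mul1e -!EFinM lee_fin -expr2; have := FGH 0 0.
  by rewrite addr0 scaler0.
move=> bF bG bH FGH.
pose sl (K : 'rV[R]_n.+1 -> R) t := fine (\int[mu R n]_v (K (vcons t v))%:E).
have K0 (K : 'rV[R]_n.+1 -> R) : bounded_support K M r ->
    forall v, (0 <= (K v)%:E)%E by move=> [_ + _] v => /(_ v) /andP[]; rewrite lee_fin.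
have mK (K : 'rV[R]_n.+1 -> R) : bounded_support K M r ->
    measurable_fun setT (EFin \o K) by move=> [mK' _ _]; exact/measurable_EFinP.
have slE (K : 'rV[R]_n.+1 -> R) t : bounded_support K M r ->
    ((sl K t)%:E = \int[mu R n]_v (K (vcons t v))%:E)%E.
  move=> bK; rewrite fineK// ge0_fin_numE; last by apply: integral_ge0 => v _; exact: K0.
  apply: le_lt_trans (integral_bounded_support r0 (bounded_support_slice t bK)) _.
  exact: ltry.
have intE (K : 'rV[R]_n.+1 -> R) : bounded_support K M r ->
    (\int[mu R n.+1]_v (K v)%:E = \int[leb]_t (sl K t)%:E)%E.
  move=> bK; rewrite (integral_mu_succ (mK _ bK) (K0 _ bK)).
  by apply: eq_integral => t _; rewrite slE.
have msl (K : 'rV[R]_n.+1 -> R) : bounded_support K M r -> measurable_fun setT (sl K).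
  move=> bK; apply: (@measurableT_comp _ _ _ _ _ _ fine); first exact: fine_measurable.
  exact: (measurable_slicer (mK _ bK) (K0 _ bK)).
have sl0 (K : 'rV[R]_n.+1 -> R) : bounded_support K M r ->
    forall t, 0 <= sl K t <= M * (2 * r) ^+ n.
  move=> bK t; rewrite -!lee_fin slE//; apply/andP; split.
    by apply: integral_ge0 => v _; exact: K0.
  exact: integral_bounded_support r0 (bounded_support_slice t bK).
have slr (K : 'rV[R]_n.+1 -> R) : bounded_support K M r ->
    forall t, r < `|t| -> sl K t = 0.
  move=> [_ _ Kr] t rt; rewrite /sl integral0_eq// => v _; congr EFin.
  by apply: (Kr _ ord0); rewrite vcons0.
rewrite !intE//; apply: (@pl_line _ _ _ (M * (2 * r) ^+ n) r).
- exact: msl.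
- exact: msl.
- exact: msl.
- exact: sl0.
- exact: sl0.
- by move=> t; case/andP: (sl0 _ bH t).
- exact: slr.
- exact: slr.
- move=> s t; rewrite expr2 -lee_fin !EFinM !slE//.
  apply: (IH (fun v => F (vcons s v)) (fun v => G (vcons t v))
             (fun v => H (vcons ((s + t) / 2) v))).
  + exact: bounded_support_slice.
  + exact: bounded_support_slice.
  + exact: bounded_support_slice.
  + by move=> v w; have := FGH (vcons s v) (vcons t w); rewrite add_vcons scale_vcons (mulrC (s + t)).
Qed.

Lemma volume_cball_ge0 n (a : R) : 0 <= a ->
  (\int[mu R n]_v ((eunorm v <= a)%R%:R)%:E = (ball_vol n * a ^+ n)%:E)%E.
Proof.
rewrite le_eqVlt => /orP[/eqP <-|]; last exact: volume_cball.
case: n => [|n]; last by rewrite int_cball0 exprS !mul0r mulr0.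
rewrite integral_dirac; first by rewrite diracT mul1e eunorm0 lexx mulr1.
  by [].
by apply/measurable_EFinP; exact: measurable_cball.
Qed.

Lemma ball_vol_ge0 n : 0 <= ball_vol n :> R.
Proof.
rewrite -[ball_vol n]mulr1 -(expr1n R n) -lee_fin -volume_cball_ge0//.
by apply: integral_ge0 => v _; rewrite lee_fin.
Qed.

Let ereal_sqr_le (x : \bar R) (b : R) :
  (0 <= x)%E -> 0 <= b -> (x * x <= b%:E * b%:E)%E -> (x <= b%:E)%E.
Proof.
case: x => [x||] //; first by rewrite -!EFinM !lee_fin -!expr2 => x0 b0; rewrite ler_sqr.
Qed.

(* Prekopa-Leindler for K, -K and the ball of radius D/2, which contains (K - K)/2. *)
Lemma isodiametric n (K : set 'rV[R]_n) (D : R) : 0 <= D -> measurable K ->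
  (forall v w, K v -> K w -> eunorm (v - w) <= D) ->
  (mu R n K <= (ball_vol n * (D / 2) ^+ n)%:E)%E.
Proof.
move=> D0 mK KD.
have D20 : 0 <= D / 2 by rewrite divr_ge0.
have [->|/set0P[v0 Kv0]] := eqVneq K set0.
  by rewrite measure0 lee_fin mulr_ge0 ?ball_vol_ge0// exprn_ge0.
have mi : measurable_fun setT (\1_K : 'rV[R]_n -> R) by exact: measurable_indic.
have mopp : measurable_fun setT (fun v : 'rV[R]_n => - v).
  by under eq_fun do rewrite -scaleN1r; apply: measurable_rVZ => //; exact: measurable_id.
have mi' : measurable_fun setT (fun v : 'rV[R]_n => \1_K (- v) : R).
  exact: (measurableT_comp mi mopp).
pose r := eunorm v0 + D.
have r0 : 0 <= r by rewrite addr_ge0// eunorm_ge0.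
have Kr v : K v -> eunorm v <= r.
  move=> Kv; rewrite -[v](subrK v0) addrC; apply: le_trans (ler_eunormD _ _) _.
  by rewrite lerD2l KD.
have ind1 (P : bool) : 0 <= (P%:R : R) <= 1 by case: P; rewrite ?lexx ?ler01.
have H := @prekopa_leindler n (\1_K) (fun v => \1_K (- v)) (fun v => (eunorm v <= D / 2)%R%:R) 1 r r0.
have : (\int[mu R n]_v (\1_K v)%:E * \int[mu R n]_v (\1_K (- v)%R)%:E <=
   (\int[mu R n]_v ((eunorm v <= D / 2)%R%:R)%:E) * (\int[mu R n]_v ((eunorm v <= D / 2)%R%:R)%:E))%E.
  apply: H.
  - split => // [v|v i vr]; first by rewrite indicE.
    rewrite indicE memNset// => /Kr vr'; move: vr; apply/negP; rewrite -leNgt.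
    exact: le_trans (ler_coord_eunorm _ _) vr'.
  - split => // [v|v i vr]; first by rewrite indicE.
    rewrite indicE memNset// => /Kr; rewrite eunormN => vr'; move: vr; apply/negP; rewrite -leNgt.
    exact: le_trans (ler_coord_eunorm _ _) vr'.
  - split => // [|v i vr]; first exact: measurable_cball.
    case: leP => // vD; move: vr; rewrite ltNge => /negP []; apply: le_trans (ler_coord_eunorm _ _) _.
    apply: le_trans vD _; apply: le_trans (_ : D <= _); last by rewrite lerDr eunorm_ge0.
    by rewrite ler_pdivrMr// mulr2n mulrDr mulr1 lerDl.
  - move=> v w; rewrite !indicE; case: (boolP (v \in K)) => [/set_mem Kv|_]; last by rewrite mul0r sqr_ge0.
    case: (boolP (- w \in K)) => [/set_mem Kw|_]; last by rewrite mulr0 sqr_ge0.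
    rewrite eunormZ ger0_norm// (_ : (2^-1 * _ <= _) = true) ?expr1n ?mulr1//.
    by rewrite mulrC ler_pM2r ?invr_gt0//; have := KD _ _ Kv Kw; rewrite opprK.
rewrite (mu_opp (F := fun v => (\1_K v)%:E)); last 2 first.
- exact/measurable_EFinP.
- by move=> v; rewrite lee_fin.
rewrite integral_indic// setIT volume_cball_ge0//.
have B0 : 0 <= ball_vol n * (D / 2) ^+ n by rewrite mulr_ge0 ?ball_vol_ge0// exprn_ge0.
by move=> h; apply: (ereal_sqr_le _ B0 h); exact: measure_ge0.
Qed.

End PrekopaLeindler.

(** * Hausdorff measure on the sphere *)

(** For distinct vectors, the reflection in the hyperplane orthogonal to [e - x], which exchanges
    the two because they have equal length. *)
Lemma householder (R : realType) n (e x : 'rV[R]_n) : eunorm e = 1 -> eunorm x = 1 ->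
  exists M : 'M[R]_n, M *m M^T = 1%:M /\ e *m M = x.
Proof.
move=> e1 x1; have [<-|ex] := eqVneq e x.
  by exists 1%:M; rewrite trmx1 !mulmx1.
pose u := e - x; pose c := 2 / edot u u.
have u0 : edot u u != 0.
  by apply: contraNneq ex => /edot_eq0 /eqP; rewrite subr_eq0.
have ee : edot e e = 1 by rewrite -eunormE e1 expr1n.
have xx : edot x x = 1 by rewrite -eunormE x1 expr1n.
pose M := 1%:M - c *: (u^T *m u) : 'M[R]_n.
have vM v : v *m M = v - (c * edot v u) *: u.
  rewrite mulmxBr mulmx1 -scalemxAr mulmxA -scalerA; congr (_ - _ *: _).
  rewrite [v *m u^T]mx11_scalar mul_scalar_mx; congr (_ *: _).
  by rewrite edot_mxE; congr (fun_of_matrix _ _ _); exact: val_inj.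
have MT : M^T = M by rewrite /M linearB/= trmx1 linearZ/= trmx_mul trmxK.
exists M; split.
  rewrite MT; apply/row_matrixP => i; rewrite row_mul row1 rowE !vM.
  set v := delta_mx _ _.
  have -> : edot (v - (c * edot v u) *: u) u = - edot v u.
    by rewrite edotBl edotZl /c; field.
  by rewrite mulrN scaleNr opprK subrK.
rewrite vM; have -> : edot e u = edot u u / 2.
  by rewrite /u !edotBl !edotBr (edotC x e) ee xx; field.
have -> : c * (edot u u / 2) = 1 by rewrite /c; field.
by rewrite scale1r /u opprB addrC subrK.
Qed.

Lemma measurable_invr (R : realType) : measurable_fun setT (@GRing.inv R).
Proof.
have -> : [set: R] = [set 0] `|` [set~ 0] by rewrite setUv.
have m0 : measurable [set~ (0 : R)] by apply: measurableC; exact: measurable_set1.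
apply/measurable_funU => //; split; first exact: measurable_fun_set1.
apply: open_continuous_measurable_fun.
  by apply: closed_openC; rewrite -set_itv1; exact: interval_closed.
by move=> x; rewrite inE /= => /eqP x0; exact: inv_continuous.
Qed.

(** * Volumes of cones over spherical sets: small diameter, and caps *)

Section cone.
Context {R : realType}.
Local Notation leb := (@lebesgue_measure R).
Implicit Types n m : nat.

Definition cone n (A : set 'rV[R]_n) : set 'rV[R]_n :=
  [set v | 0 < eunorm v <= 1 /\ A ((eunorm v)^-1 *: v)].

Lemma measurable_normalize n :
  measurable_fun setT (fun v : 'rV[R]_n => (eunorm v)^-1 *: v).
Proof.
apply: measurable_rVZ; last exact: measurable_id.
by apply: (@measurableT_comp _ _ _ _ _ _ (@GRing.inv R)); [exact: measurable_invr | exact: measurable_eunorm].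
Qed.

Lemma measurable_cone n (A : set 'rV[R]_n) : measurable A -> measurable (cone A).
Proof.
move=> mA.
have -> : cone A = (@eunorm R n) @^-1` `]0, 1]%classic `&` (fun v => (eunorm v)^-1 *: v) @^-1` A.
  by apply/seteqP; split => v /=; rewrite in_itv.
apply: measurableI; rewrite -[X in measurable X]setTI.
  by apply: measurable_eunorm => //; exact: measurable_itv.
exact: measurable_normalize.
Qed.

Lemma cone_orth n (M : 'M[R]_n) (A : set 'rV[R]_n) : M *m M^T = 1%:M -> measurable A ->
  mu R n (cone A) = mu R n (cone [set x | A (x *m M)]).
Proof.
move=> hM mA.
have mA' : measurable [set x | A (x *m M)].
  by rewrite -[X in measurable X]setTI; exact: measurable_mulmx.
have E (B : set 'rV[R]_n) : measurable B -> mu R n (cone B) = (\int[mu R n]_v (\1_(cone B) v)%:E)%E.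
  by move=> mB; rewrite integral_indic ?setIT//; exact: measurable_cone.
rewrite !E// -(mu_orth (M := M) hM); last 2 first.
- by apply/measurable_EFinP; apply: measurable_indic; exact: measurable_cone.
- by move=> v; rewrite lee_fin.
apply: eq_integral => v _; rewrite !indicE.
rewrite (_ : (v *m M \in cone A) = (v \in cone [set x | A (x *m M)]))//.
apply/idP/idP => /set_mem h; apply/mem_set; move: h; rewrite /cone /= eunorm_orth//;
  by rewrite -scalemxAl.
Qed.

Definition e0 n : 'rV[R]_n.+1 := vcons 1 0.

Lemma eunorm_e0 n : eunorm (e0 n) = 1.
Proof. by rewrite eunorm_vcons eunorm0 expr0n/= addr0 expr1n sqrtr1. Qed.

Lemma measurable_slice n (A : set 'rV[R]_n.+1) t : measurable A ->
  measurable [set u : 'rV[R]_n | A (vcons t u)].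
Proof. by move=> mA; rewrite -[X in measurable X]setTI; exact: measurable_vconsr. Qed.

Lemma mu_slice_int n (A : set 'rV[R]_n.+1) t : measurable A ->
  (mu R n [set u | A (vcons t u)] = \int[mu R n]_u (\1_A (vcons t u))%:E)%E.
Proof.
move=> mA; rewrite -(setIT [set u | _]) -integral_indic//; exact: measurable_slice.
Qed.

Lemma measurable_mu_slice n (A : set 'rV[R]_n.+1) : measurable A ->
  measurable_fun setT (fun t : measurableTypeR R => mu R n [set u | A (vcons t u)]).
Proof.
move=> mA; under eq_fun do rewrite mu_slice_int//.
apply: (@measurable_slicer _ _ (fun v => (\1_A v)%:E)); last by move=> v; rewrite lee_fin.
by apply/measurable_EFinP; exact: measurable_indic.
Qed.

Lemma mu_slices n (A : set 'rV[R]_n.+1) : measurable A ->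
  (mu R n.+1 A = \int[leb]_t mu R n [set u | A (vcons t u)])%E.
Proof.
move=> mA; rewrite -(setIT A) -integral_indic//.
rewrite integral_mu_succ; last 2 first.
- by apply/measurable_EFinP; exact: measurable_indic.
- by move=> v; rewrite lee_fin.
by apply: eq_integral => t _; rewrite setIT mu_slice_int.
Qed.

Lemma sub_vcons n (t u : R) (v w : 'rV[R]_n) : vcons t v - vcons u w = vcons (t - u) (v - w).
Proof. by rewrite -[- vcons u w]scaleN1r scale_vcons add_vcons mulN1r scaleN1r. Qed.

Lemma vtail_vcons n (t : R) (v : 'rV[R]_n) : vtail (vcons t v) = v.
Proof. by apply/rowP => i; rewrite mxE vconsS. Qed.

Lemma ler_eunorm_vcons_tail n (t : R) (u : 'rV[R]_n) : eunorm u <= eunorm (vcons t u).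
Proof. by rewrite {1}/eunorm -eunormE eunorm_vcons ler_wsqrtr// lerDr sqr_ge0. Qed.

Lemma is_derive_cpow n (c t : R) :
  is_derive t (1 : R) (fun t : R => c / n.+1%:R * t ^+ n.+1) (c * t ^+ n).
Proof.
have H := is_derive_expn n t; apply: is_derive_eq; rewrite /GRing.scale/=.
by rewrite mulrA divfK// pnatr_eq0.
Qed.

Lemma integral_powers n (c b : R) : 0 <= c -> 0 <= b ->
  (\int[leb]_(t in `[0%R, b]) (c * t ^+ n)%:E = (c * b ^+ n.+1 / n.+1%:R)%:E)%E.
Proof.
move=> c0 b0.
rewrite (@FTC_segment _ (fun t => c / n.+1%:R * t ^+ n.+1) _ 0 b b0 (fun t _ => is_derive_cpow n c t)).
  by rewrite expr0n/= mulr0 subr0 mulrAC.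
by move=> t _; apply: cvgM; [exact: cvg_cst | exact: exprn_continuous].
Qed.

(* Lipschitz constant of the gnomonic projection on a spherical cap of radius D. *)
Definition gnomonic_lip (D : R) : R := (1 - D)^-1 + D * (1 - D) ^- 2.

(** Rotate a point of [C] to the pole. The slice of the cone at height t lies in t times the
    gnomonic projection of [C], so its diameter is at most t D [gnomonic_lip D]; the isodiametric
    inequality bounds its volume by a multiple of t^n, whose integral over [0, 1] brings the factor
    1/(n+1). *)
Lemma cone_diam_le n (C : set 'rV[R]_n.+1) (D : R) : measurable C ->
  (forall x, C x -> eunorm x = 1) -> 0 <= D < 1 ->
  (forall x y, C x -> C y -> eunorm (x - y) <= D) ->
  ((n.+1%:R)%:E * mu R n.+1 (cone C) <=
   (gnomonic_lip D ^+ n)%:E * (ball_vol n * (D / 2) ^+ n)%:E)%E.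
Proof.
move=> mC C1 /andP[D0 D1] CD.
have L0 : 0 <= gnomonic_lip D.
  by rewrite addr_ge0 ?invr_ge0 ?mulr_ge0 ?invr_ge0 ?exprn_ge0 ?subr_ge0 ?(ltW D1).
have [CE|/set0P[x0 Cx0]] := eqVneq C set0.
  rewrite (_ : cone C = set0) ?measure0 ?mule0 -?EFinM ?lee_fin.
    by rewrite !mulr_ge0 ?exprn_ge0 ?ball_vol_ge0 ?divr_ge0.
  by apply/seteqP; split => // v [_]; rewrite CE.
have [M [hM eM]] := householder (eunorm_e0 n) (C1 _ Cx0).
rewrite (cone_orth hM mC); set C' := [set x | C (x *m M)].
have mC' : measurable C'.
  by rewrite -[X in measurable X]setTI; exact: measurable_mulmx.
have C'1 x : C' x -> eunorm x = 1 by move=> /C1; rewrite eunorm_orth.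
have C'D x y : C' x -> C' y -> eunorm (x - y) <= D.
  by move=> Cx Cy; have := CD _ _ Cx Cy; rewrite -mulmxBl eunorm_orth.
have C'e : C' (e0 n) by rewrite /C' /= eM.
pose c := ball_vol n * (gnomonic_lip D * D / 2) ^+ n.
have c0 : 0 <= c by rewrite mulr_ge0 ?ball_vol_ge0// exprn_ge0// divr_ge0// mulr_ge0.
have mK := measurable_cone mC'.
have key (t : R) : (mu R n [set u | cone C' (vcons t u)] <=
    (if 0 <= t <= 1 then c * t ^+ n else 0)%:E)%E.
  (* The direction of a point of the cone is within [D] of the pole, so its first coordinate is at
     least [1 - D]. *)
  have coord u : cone C' (vcons t u) -> [/\ (1 - D) * eunorm (vcons t u) <= t,
      0 < eunorm (vcons t u) <= 1 & C' ((eunorm (vcons t u))^-1 *: vcons t u)].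
    move=> [n01 Cv]; split => //; case/andP: n01 => n0 n1.
    have := C'D _ _ C'e Cv; rewrite scale_vcons sub_vcons => /(le_trans (ler_coord_eunorm _ ord0)).
    rewrite vcons0.
    move=> /(le_trans (ler_norm _)); rewrite lerBlDl -lerBlDr.
    by rewrite ler_pdivlMl// mulrC.
  have [/set0P[u1 Ku1]|] := boolP ([set u | cone C' (vcons t u)] != set0); last first.
    by rewrite negbK => /eqP ->; rewrite measure0 lee_fin; case: ifP => // /andP[t0 _]; rewrite mulr_ge0// exprn_ge0.
  have [h1 /andP[n0 n1] _] := coord _ Ku1.
  have t0 : 0 < t by apply: lt_le_trans h1; rewrite mulr_gt0// subr_gt0.
  have t1 : t <= 1.
    apply: le_trans n1; apply: le_trans (ler_norm _) _.
    by have := ler_coord_eunorm (vcons t u1) ord0; rewrite vcons0.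
  rewrite (ltW t0) t1 /=.
  have -> : c * t ^+ n = ball_vol n * (t * (gnomonic_lip D * D) / 2) ^+ n.
    by rewrite /c -mulrA -exprMn; congr (_ * _ ^+ _); ring.
  apply: isodiametric.
  - by rewrite !mulr_ge0// ltW.
  - exact: (measurable_slice _ mK).
  - move=> u w /= /coord[hu /andP[nu0 nu1] Cu] /coord[hw /andP[nw0 nw1] Cw].
    set a := eunorm (vcons t u) in hu nu0 nu1 Cu; set b := eunorm (vcons t w) in hw nw0 nw1 Cw.
    have := C'D _ _ Cu Cw.
    have D10 : 0 < 1 - D by rewrite subr_gt0.
    (* with xi = (t,u)/a and eta = (t,w)/b: u - w = a (xi - eta)' + (a - b) eta' *)
    rewrite !scale_vcons sub_vcons => xe.
    have tl : u - w = a *: (a^-1 *: u - b^-1 *: w) + (a - b) *: (b^-1 *: w).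
      by apply/rowP => i; rewrite !mxE; field; rewrite !gt_eqF.
    have etaD : eunorm (b^-1 *: w) <= D.
      have := C'D _ _ Cw C'e; rewrite scale_vcons sub_vcons subr0.
      by apply: le_trans; exact: ler_eunorm_vcons_tail.
    have aD : a <= t / (1 - D) by rewrite ler_pdivlMr// mulrC.
    have bD : b <= t / (1 - D) by rewrite ler_pdivlMr// mulrC.
    have abD : `|a - b| <= t * (1 - D) ^- 2 * D.
      (* The quotients t/a and t/b are the first coordinates of two directions, which differ by at
         most [D]. *)
      have -> : a - b = (a * b / t) * (b^-1 * t - a^-1 * t).
        by field; rewrite !gt_eqF.
      rewrite normrM; apply: ler_pM => //; last first.
        rewrite distrC; apply: le_trans xe.
        by apply: le_trans (ler_coord_eunorm _ ord0); rewrite vcons0.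
      rewrite ger0_norm; last by rewrite divr_ge0 ?mulr_ge0// ltW.
      rewrite ler_pdivrMr//; apply: le_trans (_ : t / (1 - D) * (t / (1 - D)) <= _).
        by apply: ler_pM => //; exact: ltW.
      by rewrite le_eqVlt; apply/orP; left; apply/eqP; field; rewrite gt_eqF.
    rewrite tl; apply: le_trans (ler_eunormD _ _) _; rewrite [eunorm (a *: _)]eunormZ [eunorm ((a - b) *: _)]eunormZ (gtr0_norm nu0).
    have -> : t * (gnomonic_lip D * D) = t / (1 - D) * D + t * (1 - D) ^- 2 * D * D.
      by rewrite /gnomonic_lip; ring.
    apply: lerD; apply: ler_pM => //; rewrite ?eunorm_ge0 ?(ltW nu0)//.
    exact: le_trans (ler_eunorm_vcons_tail _ _) xe.
rewrite mu_slices//.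
have mpow D' : measurable_fun D' (fun t : measurableTypeR R => (c * t ^+ n)%:E).
  by apply/measurable_funTS/measurable_EFinP; apply: measurable_funM => //; exact: measurable_funX.
apply: (@le_trans _ _ ((n.+1%:R)%:E * \int[leb]_(t in `[0%R, 1%R]) (c * t ^+ n)%:E))%E.
  rewrite lee_pmul2l//.
  rewrite [leRHS]integral_mkcond; apply: ge0_le_integral => //.
  - by apply: measurable_mu_slice.
  - by apply/(measurable_restrictT _ _).1 => //; exact: mpow.
  - move=> t _; rewrite patchE mem_setE in_itv/=; apply: le_trans (key t) _.
    by case: ifP.
rewrite integral_powers// -!EFinM lee_fin /c expr1n mulr1 mulrC divfK ?pnatr_eq0//.
by rewrite -mulrA exprMn [leRHS]mulrCA.
Qed.

Lemma measurable_cball_set n (a : R) : measurable [set v : 'rV[R]_n | eunorm v <= a].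
Proof.
have -> : [set v : 'rV[R]_n | eunorm v <= a] = (@eunorm R n) @^-1` `]-oo, a].
  by apply/seteqP; split => v /=; rewrite in_itv.
by rewrite -[X in measurable X]setTI; apply: measurable_eunorm => //; exact: measurable_itv.
Qed.

Lemma mu_cball n (a : R) : 0 <= a ->
  (mu R n [set v | (eunorm v <= a)%R] = (ball_vol n * a ^+ n)%:E)%E.
Proof.
move=> a0; rewrite -volume_cball_ge0// -(setIT [set v | _]) -integral_indic//.
  by apply: eq_integral => v _; rewrite indicE mem_setE.
exact: measurable_cball_set.
Qed.

Definition cap n (x : 'rV[R]_n) (r : R) : set 'rV[R]_n :=
  [set y | eunorm y = 1 /\ eunorm (y - x) <= r].

Lemma measurable_cap n (x : 'rV[R]_n) r : measurable (cap x r).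
Proof.
have -> : cap x r = (@eunorm R n) @^-1` [set 1] `&` (fun y => eunorm (y - x)) @^-1` `]-oo, r].
  by apply/seteqP; split => v /=; rewrite in_itv.
apply: measurableI; rewrite -[X in measurable X]setTI.
  by apply: measurable_eunorm => //; exact: measurable_set1.
have mB : measurable_fun setT (fun y : rVm R n => y - x).
  by apply: measurable_rVD; [exact: measurable_id | exact: measurable_cst].
by apply: (measurableT_comp measurable_eunorm mB) => //; exact: measurable_itv.
Qed.

(** With the centre rotated to the pole, every point at height t <= 1/(1+r) and horizontal distance
    at most t r belongs to the cone: its norm is at most t (1 + r) and its direction is within r of
    the pole. Integrating the volumes of these balls of radius t r gives the bound. *)
Lemma cone_cap_ge n (x : 'rV[R]_n.+1) (r : R) : eunorm x = 1 -> 0 <= r ->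
  ((ball_vol n * r ^+ n)%:E <= ((1 + r) ^+ n.+1 * n.+1%:R)%:E * mu R n.+1 (cone (cap x r)))%E.
Proof.
move=> x1 r0.
have [M [hM eM]] := householder (eunorm_e0 n) x1.
rewrite (cone_orth hM (measurable_cap x r)); set C' := [set y | cap x r (y *m M)].
have mC' : measurable C'.
  by rewrite -[X in measurable X]setTI; apply: measurable_mulmx => //; exact: measurable_cap.
pose b := (1 + r)^-1.
have b0 : 0 <= b by rewrite invr_ge0 addr_ge0.
have r10 : 0 < 1 + r by rewrite ltr_pwDl.
have c0 : 0 <= ball_vol n * r ^+ n by rewrite mulr_ge0 ?ball_vol_ge0// exprn_ge0.
suff : (((ball_vol n * r ^+ n) * b ^+ n.+1 / n.+1%:R)%:E <= mu R n.+1 (cone C'))%E.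
  have k0 : 0 <= (1 + r) ^+ n.+1 * n.+1%:R by rewrite mulr_ge0// exprn_ge0// ltW.
  move=> h; apply: le_trans (lee_wpmul2l _ h); rewrite ?lee_fin//.
  rewrite exprVn le_eqVlt; apply/orP; left; apply/eqP; field.
  by rewrite nat1r pnatr_eq0/= expf_neq0// gt_eqF.
have mpow D : measurable_fun D (fun t : measurableTypeR R => (ball_vol n * r ^+ n * t ^+ n)%:E).
  by apply/measurable_funTS/measurable_EFinP; apply: measurable_funM => //; exact: measurable_funX.
rewrite -integral_powers// mu_slices; last exact: measurable_cone.
rewrite -integral_itv_obnd_cbnd//; first last.
  exact: mpow.
rewrite [leLHS]integral_mkcond; apply: ge0_le_integral => //.
- by move=> t _; rewrite patchE; case: ifPn => // /[!inE]/=; rewrite in_itv/= => /andP[t0 _]; rewrite lee_fin mulr_ge0// exprn_ge0// ltW.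
- by apply/(measurable_restrictT _ _).1 => //; exact: mpow.
- by apply: measurable_mu_slice; exact: measurable_cone.
move=> t _; rewrite patchE mem_setE in_itv/=; case: ifPn => [/andP[tp tb]|_]; last exact: measure_ge0.
have t0 := ltW tp.
have -> : ball_vol n * r ^+ n * t ^+ n = ball_vol n * (t * r) ^+ n by rewrite exprMn; ring.
rewrite -mu_cball ?mulr_ge0//.
apply: le_measure; rewrite ?inE.
  exact: measurable_cball_set.
  by apply: measurable_slice; exact: measurable_cone.
move=> u /= utr.
have N1 : t <= eunorm (vcons t u).
  by apply: le_trans (ler_norm _) _; have := ler_coord_eunorm (vcons t u) ord0; rewrite vcons0.
have N0 : 0 < eunorm (vcons t u) by apply: lt_le_trans N1.
set N := eunorm (vcons t u) in N1 N0 *.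
have N2 : N ^+ 2 = t ^+ 2 + eunorm u ^+ 2.
  by rewrite /N eunorm_vcons sqr_sqrtr// addr_ge0 ?sqr_ge0.
have u2 : eunorm u ^+ 2 <= (t * r) ^+ 2 by rewrite ler_sqr ?nnegrE ?eunorm_ge0 ?mulr_ge0.
split.
  rewrite N0/= -(@ler_pXn2r _ 2)// ?nnegrE ?(ltW N0)// N2.
  have tb' : t * (1 + r) <= 1 by rewrite -ler_pdivlMr// mul1r.
  have tb2 : (t * (1 + r)) ^+ 2 <= 1 by rewrite exprn_ile1// mulr_ge0// ltW.
  rewrite expr1n; apply: le_trans tb2; apply: le_trans (_ : t ^+ 2 + (t * r) ^+ 2 <= _).
    by rewrite lerD2l.
  by have : 0 <= t ^+ 2 * r; [rewrite mulr_ge0// sqr_ge0 | lra].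
split; first by rewrite eunorm_orth// eunormZ ger0_norm ?invr_ge0 ?(ltW N0)// mulVf// gt_eqF.
rewrite -eM -mulmxBl eunorm_orth// scale_vcons sub_vcons subr0.
rewrite -(@ler_pXn2r _ 2)// ?nnegrE ?eunorm_ge0// eunorm_vcons sqr_sqrtr; last by rewrite addr_ge0 ?sqr_ge0.
rewrite eunormZ exprMn real_normK ?num_real//.
(* The squared distance of a unit vector to the pole is 2 minus twice its first coordinate, here
   t/N. *)
have -> : (N^-1 * t - 1) ^+ 2 + N^-1 ^+ 2 * eunorm u ^+ 2 = (2 * N - 2 * t) / N.
  have -> : eunorm u ^+ 2 = N ^+ 2 - t ^+ 2 by rewrite N2; ring.
  by field; rewrite gt_eqF.
rewrite ler_pdivrMr// -(ler_pM2l (exprn_gt0 2 tp)).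
apply: le_trans (_ : N * eunorm u ^+ 2 <= _).
  have -> : eunorm u ^+ 2 = (N - t) * (N + t) by rewrite -(addrK (t ^+ 2) (eunorm u ^+ 2)) (addrC _ (t ^+ 2)) -N2; ring.
  have -> : t ^+ 2 * (2 * N - 2 * t) = (N - t) * (2 * (t * t)) by ring.
  rewrite [leRHS]mulrCA ler_wpM2l ?subr_ge0//.
  have h : t * t <= N * t by rewrite ler_wpM2r.
  have h' : N * t <= N * N by rewrite ler_wpM2l// ltW.
  by rewrite mulrDr; lra.
have -> : t ^+ 2 * (r ^+ 2 * N) = N * (t * r) ^+ 2 by ring.
by rewrite ler_wpM2l ?(ltW N0).
Qed.

End cone.

Lemma le_at_right0 (R : realType) (f : R -> R) a : {for 0, continuous f} ->
  (forall x, 0 < x < 1 -> a <= f x) -> a <= f 0.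
Proof.
move=> cf h; apply/ler_addgt0Pr => e e0.
move/cvgrPdist_le : cf => /(_ e e0)/nbhs_ballP[d /= d0 hd].
pose x := Num.min (d / 2) (1 / 2).
have x0 : 0 < x by rewrite lt_min !divr_gt0.
have x1 : x < 1 by rewrite gt_min; apply/orP; right; lra.
have xd : x < d by rewrite gt_min; apply/orP; left; lra.
have := hd x; rewrite /ball/= sub0r normrN gtr0_norm// => /(_ xd) hx.
have := h x; rewrite x0 x1 => /(_ isT) /le_trans; apply.
by move: hx; rewrite ler_norml => /andP[]; lra.
Qed.

Section haus_cone.
Context {R : realType}.
Implicit Types n m : nat.

Lemma ediam_ge0 n (C : set 'rV[R]_n) : C !=set0 -> (0 <= ediam C)%E.
Proof.
move=> [x Cx]; apply: ereal_sup_ubound; exists x => //; exists x => //.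
by rewrite subrr eunorm0.
Qed.

Lemma ediam_le n (C : set 'rV[R]_n) (D : R) :
  (forall x y, C x -> C y -> eunorm (x - y) <= D) -> (ediam C <= D%:E)%E.
Proof. by move=> h; apply: ge_ereal_sup => _ [x Cx [y Cy <-]]; rewrite lee_fin h. Qed.

Lemma le_ediam n (C : set 'rV[R]_n) (D : R) x y :
  (ediam C <= D%:E)%E -> C x -> C y -> eunorm (x - y) <= D.
Proof.
move=> h Cx Cy; rewrite -lee_fin; apply: le_trans h.
by apply: ereal_sup_ubound; exists x => //; exists y.
Qed.

Lemma le_fine_ediam n (C : set 'rV[R]_n) (D : R) : (ediam C <= D%:E)%E -> C !=set0 ->
  [/\ ediam C = (fine (ediam C))%:E, 0 <= fine (ediam C) & fine (ediam C) <= D].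
Proof.
move=> CD C0; have d0 := ediam_ge0 C0.
have fd : ediam C \is a fin_num by rewrite ge0_fin_numE// (le_lt_trans CD)// ltry.
by rewrite -!lee_fin !fineK//; split.
Qed.

Lemma haus_cost0 n m : haus_cost m (set0 : set 'rV[R]_n) = 0%E.
Proof. by rewrite /haus_cost; case: asboolP. Qed.

Lemma haus_costE n m (C : set 'rV[R]_n) : C !=set0 ->
  haus_cost m C = (ball_vol m * (fine (ediam C) / 2) ^+ m)%:E.
Proof. by move=> /set0P/eqP C0; rewrite /haus_cost; case: asboolP. Qed.

Lemma haus_cost_ge0 n m (C : set 'rV[R]_n) : (0 <= haus_cost m C)%E.
Proof.
have [->|/set0P C0] := eqVneq C set0; first by rewrite haus_cost0.
rewrite haus_costE// lee_fin mulr_ge0 ?ball_vol_ge0// exprn_ge0// divr_ge0//.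
by rewrite fine_ge0// ediam_ge0.
Qed.

Lemma haus_cost_le n m (C : set 'rV[R]_n) (D : R) : 0 <= D ->
  (ediam C <= D%:E)%E -> (haus_cost m C <= (ball_vol m * (D / 2) ^+ m)%:E)%E.
Proof.
move=> D0 CD; have [->|/set0P C0] := eqVneq C set0.
  by rewrite haus_cost0 lee_fin mulr_ge0 ?ball_vol_ge0// exprn_ge0// divr_ge0.
have [_ f0 fD] := le_fine_ediam CD C0.
by rewrite haus_costE// lee_fin ler_wpM2l ?ball_vol_ge0// lerXn2r// ?nnegrE ?divr_ge0// ler_wpM2r.
Qed.

Lemma closure_sub_closed (T : topologicalType) (A B : set T) : closed B -> A `<=` B -> closure A `<=` B.
Proof. by move=> /closure_id {2}-> /closure_subset. Qed.

(** Sets of a covering are arbitrary; taking closures makes them measurable at no cost in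
    diameter. *)
Lemma closure_diam n (C : set 'rV[R]_n) (D : R) :
  (forall x y, C x -> C y -> eunorm (x - y) <= D) ->
  forall x y, closure C x -> closure C y -> eunorm (x - y) <= D.
Proof.
have clo (z : 'rV[R]_n) : closed [set y | eunorm (z - y) <= D].
  apply: (@preimage_closed 'rV[R]_n R (fun y => eunorm (z - y)) [set t : R | t <= D]); last exact: closed_le.
  move=> y _; apply: (@lipschitz_continuous_rV _ _ _ 1) => u w.
  by rewrite mul1r (le_trans (ler_eunorm_dist _ _))// opprB addrC addrA subrK -opprB eunormN.
move=> h; have h1 x y : C x -> closure C y -> eunorm (x - y) <= D.
  by move=> Cx Cy; apply: closure_sub_closed (clo x) _ _ Cy => z Cz; exact: h.
move=> x y Cx Cy; rewrite -eunormN opprB.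
apply: closure_sub_closed (clo y) _ _ Cx => z Cz /=; rewrite -eunormN opprB; exact: h1.
Qed.

Lemma mu_cone_lty n (A : set 'rV[R]_n) : measurable A -> (mu R n (cone A) < +oo)%E.
Proof.
move=> mA; apply: le_lt_trans (ltry (ball_vol n * 1 ^+ n)); rewrite -mu_cball//.
apply: le_measure; rewrite ?inE; [exact: measurable_cone | exact: measurable_cball_set|].
by move=> v [/andP[]].
Qed.

Lemma gnomonic_lip_le (x y : R) : 0 <= x -> x <= y -> y < 1 -> gnomonic_lip x <= gnomonic_lip y.
Proof.
move=> x0 xy y1; have h : (1 - x)^-1 <= (1 - y)^-1.
  by rewrite lef_pV2 ?posrE ?subr_gt0//; lra.
have p : 0 <= (1 - x)^-1 by rewrite invr_ge0; lra.
apply: lerD => //; apply: ler_pM => //; first by rewrite invr_ge0 exprn_ge0//; lra.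
by rewrite -!exprVn lerXn2r// nnegrE//; apply: le_trans h.
Qed.

Lemma gnomonic_lip_ge0 (x : R) : 0 <= x < 1 -> 0 <= gnomonic_lip x.
Proof.
move=> /andP[x0 x1]; apply: addr_ge0; rewrite ?invr_ge0 ?mulr_ge0 ?invr_ge0 ?exprn_ge0//; lra.
Qed.

Lemma mu_cone_le_cover m (A : set 'rV[R]_m.+1) (C : (set 'rV[R]_m.+1)^nat) (D : R) :
  measurable A -> (forall x, A x -> eunorm x = 1) -> 0 < D < 1 ->
  A `<=` \bigcup_i C i -> (forall i, (ediam (C i) <= D%:E)%E) ->
  ((m.+1%:R)%:E * mu R m.+1 (cone A) <=
   (gnomonic_lip D ^+ m)%:E * \sum_(0 <= i <oo) haus_cost m (C i))%E.
Proof.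
move=> mA A1 /andP[D0 D1] AC CD.
pose S := [set x : 'rV[R]_m.+1 | eunorm x = 1].
have clS : closed S.
  apply: (@preimage_closed 'rV[R]_m.+1 R (@eunorm R m.+1) [set t : R | t = 1]); last exact: closed_eq.
  by move=> y _; exact: eunorm_continuous.
pose K i := closure (C i `&` S).
have K1 i x : K i x -> eunorm x = 1.
  by move=> Kx; apply: closure_sub_closed clS _ _ Kx => y [].
have mK i : measurable (K i).
  rewrite -(setCK (K i)); apply: measurableC; apply: open_measurable_rV.
  by apply: closed_openC; exact: closed_closure.
have L0 : 0 <= gnomonic_lip D by rewrite gnomonic_lip_ge0// (ltW D0).
have AK : cone A `<=` \bigcup_i cone (K i).
  move=> v [h Av]; have [i _ Ci] := AC _ Av; exists i => //; split => //.
  by apply: subset_closure; split => //; exact: A1.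
have bound i : ((m.+1%:R)%:E * mu R m.+1 (cone (K i)) <=
    (gnomonic_lip D ^+ m)%:E * haus_cost m (C i))%E.
  have [C0|/set0P C0] := eqVneq (C i) set0.
    have -> : cone (K i) = set0.
      by apply/seteqP; split => // v [_]; rewrite /K C0 set0I closure0.
    by rewrite measure0 mule0 C0 haus_cost0 mule0.
  have [dE d0 dD] := le_fine_ediam (CD i) C0.
  rewrite haus_costE//; set Di := fine _ in dE d0 dD *.
  apply: le_trans (_ : ((gnomonic_lip Di ^+ m)%:E * (ball_vol m * (Di / 2) ^+ m)%:E <= _)%E).
    apply: cone_diam_le; rewrite ?d0 ?(le_lt_trans dD)//; first exact: K1.
    apply: closure_diam => x y [Cx _] [Cy _].
    by apply: le_ediam Cx Cy; rewrite dE.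
  rewrite -!EFinM lee_fin ler_wpM2r//.
    by rewrite mulr_ge0 ?ball_vol_ge0// exprn_ge0// divr_ge0.
  by rewrite lerXn2r// ?nnegrE// ?gnomonic_lip_le// gnomonic_lip_ge0// d0 (le_lt_trans dD).
apply: (@le_trans _ _ ((m.+1%:R)%:E * \sum_(0 <= i <oo) mu R m.+1 (cone (K i))))%E.
  rewrite lee_pmul2l//; apply: measure_sigma_subadditive => //.
    by move=> i; exact: measurable_cone.
  exact: measurable_cone.
rewrite -!nneseriesZl//; last by move=> i _; exact: haus_cost_ge0.
apply: lee_nneseries => [i _|i _]; last exact: bound.
by rewrite mule_ge0.
Qed.

Lemma ball_vol_gt0 n : 0 < ball_vol n :> R.
Proof.
have [k] := ubnP n; elim: k n => // k IH [|[|n]] /ltnSE nk //=.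
by rewrite mulr_gt0 ?IH ?(leq_trans _ nk)// divr_gt0// mulr_gt0// pi_gt0.
Qed.

Definition admissible n (A U : set 'rV[R]_n) (r0 : R) (x : 'rV[R]_n) (r : R) : Prop :=
  [/\ A x, 0 < r <= r0 & cap x r `<=` A `\` U].

Definition ocap n (k : R) (o : option ('rV[R]_n * R)) : set 'rV[R]_n :=
  if o is Some (x, r) then cap x (k * r) else set0.

(** A chosen radius is at least half of every radius still available. [None] records that nothing is
    left; it contributes the empty set, so that the selection is an infinite sequence in all
    cases. *)
Definition greedy n (A : set 'rV[R]_n) (r0 : R) (U : set 'rV[R]_n) (o : option ('rV[R]_n * R)) : Prop :=
  if o is Some (x, r) then admissible A U r0 x r /\
    (forall x' r', admissible A U r0 x' r' -> r' <= 2 * r)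
  else forall x' r', ~ admissible A U r0 x' r'.

Lemma greedy_exists n (A : set 'rV[R]_n) (r0 : R) U : exists o, greedy A r0 U o.
Proof.
have [[x [r xr]]|none] := pselect (exists x r, admissible A U r0 x r); last first.
  by exists None => x r xr; apply: none; exists x, r.
pose Q := [set r | exists x, admissible A U r0 x r].
have hsQ : has_sup Q.
  split; first by exists r, x.
  by exists r0 => r' [x' [_ /andP[]]].
have r_gt0 : 0 < r by case: xr => _ /andP[].
have sQ : r <= sup Q by apply: sup_upper_bound => //; exists x.
have [|r' [x' xr'] hr'] := @sup_adherent _ _ (sup Q / 2) _ hsQ; first lra.
exists (Some (x', r')); split => // y s ys.
have : s <= sup Q by apply: sup_upper_bound => //; exists y.
lra.
Qed.

Lemma cap_ediam n (x : 'rV[R]_n) r : (ediam (cap x r) <= (2 * r)%:E)%E.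
Proof.
apply: ediam_le => y z [_ hy] [_ hz].
have -> : y - z = (y - x) + - (z - x) by rewrite opprB addrA subrK.
by apply: le_trans (ler_eunormD _ _) _; rewrite eunormN; lra.
Qed.

Lemma cap_compl n (y x : 'rV[R]_n) (s : R) : eunorm x = 1 -> ~ cap y s x ->
  exists2 r, 0 < r & forall z, cap x r z -> ~ cap y s z.
Proof.
move=> x1 xs; have {}xs : s < eunorm (x - y).
  by rewrite ltNge; apply/negP => h; apply: xs.
exists ((eunorm (x - y) - s) / 2); first by rewrite divr_gt0// subr_gt0.
move=> z [_ zx] [_ zy].
have : eunorm (x - y) <= eunorm (z - x) + eunorm (z - y).
  rewrite -(eunormN (z - x)); apply: le_trans (ler_eunormD _ _).
  by rewrite opprB addrA subrK.
lra.
Qed.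

(** * Greedy Vitali packing by caps *)

Section vitali.
Variables (m : nat) (A : set 'rV[R]_m.+1) (r0 : R).
Hypothesis A1 : forall x, A x -> eunorm x = 1.
Hypothesis mA : measurable A.
Hypothesis oA : forall x, A x -> exists2 r, 0 < r & cap x r `<=` A.
Hypothesis r0_gt0 : 0 < r0.
Variable sel : set 'rV[R]_m.+1 -> option ('rV[R]_m.+1 * R).
Hypothesis selP : forall U, greedy A r0 U (sel U).

Fixpoint used (k : nat) : set 'rV[R]_m.+1 :=
  if k is k'.+1 then used k' `|` ocap 1 (sel (used k')) else set0.

Definition chosen k := ocap 1 (sel (used k)).
(** The factor is 3: a centre x whose cap of radius q meets the chosen cap of radius s, with q <= 2
    s, lies within q + s <= 3 s of the chosen centre. Only centres need to be covered, not their
    whole caps. *)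
Definition enlarged k := ocap 3 (sel (used k)).

Lemma chosen_sub k : chosen k `<=` A `\` used k.
Proof.
rewrite /chosen; have := selP (used k); case: (sel _) => [[x r]|_ y []] /=.
by rewrite mul1r => -[[]].
Qed.

Lemma used_mono j k : (j <= k)%N -> used j `<=` used k.
Proof.
move=> /subnK <-; elim: (k - j)%N => //= i IH.
by apply: subset_trans IH _; left.
Qed.

Lemma trivIset_chosen : trivIset setT chosen.
Proof.
apply: ltn_trivIset => k j jk; apply/seteqP; split => // x [cx /chosen_sub[_ nx]].
by apply: nx; apply: (used_mono jk); right.
Qed.

Lemma measurable_chosen k : measurable (chosen k).
Proof. by rewrite /chosen; case: (sel _) => [[x r]|] //=; exact: measurable_cap. Qed.

Lemma sum_mu_chosen :
  (\sum_(0 <= k <oo) mu R m.+1 (cone (chosen k)) <= mu R m.+1 (cone A))%E.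
Proof.
have mC k : measurable (cone (chosen k)) by apply: measurable_cone; exact: measurable_chosen.
rewrite -measure_semi_bigcup//; last 2 first.
- apply/trivIsetP => i j _ _ ij; apply/seteqP; split => // v [[_ vi] [_ vj]].
  have /trivIsetP/(_ i j I I ij) := trivIset_chosen.
  by move=> h; have : (chosen i `&` chosen j) ((eunorm v)^-1 *: v) by []; rewrite h.
- exact: bigcup_measurable.
apply: le_measure; rewrite ?inE; [exact: bigcup_measurable | exact: measurable_cone |].
by move=> v [k _ [h /chosen_sub[]]]; split.
Qed.

(** Finitely many caps have been removed, and each of them is closed. *)
Lemma used_compl k x : A x -> ~ used k x ->
  exists2 r, 0 < r & cap x r `<=` A `\` used k.
Proof.
move=> Ax; elim: k => [_|k IH] /=.
  by have [r r0' h] := oA Ax; exists r => // y /h; split.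
move=> /not_orP[/IH[r1 r1_gt0 h1] nx].
have [r2 r2_gt0 h2] : exists2 r, 0 < r & forall z, cap x r z -> ~ ocap 1 (sel (used k)) z.
  case: (sel _) nx => [[y s]|] /= nx; last by exists 1.
  by apply: cap_compl => //; exact: A1.
exists (Num.min r1 r2); first by rewrite lt_min r1_gt0.
move=> z [z1 zx]; move: zx; rewrite le_min => /andP[zx1 zx2].
have [Az nz] := h1 z (conj z1 zx1).
by split => // -[//|]; exact: h2 (conj z1 zx2).
Qed.

Let lam := (1 + r0) ^+ m.+1 * m.+1%:R.

Lemma lam_gt0 : 0 < lam.
Proof. by rewrite mulr_gt0 ?ltr0n// exprn_gt0// addr_gt0. Qed.

Lemma radius_le k x r : sel (used k) = Some (x, r) -> A x /\ 0 < r <= r0.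
Proof. by move=> h; have := selP (used k); rewrite h => -[[]]. Qed.

Lemma chosen_ge k x r : sel (used k) = Some (x, r) ->
  ((ball_vol m * r ^+ m)%:E <= lam%:E * mu R m.+1 (cone (chosen k)))%E.
Proof.
move=> h; have [/A1 x1 /andP[rp rr]] := radius_le h.
rewrite /chosen h /= mul1r; apply: le_trans (cone_cap_ge x1 (ltW rp)) _.
rewrite lee_wpmul2r// lee_fin ler_wpM2r// lerXn2r// ?nnegrE ?addr_ge0 ?(ltW rp) ?(ltW r0_gt0)//.
by rewrite lerD2l.
Qed.

Lemma ocap_cost (q : R) k : 0 < q -> (haus_cost m (ocap q (sel (used k))) <=
  (q ^+ m)%:E * (lam%:E * mu R m.+1 (cone (chosen k))))%E.
Proof.
move=> q0; case h : (sel (used k)) => [[x r]|] /=; last first.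
  by rewrite haus_cost0 !mule_ge0// lee_fin ?exprn_ge0 ?(ltW q0)// ltW// lam_gt0.
have [_ /andP[rp rr]] := radius_le h.
apply: le_trans (haus_cost_le m _ (cap_ediam x (q * r))) _.
  by rewrite !mulr_ge0// ltW.
apply: le_trans (lee_wpmul2l _ (chosen_ge h)); last by rewrite lee_fin exprn_ge0// ltW.
by rewrite -EFinM lee_fin (_ : 2 * (q * r) / 2 = q * r) ?exprMn 1?mulrCA//; field.
Qed.

Lemma tail_small (c : R) : 0 < c ->
  exists N, forall M, (N <= M)%N -> (\sum_(M <= k <oo) mu R m.+1 (cone (chosen k)) < c%:E)%E.
Proof.
move=> c0; have h : (\sum_(0 <= k <oo) mu R m.+1 (cone (chosen k)) < +oo)%E.
  by apply: le_lt_trans sum_mu_chosen _; exact: mu_cone_lty.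
have /(_ (fun k _ => measure_ge0 _ _)) := nneseries_tail_cvg h.
move=> /fine_cvgP[[N1 _ h1] /cvgrPdist_lt/(_ c c0)[N2 _ h2]].
exists (maxn N1 N2) => M; rewrite geq_max => /andP[hM1 hM2].
rewrite -(fineK (h1 M hM1)) lte_fin; apply: le_lt_trans (ler_norm _) _.
by rewrite -normrN -sub0r; exact: h2.
Qed.

(** Each cap of radius at least [r] occupies a fixed amount of cone volume, while the chosen cones
    are disjoint inside a set of finite volume. *)
Lemma radii_small r N : 0 < r ->
  ~ (forall k, (N <= k)%N -> exists x s, sel (used k) = Some (x, s) /\ r <= s).
Proof.
move=> r_gt0 h.
have c0 : 0 < ball_vol m * r ^+ m / lam by rewrite divr_gt0 ?lam_gt0// mulr_gt0 ?ball_vol_gt0 ?exprn_gt0.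
have [M hM] := tail_small c0; pose K := maxn M N.
have [x [s [hs rs]]] := h K (leq_maxr _ _).
have := hM K (leq_maxl _ _); apply/negP; rewrite -leNgt.
apply: le_trans (nneseries_lim_ge K.+1 _) => //; rewrite big_nat1.
rewrite mulrC EFinM lee_pdivrMl ?lam_gt0//; apply: le_trans (chosen_ge hs).
by rewrite lee_fin ler_wpM2l ?ball_vol_ge0// lerXn2r// nnegrE ltW// (lt_le_trans r_gt0).
Qed.

(** Around a point missed by the first [N] caps there is a cap of some radius q avoiding them. As
    long as it avoids the chosen caps, the greedy rule keeps choosing radii at least q/2, which
    cannot last. At the first stage where it is met, tripling the chosen cap reaches the point. *)
Lemma vitali_covers N : A `<=` \bigcup_k (if (k < N)%N then chosen k else enlarged k).
Proof.
move=> x Ax; have [Ux|Ux] := pselect (used N x).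
  suff : forall j, (j <= N)%N -> used j x -> exists2 k, (k < N)%N & chosen k x.
    by move=> /(_ _ (leqnn N) Ux)[k kN cx]; exists k => //; rewrite kN.
  elim=> // j IH jN [|cx]; first by apply: IH; exact: ltnW.
  by exists j.
have [r r_gt0 xr] := used_compl Ax Ux.
pose q := Num.min r r0; have q_gt0 : 0 < q by rewrite lt_min r_gt0.
have adm k : cap x q `<=` A `\` used k -> admissible A (used k) r0 x q.
  by move=> h; split => //; rewrite q_gt0 /q ge_min lexx orbT.
have xq : cap x q `<=` A `\` used N.
  by move=> y [y1 yx]; apply: xr; split => //; apply: le_trans yx _; rewrite ge_min lexx.
have big k : cap x q `<=` A `\` used k -> exists y s, sel (used k) = Some (y, s) /\ q <= 2 * s.
  move=> h; have := selP (used k); case: (sel _) => [[y s] [_ /(_ _ _ (adm _ h))]|/(_ _ _ (adm _ h))//].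
  by exists y, s.
(* the first stage whose cap meets [cap x q] *)
have [i hi] : exists i, ~ (cap x q `<=` A `\` used (N + i.+1)).
  apply: contrapT => /forallNP h.
  apply: (@radii_small (q / 2) N); first by rewrite divr_gt0.
  move=> k Nk; have [|y [s [hs qs]]] := big k.
    by have := h (k - N)%N; move/contrapT; rewrite addnS subnKC// => h' z /h'[Az nz]; split => // /(used_mono (leqnSn k)).
  by exists y, s; split => //; lra.
have [k hk [hk' hk'']] : exists2 k, (N <= k)%N & cap x q `<=` A `\` used k /\ ~ (cap x q `<=` A `\` used k.+1).
  elim: i hi => [|i IH hi]; first by rewrite addn1; exists N.
  have [h|h] := pselect (cap x q `<=` A `\` used (N + i.+1)); last exact: IH.
  by exists (N + i.+1)%N; [exact: leq_addr | split => //; rewrite -addnS].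
have [y [s [hs qs]]] := big k hk'.
exists k => //; rewrite ltnNge hk /= /enlarged hs /=; split; first exact: A1.
have [z [z1 zx] zs] : exists2 z, cap x q z & cap y s z.
  apply: contrapT => h; apply: hk'' => z zx; have [Az nz] := hk' _ zx; split => //= -[//|].
  by rewrite hs /= mul1r => zy; apply: h; exists z.
have := ler_eunormD (x - z) (z - y); rewrite addrA subrK -(eunormN (x - z)) opprB.
case: zs => _; lra.
Qed.

(** The first [N] caps cost at most [lam] times their cone volumes, and the remaining ones,
    enlarged, cost [3 ^+ m] times more, which is a small tail of a convergent series. An enlarged
    cap has diameter at most 6 [r0]. *)
Lemma haus_delta_vitali delta : 6 * r0 <= delta ->
  (haus_delta m delta A <= lam%:E * mu R m.+1 (cone A))%E.
Proof.
move=> r0d.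
have fin : (lam%:E * mu R m.+1 (cone A))%E \is a fin_num.
  by rewrite fin_numM// ge0_fin_numE// mu_cone_lty.
apply/lee_addgt0Pr => e e0.
have e'0 : 0 < e / (3 ^+ m * lam) by rewrite divr_gt0// mulr_gt0 ?lam_gt0 ?exprn_gt0.
have [N hN] := tail_small e'0.
pose C k := if (k < N)%N then chosen k else enlarged k.
have dC k : (ediam (C k) <= delta%:E)%E.
  have d0 : 0 <= delta by apply: le_trans r0d; rewrite mulr_ge0// ltW.
  rewrite /C /chosen /enlarged; have := @radius_le k.
  case: (sel _) => [[x r] /(_ _ _ erefl)[_ /andP[rp rr]]|_] /=; last first.
    by case: ifP => _; exact: ediam_le.
  by case: ifP => _; apply: le_trans (cap_ediam _ _) _; rewrite lee_fin; lra.
apply: (@le_trans _ _ (\sum_(0 <= k <oo) haus_cost m (C k))%E).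
  by apply: ereal_inf_lbound; exists C => //; split => //; exact: vitali_covers.
rewrite (nneseries_split 0 N); last by move=> k _; exact: haus_cost_ge0.
rewrite add0n; apply: leeD.
  apply: (@le_trans _ _ (lam%:E * \sum_(0 <= k < N) mu R m.+1 (cone (chosen k)))%E).
    rewrite ge0_sume_distrr//; rewrite !big_nat; apply: lee_sum => k /= kN.
    by rewrite /C kN; apply: le_trans (ocap_cost _ _) _ => //; rewrite expr1n mul1e.
  rewrite lee_pmul2l ?lte_fin ?lam_gt0//; apply: le_trans sum_mu_chosen.
  exact: nneseries_lim_ge.
apply: (@le_trans _ _ ((3 ^+ m * lam)%:E * \sum_(N <= k <oo) mu R m.+1 (cone (chosen k)))%E).
  rewrite -nneseriesZl//; rewrite -[leLHS]nneseries_addn; last by move=> k; exact: haus_cost_ge0.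
  rewrite -[leRHS](@nneseries_addn _ (fun k => (3 ^+ m * lam)%:E * mu R m.+1 (cone (chosen k)))%E); last first.
    by move=> k; rewrite mule_ge0// lee_fin mulr_ge0// ltW ?lam_gt0.
  apply: lee_nneseries => [k _ _|k _]; first exact: haus_cost_ge0.
  by rewrite /C ltnNge leq_addl /= EFinM -muleA; exact: ocap_cost.
have l0 : 0 < 3 ^+ m * lam by rewrite mulr_gt0 ?lam_gt0 ?exprn_gt0.
apply: le_trans (lee_wpmul2l _ (ltW (hN N (leqnn N)))) _; first by rewrite lee_fin ltW.
by rewrite -EFinM mulrC divfK// gt_eqF.
Qed.

End vitali.

Lemma haus_delta_le_cone m (A : set 'rV[R]_m.+1) delta eps :
  (forall x, A x -> eunorm x = 1) -> measurable A ->
  (forall x, A x -> exists2 r, 0 < r & cap x r `<=` A) ->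
  0 < delta -> 0 < eps ->
  (haus_delta m delta A <= ((1 + eps) ^+ m.+1 * m.+1%:R)%:E * mu R m.+1 (cone A))%E.
Proof.
move=> A1 mA oA d0 e0; pose r0 := Num.min (delta / 6) eps.
have r0_gt0 : 0 < r0 by rewrite lt_min divr_gt0.
have [sel selP] := choice (greedy_exists A r0).
apply: le_trans (haus_delta_vitali A1 mA oA r0_gt0 selP (delta := delta) _) _.
  have : r0 <= delta / 6 by rewrite ge_min lexx.
  lra.
rewrite lee_wpmul2r// lee_fin ler_wpM2r// lerXn2r// ?nnegrE ?addr_ge0 ?(ltW r0_gt0) ?(ltW e0)//.
by rewrite lerD2l ge_min lexx orbT.
Qed.

(** Coverings are pushed forward by images and pulled back by preimages. The latter do not increase
    diameters, though a preimage may be empty, where the cost is zero by convention. *)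
Lemma haus_delta_isometry a b m delta (i : 'rV[R]_a -> 'rV[R]_b) (A : set 'rV[R]_a) :
  (forall x y, eunorm (i x - i y) = eunorm (x - y)) ->
  haus_delta m delta (i @` A) = haus_delta m delta A.
Proof.
move=> isoi; apply/eqP; rewrite eq_le; apply/andP; split.
  apply: le_ereal_inf_tmp => _ [C [AC dC] <-].
  have dE k : ediam (i @` C k) = ediam (C k).
    congr (ereal_sup _); apply/seteqP; split => z /=.
      by move=> [_ [x Cx <-] [_ [y Cy <-] <-]]; exists x => //; exists y; rewrite ?isoi.
    by move=> [x Cx [y Cy <-]]; exists (i x); [exists x | exists (i y); [exists y | rewrite isoi]].
  apply: ereal_inf_lbound; exists (fun k => i @` C k).
    split => [_ [x /AC[k _ Cx] <-]|k]; first by exists k => //; exists x.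
    by rewrite dE.
  apply: eq_eseriesr => k _.
  have [->|/set0P Ck] := eqVneq (C k) set0; first by rewrite image_set0 !haus_cost0.
  rewrite !haus_costE ?dE//.
  by case: Ck => x Cx; exists (i x), x.
apply: le_ereal_inf_tmp => _ [C [AC dC] <-].
have dp k : (ediam (i @^-1` C k) <= ediam (C k))%E.
  apply: ge_ereal_sup => _ [x Cx [y Cy <-]]; apply: ereal_sup_ubound.
  by exists (i x) => //; exists (i y); rewrite ?isoi.
apply: (@le_trans _ _ (\sum_(0 <= k <oo) haus_cost m (i @^-1` C k))%E).
  apply: ereal_inf_lbound; exists (fun k => i @^-1` C k) => //; split => [x Ax|k].
    by have [k _ ?] := AC _ (imageP i Ax); exists k.
  exact: le_trans (dp k) (dC k).
apply: lee_nneseries => [k _ _|k _]; first exact: haus_cost_ge0.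
have [->|/set0P [x Cx]] := eqVneq (i @^-1` C k) set0; first by rewrite haus_cost0 haus_cost_ge0.
have Ck : C k !=set0 by exists (i x).
have [dE d0 dD] := le_fine_ediam (dC k) Ck.
by rewrite (haus_costE m Ck); apply: haus_cost_le => //; rewrite -dE.
Qed.

(** The packing gives the upper bound up to the factor (1 + e)^(m+1), the coverings give the lower
    bound up to [gnomonic_lip D ^+ m]. Both factors tend to 1 as e and [D] go to 0. *)
Lemma haus_cone m (A : set 'rV[R]_m.+1) :
  (forall x, A x -> eunorm x = 1) -> measurable A ->
  (forall x, A x -> exists2 r, 0 < r & cap x r `<=` A) ->
  haus m A = ((m.+1%:R)%:E * mu R m.+1 (cone A))%E.
Proof.
move=> A1 mA oA.
have fmu : mu R m.+1 (cone A) \is a fin_num by rewrite ge0_fin_numE// mu_cone_lty.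
have c0 : 0 <= fine (mu R m.+1 (cone A)) by rewrite fine_ge0.
have hle : (haus m A <= (m.+1%:R)%:E * mu R m.+1 (cone A))%E.
  apply: ge_ereal_sup => _ [delta d0 <-].
  suff h e : 0 < e < 1 -> (haus_delta m delta A <= ((1 + e) ^+ m.+1 * m.+1%:R * fine (mu R m.+1 (cone A)))%:E)%E.
    have : haus_delta m delta A \is a fin_num.
      rewrite fin_numElt; apply/andP; split.
        apply: lt_le_trans (ltNyr 0) _; apply: le_ereal_inf_tmp => _ [C _ <-].
        by apply: nneseries_ge0 => k _ _; exact: haus_cost_ge0.
      by apply: le_lt_trans (h (1 / 2) _) (ltry _); apply/andP; split; lra.
    move: h; set H := haus_delta _ _ _ => h fH.
    rewrite -(fineK fH) -(fineK fmu) -EFinM lee_fin.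
    have -> : m.+1%:R * fine (mu R m.+1 (cone A)) = (1 + 0) ^+ m.+1 * m.+1%:R * fine (mu R m.+1 (cone A)).
      by rewrite addr0 expr1n mul1r.
    apply: (@le_at_right0 _ (fun e => (1 + e) ^+ m.+1 * m.+1%:R * fine (mu R m.+1 (cone A)))).
      apply: cvgM; last exact: cvg_cst.
      apply: cvgM; last exact: cvg_cst.
      have c1 : {for 0, continuous (fun x : R => 1 + x)}.
        by apply: cvgD; [exact: cvg_cst | exact: cvg_id].
      exact: (@continuous_comp _ _ _ _ (fun y : R => y ^+ m.+1) _ c1 (@exprn_continuous _ _ _)).
    by move=> x /h; rewrite -lee_fin (fineK fH).
  move=> /andP[e0 _]; rewrite EFinM fineK//; exact: haus_delta_le_cone.
apply/eqP; rewrite eq_le hle /=.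
have fH : haus m A \is a fin_num.
  rewrite ge0_fin_numE; first by apply: le_lt_trans hle _; rewrite -(fineK fmu) -EFinM ltry.
  apply: le_trans (ereal_sup_ubound _ : haus_delta m 1 A <= _)%E; last by exists 1 => //=.
  apply: le_ereal_inf_tmp => _ [C _ <-].
  by apply: nneseries_ge0 => k _ _; exact: haus_cost_ge0.
rewrite -(fineK fmu) -(fineK fH) -EFinM lee_fin.
have -> : fine (haus m A) = gnomonic_lip (0 : R) ^+ m * fine (haus m A).
  by rewrite /gnomonic_lip mul0r subr0 invr1 addr0 expr1n mul1r.
apply: (@le_at_right0 _ (fun x => gnomonic_lip x ^+ m * fine (haus m A))).
  apply: cvgM; last exact: cvg_cst.
  have c1 : {for 0, continuous (fun x : R => 1 - x)}.
    by apply: cvgB; [exact: cvg_cst | exact: cvg_id].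
  have ci k : {for 0, continuous (fun x : R => (1 - x) ^- k)}.
    apply: cvgV; first by rewrite subr0 expr1n oner_eq0.
    exact: (@continuous_comp _ _ _ _ (fun y : R => y ^+ k) _ c1 (@exprn_continuous _ _ _)).
  have cl : {for 0, continuous (@gnomonic_lip R)}.
    apply: cvgD; last by apply: cvgM; [exact: cvg_id | exact: ci].
    exact: (ci 1%N).
  exact: (@continuous_comp _ _ _ _ (fun y : R => y ^+ m) _ cl (@exprn_continuous _ _ _)).
move=> D D01; rewrite -lee_fin !EFinM (fineK fmu) (fineK fH).
have [D0 D1] := andP D01.
have L0 : 0 <= gnomonic_lip D ^+ m by rewrite exprn_ge0// gnomonic_lip_ge0// (ltW D0).
apply: (@le_trans _ _ ((gnomonic_lip D ^+ m)%:E * haus_delta m D A)%E); last first.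
  by rewrite lee_wpmul2l// ereal_sup_ubound//; exists D.
have Lp : 0 < gnomonic_lip D ^+ m.
  by rewrite exprn_gt0// ltr_pwDl ?invr_gt0 ?subr_gt0// mulr_ge0 ?invr_ge0 ?exprn_ge0 ?subr_ge0 ?(ltW D0) ?(ltW D1).
rewrite -lee_pdivrMl//; apply: le_ereal_inf_tmp => _ [C [AC dC] <-].
by rewrite lee_pdivrMl//; exact: mu_cone_le_cover.
Qed.

End haus_cone.

(** * Hausdorff integrals over the sphere as volume integrals over the ball *)

Section sphere_integral.
Context {R : realType}.
Implicit Types n m : nat.
Local Notation leb := (@lebesgue_measure R).

Definition sph_cont n (psi : 'rV[R]_n -> R) :=
  forall x, eunorm x = 1 -> forall e, 0 < e ->
    exists2 r, 0 < r & forall y, cap x r y -> `|psi y - psi x| < e.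

Lemma open_ball_eu n (x : 'rV[R]_n) r : open [set y | eunorm (y - x) < r].
Proof.
apply: (@open_comp 'rV[R]_n R (fun y => eunorm (y - x)) [set t : R | t < r]); last exact: open_lt.
move=> y _; apply: (@lipschitz_continuous_rV _ _ _ 1) => u w.
by rewrite mul1r (le_trans (ler_eunorm_dist _ _))// opprB addrA subrK.
Qed.

Lemma measurable_rel_open n (A : set 'rV[R]_n) : (forall x, A x -> eunorm x = 1) ->
  (forall x, A x -> exists2 r, 0 < r & cap x r `<=` A) -> measurable A.
Proof.
move=> A1 oA.
pose P := [set p : 'rV[R]_n * R | cap p.1 p.2 `<=` A].
pose O := \bigcup_(p in P) [set y | eunorm (y - p.1) < p.2].
have -> : A = (@eunorm R n) @^-1` [set 1] `&` O.
  apply/seteqP; split => [x Ax|x [x1 [[y r] /= yr xy]]].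
    have [r r0 xr] := oA x Ax; split; first exact: A1.
    by exists (x, r) => //=; rewrite subrr eunorm0.
  by apply: yr; split => //; exact: ltW.
apply: measurableI.
  by rewrite -[X in measurable X]setTI; apply: measurable_eunorm => //; exact: measurable_set1.
by apply: open_measurable_rV; apply: bigcup_open => p _; exact: open_ball_eu.
Qed.

Lemma sph_superlevel_open n (psi : 'rV[R]_n -> R) t : sph_cont psi ->
  forall x, [set x | eunorm x = 1 /\ t < psi x] x ->
  exists2 r, 0 < r & cap x r `<=` [set x | eunorm x = 1 /\ t < psi x].
Proof.
move=> cpsi x [x1 tx]; have [|r r0 h] := cpsi x x1 (psi x - t); first by rewrite subr_gt0.
exists r => // y xy; split; first by case: xy.
by have := h y xy; rewrite ltr_norml => /andP[]; lra.
Qed.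

Lemma measurable_sph_superlevel n (psi : 'rV[R]_n -> R) t : sph_cont psi ->
  measurable [set x : 'rV[R]_n | eunorm x = 1 /\ t < psi x].
Proof.
by move=> c; apply: measurable_rel_open; [move=> x [] | exact: sph_superlevel_open].
Qed.

(** Continuity controls [psi] on the sphere only. At the origin, where the inverse of 0 is 0, the
    argument is the zero vector, so that point is treated apart. *)
Lemma measurable_radial n (psi : 'rV[R]_n -> R) : sph_cont psi ->
  measurable_fun setT (fun v : rVm R n => psi ((eunorm v)^-1 *: v)).
Proof.
move=> cpsi; have mN : measurable [set v : rVm R n | eunorm v = 0].
  have -> : [set v : rVm R n | eunorm v = 0] = (@eunorm R n) @^-1` [set 0] by [].
  by rewrite -[X in measurable X]setTI; apply: measurable_eunorm => //; exact: measurable_set1.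
rewrite -(setvU [set v : rVm R n | eunorm v = 0]); apply/measurable_funU => //; first exact: measurableC.
split.
  apply: (measurability _ (RGenOInfty.measurableE R)) => _ [_ [t ->] <-].
  rewrite (_ : _ `&` _ = (fun v => (eunorm v)^-1 *: v) @^-1` [set x | eunorm x = 1 /\ t < psi x]).
    rewrite -[X in measurable X]setTI; apply: measurable_normalize => //.
    exact: measurable_sph_superlevel.
  apply/seteqP; split => [v [/= v0 tv]|v [/= v1 tv]].
    rewrite /= in_itv/= andbT in tv; split => //.
    by rewrite eunormZ ger0_norm ?invr_ge0 ?eunorm_ge0// mulVf//; exact/eqP.
  split; last by rewrite /= in_itv/= tv.
  by move=> v0; move: v1; rewrite v0 invr0 scale0r eunorm0 => /eqP; rewrite eq_sym oner_eq0.
apply: (@eq_measurable_fun _ _ _ _ _ (cst (psi 0))); last exact: measurable_cst.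
by move=> v /set_mem /= ->; rewrite invr0 scale0r.
Qed.

Lemma integrable_ball_dom n (F : 'rV[R]_n -> R) (M a : R) : 0 <= a ->
  measurable_fun setT (F : rVm R n -> R) ->
  (forall v, `|F v| <= M * (eunorm v <= a)%R%:R) ->
  (mu R n).-integrable setT (EFin \o (F : rVm R n -> R)).
Proof.
move=> a0 mF FM; apply/integrableP; split; first exact/measurable_EFinP.
have M0 : 0 <= M by have := le_trans (normr_ge0 _) (FM 0); rewrite eunorm0 a0 mulr1.
have mind : measurable_fun setT (fun v : rVm R n => (((eunorm v <= a)%R%:R : R)%:E)).
  apply/measurable_EFinP; rewrite (_ : (fun _ => _) = \1_[set v : rVm R n | eunorm v <= a]).
    by apply: measurable_indic; exact: measurable_cball_set.
  by apply/funext => v; rewrite indicE mem_setE.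
apply: (@le_lt_trans _ _ (\int[mu R n]_v (M%:E * ((eunorm v <= a)%R%:R : R)%:E))%E).
  apply: ge0_le_integral => //.
  - by apply: measurableT_comp => //; exact/measurable_EFinP.
  - by apply: emeasurable_funM => //; exact: measurable_cst.
  - by move=> v _; rewrite /= -EFinM lee_fin.
by rewrite ge0_integralZl// ?volume_cball_ge0// -?EFinM ?ltry// => v _; rewrite lee_fin.
Qed.

(** The extension homogeneous of degree 0, cut off to the punctured unit ball: its superlevel sets
    at levels t >= 0 are cones over those of [psi]. *)
Definition unit_radial n (psi : 'rV[R]_n -> R) (v : 'rV[R]_n) : R :=
  psi ((eunorm v)^-1 *: v) * (0 < eunorm v <= 1)%R%:R.

Lemma measurable_unit_radial n (psi : 'rV[R]_n -> R) : sph_cont psi ->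
  measurable_fun setT (unit_radial psi : rVm R n -> R).
Proof.
move=> c; apply: measurable_funM; first exact: measurable_radial.
have -> : (fun v : rVm R n => (0 < eunorm v <= 1)%R%:R : R) = \1_((@eunorm R n) @^-1` `]0, 1]).
  apply/funext => v; rewrite indicE; congr (nat_of_bool _)%:R; apply/idP/idP => [h|/set_mem /=].
    by apply/mem_set; rewrite /= in_itv.
  by rewrite in_itv.
apply: measurable_indic; rewrite -[X in measurable X]setTI.
by apply: measurable_eunorm => //; exact: measurable_itv.
Qed.

Lemma integrable_unit_radial n (psi : 'rV[R]_n -> R) M : sph_cont psi ->
  (forall x, eunorm x = 1 -> `|psi x| <= M) ->
  (mu R n).-integrable setT (EFin \o (unit_radial psi : rVm R n -> R)).
Proof.
move=> c pM; apply: (@integrable_ball_dom _ _ `|M| 1) => //; first exact: measurable_unit_radial.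
move=> v; rewrite /unit_radial normrM normr_nat; case: (ltP 0 (eunorm v)) => /= v0; last by rewrite mulr0 mulr_ge0.
case: (eunorm v <= 1); rewrite ?mulr0// !mulr1; apply: le_trans (ler_norm _).
by apply: pM; rewrite eunormZ ger0_norm ?invr_ge0 ?eunorm_ge0// mulVf// gt_eqF.
Qed.

Lemma haus_isometry a b m (i : 'rV[R]_a -> 'rV[R]_b) (A : set 'rV[R]_a) :
  (forall x y, eunorm (i x - i y) = eunorm (x - y)) -> haus m (i @` A) = haus m A.
Proof.
move=> isoi; congr (ereal_sup _); apply/seteqP; split => _ [d d0 <-]; exists d => //;
  by rewrite haus_delta_isometry.
Qed.

(** Superlevel sets on the embedded sphere are isometric images of relatively open sets, to which
    [haus_cone] applies. The maximum with 0 is harmless because t >= 0. *)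
Lemma haus_superlevel m d (i : 'rV[R]_m.+1 -> 'rV[R]_d) (h : 'rV[R]_d -> R) t :
  (forall x y, eunorm (i x - i y) = eunorm (x - y)) ->
  sph_cont (h \o i) -> 0 <= t ->
  haus m (i @` [set x | eunorm x = 1] `&` [set xi | (t < h xi)%R]) =
  ((m.+1%:R)%:E * mu R m.+1 [set v | (t < Num.max (unit_radial (h \o i) v) 0)%R])%E.
Proof.
move=> isoi ch t0.
rewrite (_ : _ `&` _ = i @` [set x | eunorm x = 1 /\ t < h (i x)]); last first.
  apply/seteqP; split => [_ [[x x1 <-] hx]|_ [x [x1 hx] <-]]; first by exists x.
  by split => //; exists x.
rewrite haus_isometry// haus_cone; last 3 first.
- by move=> x [].
- exact: (measurable_sph_superlevel (psi := h \o i)).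
- exact: (sph_superlevel_open (psi := h \o i)).
congr (_ * mu _ _ _)%E; apply/seteqP; split => v /=.
  by move=> [v01 [_ tv]]; rewrite lt_max /unit_radial v01 mulr1 tv.
rewrite lt_max (ltNge t 0) t0 orbF /unit_radial.
have [v01|_] := boolP (0 < eunorm v <= 1); last by rewrite mulr0 ltNge t0.
rewrite mulr1 => tv; split => //; split => //.
by rewrite eunormZ ger0_norm ?invr_ge0 ?eunorm_ge0// mulVf// gt_eqF//; case/andP: v01.
Qed.

Lemma haus_int_layer m d (i : 'rV[R]_m.+1 -> 'rV[R]_d) (h : 'rV[R]_d -> R) :
  (forall x y, eunorm (i x - i y) = eunorm (x - y)) -> sph_cont (h \o i) ->
  (\int[leb]_(t in `[0%R, +oo[%classic)
      haus m (i @` [set x | eunorm x = 1%R] `&` [set xi | (t < h xi)%R]) =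
   (m.+1%:R)%:E * \int[mu R m.+1]_v (Num.max (unit_radial (h \o i) v) 0)%:E)%E.
Proof.
move=> isoi ch; have mU := measurable_unit_radial ch.
have mM : measurable_fun setT (fun v : rVm R m.+1 => Num.max (unit_radial (h \o i) v) 0).
  by apply: measurable_maxr => //; exact: measurable_cst.
rewrite layer_cake//; last by move=> v; rewrite le_max lexx orbT.
rewrite -ge0_integralZl//; last first.
  by apply: measurable_funTS; exact: measurable_superlevel.
apply: eq_integral => t; rewrite inE /= in_itv /= andbT => t0.
exact: haus_superlevel.
Qed.

(** The two halves of [haus_int] are the layer-cake formulas of the positive and negative parts;
    boundedness makes both finite, so that their difference is the integral. *)
Lemma haus_int_cone m d (i : 'rV[R]_m.+1 -> 'rV[R]_d) (h : 'rV[R]_d -> R) M :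
  (forall x y, eunorm (i x - i y) = eunorm (x - y)) -> sph_cont (h \o i) ->
  (forall x, eunorm x = 1 -> `|h (i x)| <= M) ->
  haus_int m (i @` [set x | eunorm x = 1]) h =
  (m.+1%:R * Rintegral (mu R m.+1) setT (unit_radial (h \o i)))%:E.
Proof.
move=> isoi ch hM; rewrite /haus_int haus_int_layer//.
have cN : sph_cont ((fun x => - h x) \o i).
  move=> x x1 e e0; have [r r0 H] := ch x x1 e e0; exists r => // y xy.
  by rewrite /= -opprD normrN; exact: H.
rewrite (haus_int_layer (h := fun x => - h x))//.
have iU := integrable_unit_radial ch hM.
rewrite EFinM /Rintegral fineK; last exact: integrable_fin_num.
have pE : (fun v => (Num.max (unit_radial (h \o i) v) 0)%:E) = (EFin \o unit_radial (h \o i))^\+%E.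
  by apply/funext => v; rewrite funeposE /= -EFin_max.
have nE : (fun v => (Num.max (unit_radial ((fun x => - h x) \o i) v) 0)%:E) = (EFin \o unit_radial (h \o i))^\-%E.
  by apply/funext => v; rewrite funenegE /= -EFin_max /unit_radial /= mulNr.
have E0 := @integralE _ _ _ (mu R m.+1) setT (EFin \o unit_radial (h \o i)).
rewrite pE nE -muleBr// -?E0//.
apply: fin_num_adde_defl; rewrite fin_numN; apply: integrable_fin_num => //.
exact: integrable_funeneg.
Qed.

End sphere_integral.

(** * Weighted volume of thin slabs *)

Section slab.
Context {R : realType}.
Local Notation leb := (@lebesgue_measure R).

Lemma mu_null_slices n (A : set 'rV[R]_n.+1) : measurable A ->
  (forall z, leb [set t | A (vcons t z)] = 0%E) -> mu R n.+1 A = 0%E.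
Proof.
move=> mA A0; rewrite -(setIT A) -integral_indic// integral_mu_succ2; last 2 first.
- by apply/measurable_EFinP; exact: measurable_indic.
- by move=> v; rewrite lee_fin.
rewrite integral0_eq// => z _; rewrite -(A0 z) -(setIT [set t | _]) -integral_indic//.
rewrite -[X in measurable X]setTI.
by apply: (measurable_vconsl z).
Qed.

Lemma lebesgue_pm (s : R) (A : set R) : measurable A -> (forall t, A t -> `|t| = s) -> leb A = 0%E.
Proof.
move=> mA h; apply/eqP; rewrite -measure_le0.
have c0 : leb [set s; - s] = 0%E.
  by apply: countable_lebesgue_measure0; apply: finite_set_countable; exact: finite_set2.
rewrite -c0; apply: le_measure; rewrite ?inE//.
  by apply: measurableU; exact: measurable_set1.
move=> t /h ts; have [t0|t0] := leP 0 t; [left|right].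
  by rewrite -ts ger0_norm.
by rewrite /= -ts ltr0_norm// opprK.
Qed.

Lemma measurable_sphere n (c : R) : measurable [set v : 'rV[R]_n | eunorm v = c].
Proof.
have -> : [set v : 'rV[R]_n | eunorm v = c] = (@eunorm R n) @^-1` [set c] by [].
by rewrite -[X in measurable X]setTI; apply: measurable_eunorm => //; exact: measurable_set1.
Qed.

Lemma mu_sphere n (c : R) : mu R n.+1 [set v | eunorm v = c] = 0%E.
Proof.
apply: mu_null_slices; first exact: measurable_sphere.
move=> z; apply: (@lebesgue_pm (Num.sqrt (c ^+ 2 - eunorm z ^+ 2))).
  have -> : [set t | eunorm (vcons t z) = c] = (fun t => vcons t z) @^-1` [set v | eunorm v = c] by [].
  by rewrite -[X in measurable X]setTI; apply: measurable_vconsl => //; exact: measurable_sphere.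
move=> t /= <-; rewrite eunorm_vcons sqr_sqrtr ?addr_ge0 ?sqr_ge0//.
by rewrite addrK sqrtr_sqr.
Qed.

Lemma measurable_vtail n : measurable_fun setT (@vtail R n).
Proof.
apply/measurable_fun_rVP => i; under eq_fun do rewrite mxE.
exact: measurable_coord.
Qed.

Lemma mu_tail_sphere n (c : R) : mu R n.+2 [set v | eunorm (vtail v) = c] = 0%E.
Proof.
rewrite mu_slices.
  rewrite integral0_eq// => t _; rewrite -(mu_sphere n c); congr (mu _ _ _).
  by apply/seteqP; split => z /=; rewrite vtail_vcons.
have -> : [set v : 'rV[R]_n.+2 | eunorm (vtail v) = c] = (@vtail R n.+1) @^-1` [set z | eunorm z = c] by [].
by rewrite -[X in measurable X]setTI; apply: measurable_vtail => //; exact: measurable_sphere.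
Qed.

(** Continuity expressed by [eunorm] instead of the maximum norm; see [econtP] for the
    equivalence. *)
Definition econt n (F : 'rV[R]_n -> R) (v : 'rV[R]_n) :=
  forall e, 0 < e -> exists2 r, 0 < r & forall y, eunorm (y - v) <= r -> `|F y - F v| < e.

Variable n : nat.
Variables (G p : 'rV[R]_n.+2 -> R) (C Cp : R).
Hypothesis mG : measurable_fun setT (G : rVm R _ -> R).
Hypothesis mp : measurable_fun setT (p : rVm R _ -> R).
Hypothesis G0 : forall v, 0 <= G v <= C.
Hypothesis p0 : forall v, 0 <= p v <= Cp * eunorm v ^+ 2.
Hypothesis cG : forall v, v != 0 -> econt G v.
Hypothesis cp : forall v, econt p v.

(* With l = (l_0, l'), the substitution v = a (shear (a / l_0) (- l' / l_0) u) gives l.v = a^2 u_0, so for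
   p homogeneous of degree 2 the slab |l.v| < p(v) becomes |u_0| < p(shear u). *)
Definition shear (al : R) (b : 'rV[R]_n.+1) (u : 'rV[R]_n.+2) : 'rV[R]_n.+2 :=
  vcons (al * u ord0 ord0 + edot b (vtail u)) (vtail u).

Definition slab_fun (al : R) (b : 'rV[R]_n.+1) (u : 'rV[R]_n.+2) : R :=
  G (shear al b u) * (`|u ord0 ord0| < p (shear al b u))%R%:R * (eunorm (shear al b u) <= 1)%R%:R.

Lemma measurable_shear al b : measurable_fun setT (shear al b).
Proof.
apply: (@measurableT_comp _ _ _ _ _ _ (fun q : R * 'rV[R]_n.+1 => vcons q.1 q.2) _
  (fun u : rVm R n.+2 => (al * u ord0 ord0 + edot b (vtail u), vtail u))).
  exact: measurable_vcons.
apply/measurable_fun_pair; last exact: measurable_vtail.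
apply: measurable_funD.
  by apply: measurable_funM; [exact: measurable_cst | exact: measurable_coord].
by apply: measurable_edot; [exact: measurable_cst | exact: measurable_vtail].
Qed.

Lemma measurable_slab_fun al b : measurable_fun setT (slab_fun al b : rVm R _ -> R).
Proof.
have mT := measurable_shear al b.
apply: measurable_funM; first apply: measurable_funM.
- exact: (measurableT_comp mG mT).
- apply: measurable_fun_b2r; apply: measurable_fun_ltr; last exact: (measurableT_comp mp mT).
  by apply: measurableT_comp => //; exact: measurable_coord.
- apply: measurable_fun_b2r; apply: measurable_fun_ler; last exact: measurable_cst.
  exact: (measurableT_comp measurable_eunorm mT).
Qed.

(** On the support the tail has norm at most 1, and the first coordinate is below p <= Cp because
    the sheared point lies in the unit ball. The majorant is therefore independent of the shear. *)
Lemma slab_fun_bound al b u : `|slab_fun al b u| <= C * (eunorm u <= `|Cp| + 1)%R%:R.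
Proof.
have C0 : 0 <= C by have /andP[h /(le_trans h)] := G0 0.
rewrite /slab_fun; have [ht|] := boolP (_ < p _); last by rewrite mulr0 mul0r normr0 mulr_ge0.
have [hT|] := boolP (_ <= 1); last by rewrite !mulr0 normr0 mulr_ge0.
have /andP[g0 gC] := G0 (shear al b u).
rewrite !mulr1 ger0_norm//; apply: le_trans gC _.
have z1 : eunorm (vtail u) <= 1 by apply: le_trans hT; exact: ler_eunorm_vcons_tail.
have u0 : `|u ord0 ord0| <= `|Cp|.
  have /andP[_ pC] := p0 (shear al b u).
  apply: le_trans (ltW ht) _; apply: le_trans pC _; rewrite (le_trans (ler_norm _))// normrM.
  by rewrite ler_piMr// ger0_norm ?sqr_ge0// expr_le1// eunorm_ge0.
have -> : eunorm u <= `|Cp| + 1.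
  rewrite -(vcons_eta u); have -> : vcons (u ord0 ord0) (vtail u) = vcons (u ord0 ord0) 0 + vcons 0 (vtail u).
    by rewrite add_vcons addr0 add0r.
  apply: le_trans (ler_eunormD _ _) _; rewrite !eunorm_vcons eunorm0 expr0n/= addr0 add0r.
  by rewrite !sqrtr_sqr (ger0_norm (eunorm_ge0 _)) lerD.
by rewrite mulr1.
Qed.

Lemma shear_near (al : R^nat) (b : ('rV[R]_n.+1)^nat) u r : 0 < r ->
  al k @[k --> \oo] --> 0 -> eunorm (b k) @[k --> \oo] --> 0 ->
  \forall k \near \oo, eunorm (shear (al k) (b k) u - shear 0 0 u) <= r.
Proof.
move=> r0 hal hb.
have H : `|al k| * `|u ord0 ord0| + eunorm (b k) * eunorm (vtail u) @[k --> \oo] -->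
    `|0 : R| * `|u ord0 ord0| + 0 * eunorm (vtail u).
  by apply: cvgD; apply: cvgM => //; [exact: cvg_norm | exact: cvg_cst | exact: cvg_cst].
rewrite normr0 !mul0r addr0 in H.
move/cvgrPdist_le : H => /(_ r r0); apply: filterS => k.
rewrite sub0r normrN ger0_norm ?addr_ge0 ?mulr_ge0 ?eunorm_ge0// => h; apply: le_trans h.
rewrite /shear sub_vcons subrr eunorm_vcons eunorm0 expr0n/= addr0 sqrtr_sqr.
rewrite mul0r add0r edot0l subr0; apply: le_trans (ler_normD _ _) _.
by rewrite normrM lerD2l CauchySchwarz_eu.
Qed.

(** The excluded points are those where a factor may jump: the origin for [G], the unit sphere for
    the cut-off, and the faces of the limit slab. *)
Lemma slab_fun_cvg (al : R^nat) (b : ('rV[R]_n.+1)^nat) u :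
  al k @[k --> \oo] --> 0 -> eunorm (b k) @[k --> \oo] --> 0 ->
  eunorm (vtail u) != 0 -> eunorm (vtail u) != 1 ->
  `|u ord0 ord0| != p (vcons 0 (vtail u)) ->
  slab_fun (al k) (b k) u @[k --> \oo] --> slab_fun 0 0 u.
Proof.
move=> hal hb z0 z1 up.
have T0 : shear 0 0 u = vcons 0 (vtail u) by rewrite /shear mul0r edot0l addr0.
have nT0 : eunorm (shear 0 0 u) = eunorm (vtail u).
  by rewrite T0 eunorm_vcons expr0n/= add0r sqrtr_sqr ger0_norm// eunorm_ge0.
have v0 : shear 0 0 u != 0 by apply: contra_neq z0 => h; rewrite -nT0 h eunorm0.
have near1 := fun r r0 => @shear_near al b u r r0 hal hb.
apply/cvgrPdist_lt => e e0.
have [r1 r1_gt0 h1] := cG v0 e0.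
have [r2 r2_gt0 h2] : exists2 r, 0 < r & forall y, eunorm (y - shear 0 0 u) <= r ->
    `|p y - p (shear 0 0 u)| < `| `|u ord0 ord0| - p (shear 0 0 u)|.
  by apply: cp; rewrite normr_gt0 subr_eq0 T0.
have r3_gt0 : 0 < `|eunorm (vtail u) - 1| / 2 by rewrite divr_gt0// normr_gt0 subr_eq0.
near=> k.
have n1 : eunorm (shear (al k) (b k) u - shear 0 0 u) <= r1 by near: k; exact: near1.
have n2 : eunorm (shear (al k) (b k) u - shear 0 0 u) <= r2 by near: k; exact: near1.
have n3 : eunorm (shear (al k) (b k) u - shear 0 0 u) <= `|eunorm (vtail u) - 1| / 2 by near: k; exact: near1.
set T := shear (al k) (b k) u in n1 n2 n3.
have e1 : (`|u ord0 ord0| < p T) = (`|u ord0 ord0| < p (shear 0 0 u)).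
  have := h2 _ n2; have [a|a] := leP `|u ord0 ord0| (p (shear 0 0 u)).
    rewrite (ler0_norm (_ : `|u ord0 ord0| - _ <= 0)) ?subr_le0// ltr_norml => /andP[h _].
    by rewrite -T0 in up; apply/idP/idP => _; [rewrite lt_neqAle up a | lra].
  rewrite (gtr0_norm (_ : 0 < `|u ord0 ord0| - _)) ?subr_gt0// ltr_norml => /andP[_ h].
  by rewrite [RHS]ltNge (ltW a) ltNge; apply/negbF; lra.
have e2 : (eunorm T <= 1) = (eunorm (shear 0 0 u) <= 1).
  have := le_trans (ler_eunorm_dist _ _) n3; rewrite nT0.
  have [a|a] := leP (eunorm (vtail u)) 1.
    rewrite (ler0_norm (_ : eunorm (vtail u) - 1 <= 0)) ?subr_le0// ler_norml => /andP[_ h].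
    lra.
  rewrite (gtr0_norm (_ : 0 < eunorm (vtail u) - 1)) ?subr_gt0// ler_norml => /andP[h _].
  by apply/negbTE; rewrite -ltNge; lra.
rewrite /slab_fun -/T e1 e2 -!mulrBl !normrM !normr_nat distrC.
by case: (`|u ord0 ord0| < _); case: (eunorm _ <= 1); rewrite ?mulr1 ?mulr0 ?mul0r//; exact: h1.
Unshelve. all: by end_near.
Qed.

(** Dominated convergence. The excluded set is null: for a fixed tail the faces of the limit slab
    consist of at most two points, and the tail conditions describe null spheres. *)
Lemma slab_int_cvg (al : R^nat) (b : ('rV[R]_n.+1)^nat) :
  al k @[k --> \oo] --> 0 -> eunorm (b k) @[k --> \oo] --> 0 ->
  (\int[mu R n.+2]_u (slab_fun (al k) (b k) u)%:E)%E @[k --> \oo] -->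
  (\int[mu R n.+2]_u (slab_fun 0 0 u)%:E)%E.
Proof.
move=> hal hb.
pose N3 := [set u : 'rV[R]_n.+2 | `|u ord0 ord0| = p (vcons 0 (vtail u))].
have mN3 : measurable N3.
  have m0 : measurable_fun setT (fun u : rVm R n.+2 => p (vcons 0 (vtail u))).
    have := measurableT_comp mp (measurable_shear 0 0).
    by apply: eq_measurable_fun => u _; rewrite /= /shear mul0r edot0l addr0.
  have -> : N3 = (fun u : rVm R n.+2 => `|u ord0 ord0| - p (vcons 0 (vtail u))) @^-1` [set 0].
    by apply/seteqP; split => u /= => [->|/eqP]; rewrite ?subrr// subr_eq0 => /eqP.
  have mF : measurable_fun setT (fun u : rVm R n.+2 => `|u ord0 ord0| - p (vcons 0 (vtail u))).
    by apply: measurable_funB => //; apply: measurableT_comp => //; exact: measurable_coord.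
  by rewrite -[X in measurable X]setTI; apply: mF => //; exact: measurable_set1.
have N30 : mu R n.+2 N3 = 0%E.
  apply: mu_null_slices => // z; apply: (@lebesgue_pm (p (vcons 0 z))).
    have -> : [set t | N3 (vcons t z)] = (fun t => vcons t z) @^-1` N3 by [].
    by rewrite -[X in measurable X]setTI; exact: measurable_vconsl.
  by move=> t; rewrite /N3 /= vcons0 vtail_vcons.
have mV c : measurable [set v : 'rV[R]_n.+2 | eunorm (vtail v) = c].
  have -> : [set v : 'rV[R]_n.+2 | eunorm (vtail v) = c] = (@vtail R n.+1) @^-1` [set z | eunorm z = c] by [].
  by rewrite -[X in measurable X]setTI; apply: measurable_vtail => //; exact: measurable_sphere.
have neg : (mu R n.+2).-negligible (N3 `|` [set v | eunorm (vtail v) = 0] `|` [set v | eunorm (vtail v) = 1]).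
  have ng A : measurable A -> mu R n.+2 A = 0%E -> (mu R n.+2).-negligible A.
    by move=> mA A0; exists A; split.
  by apply: negligibleU; [apply: negligibleU|]; apply: ng; [exact: mN3 | exact: N30 |
    exact: mV | exact: mu_tail_sphere | exact: mV | exact: mu_tail_sphere].
have C0 : 0 <= C by have /andP[h /(le_trans h)] := G0 0.
have iB : (mu R n.+2).-integrable setT (EFin \o (fun u : rVm R n.+2 => C * (eunorm u <= `|Cp| + 1)%R%:R)).
  apply: (@integrable_ball_dom _ _ _ C (`|Cp| + 1)); first by rewrite addr_ge0.
    apply: measurable_funM; first exact: measurable_cst.
    by apply: measurable_fun_b2r; apply: measurable_fun_ler; [exact: measurable_eunorm | exact: measurable_cst].
  by move=> v; rewrite ger0_norm// mulr_ge0.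
have mk k : measurable_fun setT (fun u : rVm R n.+2 => (slab_fun (al k) (b k) u)%:E).
  by apply/measurable_EFinP; exact: measurable_slab_fun.
have m0 : measurable_fun setT (fun u : rVm R n.+2 => (slab_fun 0 0 u)%:E).
  by apply/measurable_EFinP; exact: measurable_slab_fun.
have cv : {ae mu R n.+2, forall u, setT u -> (slab_fun (al k) (b k) u)%:E @[k --> \oo] --> (slab_fun 0 0 u)%:E}.
  apply: negligibleS neg => u /= h; apply: contrapT => /not_orP[/not_orP[h3 h1] h2]; apply: h => _.
  by apply: cvg_EFin; [near=> k | apply: slab_fun_cvg => //; exact/eqP].
have dom : {ae mu R n.+2, forall u k, setT u ->
    (`|(slab_fun (al k) (b k) u)%:E| <= (EFin \o (fun u : rVm R n.+2 => (C * (eunorm u <= `|Cp| + 1)%R%:R)%R)) u)%E}.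
  by apply: aeW => u k _; rewrite lee_fin; exact: slab_fun_bound.
by have [_ _] := dominated_convergence measurableT mk m0 cv iB dom.
Unshelve. all: by end_near.
Qed.

End slab.

(** * Slab volumes in small balls, uniformly in the direction *)

Section slab_scaling.
Context {R : realType}.
Local Notation leb := (@lebesgue_measure R).
Variable n : nat.
Variables (G p : 'rV[R]_n.+2 -> R) (C Cp : R).
Hypothesis mG : measurable_fun setT (G : rVm R _ -> R).
Hypothesis mp : measurable_fun setT (p : rVm R _ -> R).
Hypothesis G0 : forall v, 0 <= G v <= C.
Hypothesis p0 : forall v, 0 <= p v <= Cp * eunorm v ^+ 2.
Hypothesis cG : forall v, v != 0 -> econt G v.
Hypothesis cp : forall v, econt p v.
Hypothesis hG : forall a v, 0 < a -> G (a *: v) = G v.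
Hypothesis hp : forall a v, 0 < a -> p (a *: v) = a ^+ 2 * p v.
Variable M : 'M[R]_n.+2.
Hypothesis oM : M *m M^T = 1%:M.

Definition slab_ball (l : 'rV[R]_n.+2) (a : R) (v : 'rV[R]_n.+2) : R :=
  G v * (`|edot l v| < p v)%R%:R * (eunorm v <= a)%R%:R.

Lemma slab_ball_ge0 l a v : 0 <= slab_ball l a v.
Proof. by have /andP[? _] := G0 v; rewrite !mulr_ge0. Qed.

Lemma measurable_slab_ball l a : measurable_fun setT (slab_ball l a : rVm R _ -> R).
Proof.
apply: measurable_funM; first apply: measurable_funM => //.
- apply: measurable_fun_b2r; apply: measurable_fun_ltr => //.
  apply: measurableT_comp => //.
  by apply: measurable_edot; [exact: measurable_cst | exact: measurable_id].
- apply: measurable_fun_b2r; apply: measurable_fun_ler; last exact: measurable_cst.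
  exact: measurable_eunorm.
Qed.

Let G' v := G (v *m M).
Let p' v := p (v *m M).

Lemma mM : measurable_fun setT (fun v : rVm R n.+2 => v *m M).
Proof. exact: measurable_mulmx. Qed.

(** The dilation by [a] contributes a^(n+2), and the change of the first variable contributes a/l0.
    Homogeneity makes both sides of the slab condition acquire the same factor a^2. *)
Lemma slab_ball_scale (l : 'rV[R]_n.+2) (a : R) : 0 < a -> 0 < (l *m M^T) ord0 ord0 ->
  let l0 := (l *m M^T) ord0 ord0 in
  (\int[mu R n.+2]_v (slab_ball l a v)%:E =
   (a ^+ n.+3 / l0)%:E *
   \int[mu R n.+2]_v (slab_fun G' p' (a / l0) (- l0^-1 *: vtail (l *m M^T)) v)%:E)%E.
Proof.
move=> a_gt0 l0_gt0 l0.
have mG' : measurable_fun setT (G' : rVm R _ -> R) by exact: (measurableT_comp mG mM).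
have mp' : measurable_fun setT (p' : rVm R _ -> R) by exact: (measurableT_comp mp mM).
have mS := measurable_slab_ball l a.
have mE : measurable_fun setT (fun v : rVm R n.+2 => (slab_ball l a v)%:E) by exact/measurable_EFinP.
have S0 v : (0 <= (slab_ball l a v)%:E)%E by rewrite lee_fin slab_ball_ge0.
set b := - l0^-1 *: _; set al := a / l0.
have al0 : 0 < al by rewrite divr_gt0.
have := @mu_scale R n.+2 a (fun v => (slab_ball l a v)%:E) (lt0r_neq0 a_gt0) mE S0.
rewrite gtr0_norm// => sc.
have -> : (\int[mu R n.+2]_v (slab_ball l a v)%:E = (a ^+ n.+2)%:E * \int[mu R n.+2]_v (slab_ball l a (a *: v))%:E)%E.
  by rewrite sc muleA -EFinM mulfV ?mul1e// expf_neq0// gt_eqF.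
have mE' : measurable_fun setT (fun v : rVm R n.+2 => (slab_ball l a (a *: v))%:E).
  apply: (measurableT_comp mE); apply: measurable_rVZ; [exact: measurable_cst | exact: measurable_id].
rewrite -(@mu_orth _ _ M (fun v => (slab_ball l a (a *: v))%:E) oM mE' (fun v => S0 _)).
pose H v := (slab_ball l a (a *: (v *m M)))%:E.
have mH : measurable_fun setT (H : rVm R _ -> \bar R) by exact: (measurableT_comp mE' mM).
have HE tau z : H (vcons (al * tau + edot b z) z) = (slab_fun G' p' al b (vcons tau z))%:E.
  congr (_%:E); rewrite /slab_ball /slab_fun /shear vcons0 vtail_vcons.
  set v := vcons _ _.
  have ev : eunorm (v *m M) = eunorm v by exact: eunorm_orth.
  rewrite hG// hp// eunormZ ev (gtr0_norm a_gt0).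
  rewrite -[X in (_ <= X)%R]mulr1 (ler_pM2l a_gt0); congr (_ * (nat_of_bool _)%:R * _).
  rewrite edotZr normrM (gtr0_norm a_gt0) expr2 -mulrA ltr_pM2l//.
  have -> : edot l (v *m M) = a * tau.
    rewrite edot_mxE trmx_mul mulmxA -edot_mxE -(vcons_eta (l *m M^T)) edot_vcons -/l0.
    by rewrite /al /b edotZl; field; exact: lt0r_neq0.
  by rewrite normrM gtr0_norm// ltr_pM2l.
have inner z : (\int[leb]_t H (vcons t z) = al%:E * \int[leb]_tau (slab_fun G' p' al b (vcons tau z))%:E)%E.
  have mHz : measurable_fun setT (fun t => H (vcons t z)) by exact: (measurableT_comp mH (measurable_vconsl z)).
  have := @ge0_integral_affine R al (edot b z) (fun t => H (vcons t z)) (lt0r_neq0 al0) mHz (fun t => S0 _).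
  under eq_integral do rewrite HE.
  move=> ->; rewrite gtr0_norm// muleA -EFinM mulfV ?mul1e// gt_eqF//.
have msf : measurable_fun setT (fun v : rVm R n.+2 => (slab_fun G' p' al b v)%:E).
  by apply/measurable_EFinP; exact: measurable_slab_fun.
have sf0 v : (0 <= (slab_fun G' p' al b v)%:E)%E.
  by rewrite lee_fin /slab_fun !mulr_ge0//; have /andP[] := G0 (shear al b v *m M).
rewrite [X in (_ * X)%E](_ : _ = al%:E * \int[mu R n.+2]_v (slab_fun G' p' al b v)%:E)%E; last first.
  rewrite [LHS](integral_mu_succ2 mH (fun v => S0 _)) (integral_mu_succ2 msf sf0).
  under eq_integral do rewrite inner.
  rewrite ge0_integralZl//; last 3 first.
  - exact: (@measurable_slicel _ _ _ msf sf0).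
  - by move=> z _; apply: integral_ge0 => t _; exact: sf0.
  - by rewrite lee_fin ltW.
by rewrite muleA -EFinM /al (exprSr a n.+2) mulrA.
Qed.

(** The constant J of the overview, with the tangent hyperplane parametrised by z -> (0, z) M. *)
Definition slab_lim : R :=
  Rintegral (mu R n.+1) setT (fun z => 2 * p (vcons 0 z *m M) * G (vcons 0 z *m M) * (eunorm z <= 1)%R%:R).

(** Without shear the point no longer depends on the first coordinate, which therefore ranges over
    an interval of length 2 p. *)
Lemma slab_fun00 : (\int[mu R n.+2]_u (slab_fun G' p' 0 0 u)%:E = (slab_lim)%:E)%E.
Proof.
have mG' : measurable_fun setT (G' : rVm R _ -> R) by exact: (measurableT_comp mG mM).
have mp' : measurable_fun setT (p' : rVm R _ -> R) by exact: (measurableT_comp mp mM).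
have msf : measurable_fun setT (fun v : rVm R n.+2 => (slab_fun G' p' 0 0 v)%:E).
  by apply/measurable_EFinP; exact: measurable_slab_fun.
have sf0 v : (0 <= (slab_fun G' p' 0 0 v)%:E)%E.
  by rewrite lee_fin /slab_fun !mulr_ge0//; have /andP[] := G0 (shear 0 0 v *m M).
have mv0 : measurable_fun setT (fun z : rVm R n.+1 => vcons (0 : R) z *m M).
  apply: (measurableT_comp mM).
  by apply: (@measurableT_comp _ _ _ _ _ _ (fun q : R * 'rV[R]_n.+1 => vcons q.1 q.2) _
  (fun u : rVm R n.+1 => (0, u))); [exact: measurable_vcons | apply/measurable_fun_pair].
rewrite (integral_mu_succ2 msf sf0) /slab_lim /Rintegral fineK; last first.
  apply: integrable_fin_num => //; apply: (@integrable_ball_dom _ _ _ (2 * `|Cp| * `|C|) 1) => //.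
    apply: measurable_funM; last first.
      apply: measurable_fun_b2r; apply: measurable_fun_ler; [exact: measurable_eunorm | exact: measurable_cst].
    apply: measurable_funM; last exact: (measurableT_comp mG mv0).
    by apply: measurable_funM; [exact: measurable_cst | exact: (measurableT_comp mp mv0)].
  move=> z; set v := vcons _ _ *m _; have /andP[g0 gC] := G0 v; have /andP[h0 hC] := p0 v.
  have nv : eunorm v = eunorm z.
    by rewrite /v eunorm_orth// eunorm_vcons expr0n/= add0r sqrtr_sqr ger0_norm ?eunorm_ge0.
  case: (leP (eunorm z) 1) => z1; last by rewrite !mulr0 normr0.
  rewrite !mulr1 ger0_norm ?mulr_ge0// -!mulrA ler_pM2l//; apply: ler_pM => //.
    apply: le_trans hC _; rewrite (le_trans (ler_norm _))// normrM ler_piMr//.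
    by rewrite ger0_norm ?sqr_ge0// expr_le1// ?eunorm_ge0// nv.
  exact: le_trans gC (ler_norm _).
apply: eq_integral => z _ /=.
have sE tau : slab_fun G' p' 0 0 (vcons tau z) =
    G' (vcons 0 z) * (eunorm z <= 1)%R%:R * (`|tau| < p' (vcons 0 z))%R%:R.
  rewrite /slab_fun /shear vcons0 vtail_vcons mul0r edot0l addr0 eunorm_vcons expr0n/= add0r.
  by rewrite sqrtr_sqr (ger0_norm (eunorm_ge0 _)) mulrAC.
under eq_integral do rewrite sE EFinM.
have k0 : 0 <= G' (vcons 0 z) * (eunorm z <= 1)%R%:R.
  by rewrite mulr_ge0//; have /andP[] := G0 (vcons 0 z *m M).
rewrite ge0_integralZl//; last first.
  apply/measurable_EFinP; apply: measurable_fun_b2r; apply: measurable_fun_ltr; last exact: measurable_cst.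
  exact: normr_measurable.
have c0 : 0 <= p' (vcons 0 z) by have /andP[] := p0 (vcons 0 z *m M).
rewrite -/(p' (vcons 0 z)) -/(G' (vcons 0 z)); set c := p' _ in c0 *.
have -> : (\int[leb]_tau ((`|tau| < c)%R%:R : R)%:E = (2 * c)%:E)%E.
  have -> : (\int[leb]_tau ((`|tau| < c)%R%:R : R)%:E = \int[leb]_tau (\1_(`]- c, c[%classic) tau)%:E)%E.
    by apply: eq_integral => t _; rewrite indicE mem_setE in_itv/= ltr_norml.
  rewrite integral_indic// setIT.
  have := @lebesgue_measure_itv R `]- c, c[; rewrite /= lte_fin => ->.
  case: ltP => [_|h]; first by rewrite -EFinB; congr (_%:E); ring.
  by congr (_%:E); lra.
by rewrite -EFinM; congr (_%:E); ring.
Qed.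

Lemma slab_ball_limit (nu : 'rV[R]_n.+2) (eta : R) : e0 n.+1 *m M = nu -> 0 < eta ->
  exists2 de, 0 < de & forall l a, 0 < a <= de -> eunorm (l - nu) <= de ->
    (((slab_lim - eta) * a ^+ n.+3)%:E <= \int[mu R n.+2]_v (slab_ball l a v)%:E <=
     ((slab_lim + eta) * a ^+ n.+3)%:E)%E.
Proof.
(* dominated convergence along a sequence of counterexamples *)
move=> eM eta0; apply: contrapT => /forall2NP H.
pose dk k : R := k.+1%:R^-1.
have dk0 k : 0 < dk k by rewrite invr_gt0 ltr0n.
have /choice[f hf] : forall k, exists q : 'rV[R]_n.+2 * R, [/\ 0 < q.2 <= dk k, eunorm (q.1 - nu) <= dk k &
    ~ (((slab_lim - eta) * q.2 ^+ n.+3)%:E <= \int[mu R n.+2]_v (slab_ball q.1 q.2 v)%:E <=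
     ((slab_lim + eta) * q.2 ^+ n.+3)%:E)%E].
  move=> k; have [//|h] := H (dk k); apply: contrapT => h'; apply: h => l a ha hl.
  by apply: contrapT => h2; apply: h'; exists (l, a).
pose lk k := (f k).1 *m M^T; pose ak k : R := (f k).2; pose l0 k : R := lk k ord0 ord0.
have dk_cvg : dk k @[k --> \oo] --> 0 by exact: cvg_harmonic.
have lke k : eunorm (lk k - e0 n.+1) <= dk k.
  have [_ h _] := hf k; rewrite -(eunorm_orth (lk k - _) oM).
  by rewrite mulmxBl eM /lk -mulmxA (mulmx1C oM) mulmx1.
have l01 k : `|l0 k - 1| <= dk k.
  have := le_trans (ler_coord_eunorm _ ord0) (lke k).
  by rewrite -{1}(vcons_eta (lk k)) sub_vcons vcons0.
have tk k : eunorm (vtail (lk k)) <= dk k.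
  apply: le_trans (lke k); rewrite -{2}(vcons_eta (lk k)) sub_vcons subr0.
  exact: ler_eunorm_vcons_tail.
have l0c : l0 k @[k --> \oo] --> (1 : R).
  apply/cvgrPdist_le => e e0; move/cvgrPdist_le : dk_cvg => /(_ e e0); apply: filterS => k.
  rewrite sub0r normrN gtr0_norm// => /(le_trans (l01 k)); by rewrite distrC.
have akc : ak k @[k --> \oo] --> 0.
  apply/cvgrPdist_le => e e0; move/cvgrPdist_le : dk_cvg => /(_ e e0); apply: filterS => k.
  rewrite !sub0r !normrN gtr0_norm// => h; apply: le_trans h.
  by have [/andP[a0 ad] _ _] := hf k; rewrite gtr0_norm.
have tkc : eunorm (vtail (lk k)) @[k --> \oo] --> 0.
  apply/cvgrPdist_le => e e0; move/cvgrPdist_le : dk_cvg => /(_ e e0); apply: filterS => k.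
  by rewrite !sub0r !normrN gtr0_norm// ger0_norm ?eunorm_ge0//; exact: le_trans.
have lV : (l0 k)^-1 @[k --> \oo] --> (1 : R).
  by rewrite -[X in _ --> X]invr1; apply: cvgV => //; exact: oner_neq0.
have alc : ak k / l0 k @[k --> \oo] --> 0.
  by rewrite -[X in _ --> X](mul0r 1); exact: cvgM.
have bc : eunorm (- (l0 k)^-1 *: vtail (lk k)) @[k --> \oo] --> 0.
  have H1 : `|(l0 k)^-1| * eunorm (vtail (lk k)) @[k --> \oo] --> `|1 : R| * 0.
    by apply: cvgM => //; exact: cvg_norm.
  rewrite mulr0 in H1; apply: cvg_trans H1; apply: near_eq_cvg; apply: nearW => k.
  by rewrite eunormZ normrN.
have mG' : measurable_fun setT (G' : rVm R _ -> R) by exact: (measurableT_comp mG mM).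
have mp' : measurable_fun setT (p' : rVm R _ -> R) by exact: (measurableT_comp mp mM).
have G0' v : 0 <= G' v <= C by exact: G0.
have p0' v : 0 <= p' v <= Cp * eunorm v ^+ 2 by rewrite -(eunorm_orth v oM); exact: p0.
have cG' v : v != 0 -> econt G' v.
  move=> v0 e e0; have [|r r0 hr] := @cG (v *m M) _ e e0.
    by apply: contra_neq v0 => h; apply/eqP; rewrite -(mulmx1 v) -oM mulmxA h mul0mx.
  by exists r => // y; rewrite -(eunorm_orth _ oM) mulmxBl => /hr.
have cp' v : econt p' v.
  move=> e e0; have [r r0 hr] := @cp (v *m M) e e0.
  by exists r => // y; rewrite -(eunorm_orth _ oM) mulmxBl => /hr.
have := slab_int_cvg mG' mp' G0' p0' cG' cp' alc bc.
rewrite slab_fun00 => /fine_cvgP[fin cv].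
pose q k := fine (\int[mu R n.+2]_u (slab_fun G' p' (ak k / l0 k) (- (l0 k)^-1 *: vtail (lk k)) u)%:E)%E.
have qc : q k * (l0 k)^-1 @[k --> \oo] --> slab_lim.
  by rewrite -[X in _ --> X]mulr1; apply: cvgM.
suff : \forall k \near \oo, False by move=> [N _ /(_ N)]; apply; exact: leqnn.
near=> k.
have fink : (\int[mu R n.+2]_u (slab_fun G' p' (ak k / l0 k) (- (l0 k)^-1 *: vtail (lk k)) u)%:E)%E \is a fin_num.
  by near: k.
have lk0 : 0 < l0 k.
  have : `|1 - l0 k| <= 1 / 2 by near: k; move/cvgrPdist_le : l0c; apply.
  by rewrite ler_norml => /andP[]; lra.
have qk : `|slab_lim - q k * (l0 k)^-1| <= eta by near: k; move/cvgrPdist_le : qc; apply.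
have [/andP[a_gt0 _] _] := hf k; apply.
rewrite slab_ball_scale// -(fineK fink) -/(q k) -EFinM !lee_fin -/(ak k) -/(l0 k).
have -> : ak k ^+ n.+3 / l0 k * q k = q k * (l0 k)^-1 * ak k ^+ n.+3 by ring.
move: qk; rewrite ler_norml => /andP[h1 h2].
by rewrite !ler_pM2r ?exprn_gt0//; apply/andP; split; lra.
Unshelve. all: by end_near.
Qed.

End slab_scaling.

(** * Asymptotics of the truncated kernel *)

Section radial_kernel.
Context {R : realType}.
Local Notation leb := (@lebesgue_measure R).

(* minus the derivative of the power function of exponent [- e] *)
Definition dpow (e a : R) : R := e * a `^ (- e - 1).

Lemma measurable_dpow e : measurable_fun setT (dpow e).
Proof. by apply: measurable_funM => //; exact: measurable_powR. Qed.

Lemma dpow_ge0 e a : 0 <= e -> 0 <= dpow e a.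
Proof. by move=> e0; rewrite mulr_ge0// powR_ge0. Qed.

Lemma is_derive_dpow e (t : R) : 0 < t ->
  is_derive t (1 : R) (fun t : R => - t `^ (- e)) (dpow e t).
Proof.
move=> t0; have H := is_derive1_powR (- e) t0.
by apply: is_derive_eq; rewrite /dpow mulNr opprK.
Qed.

Lemma continuous_powRl (p t : R) : 0 < t -> {for t, continuous (fun t : R => t `^ p)}.
Proof. by move=> t0; exact: is_derive_continuous (is_derive1_powR p t0). Qed.

Lemma continuous_dpow e t : 0 < t -> {for t, continuous (dpow e)}.
Proof. by move=> t0; apply: cvgM; [exact: cvg_cst | exact: continuous_powRl]. Qed.

Lemma integral_dpow_segment e x y : 0 < x -> x <= y ->
  (\int[leb]_(t in `[x, y]) (dpow e t)%:E = (x `^ (- e) - y `^ (- e))%:E)%E.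
Proof.
move=> x0 xy.
rewrite (@FTC_segment _ _ _ x y xy (fun t h => @is_derive_dpow e t (lt_le_trans x0 (proj1 (andP h))))).
  by congr (_%:E); lra.
by move=> t /andP[xt _]; apply: continuous_dpow; exact: lt_le_trans xt.
Qed.

Lemma powR_cvgy (e : R) : 1 <= e -> - t `^ (- e) @[t --> +oo] --> (0 : R).
Proof.
move=> e1; apply/cvgrPdist_le => eps eps0; near=> t.
have t1 : 1 <= t by near: t; apply: nbhs_pinfty_ge; exact: num_real.
have te : eps^-1 <= t by near: t; apply: nbhs_pinfty_ge; exact: num_real.
have t0 : 0 < t by apply: lt_le_trans t1.
rewrite sub0r opprK ger0_norm ?powR_ge0//.
apply: le_trans (_ : t `^ (- 1) <= _); first by apply: ler_powR => //; rewrite lerN2.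
by rewrite (powR_inv1 (ltW t0)) invf_ple.
Unshelve. all: by end_near.
Qed.

Lemma integral_dpow_halfline e x : 0 < x -> 1 <= e ->
  (\int[leb]_(t in `[x, +oo[) (dpow e t)%:E = (x `^ (- e))%:E)%E.
Proof.
move=> x0 e1.
rewrite (@FTC_halfline _ _ _ x 0 (fun t h => @is_derive_dpow e t (lt_le_trans x0 h))).
- by rewrite sub0r opprK.
- by move=> t xt; apply: continuous_dpow; exact: lt_le_trans xt.
- by move=> t _; apply: dpow_ge0; exact: le_trans e1.
- exact: powR_cvgy.
Qed.

Variable n : nat.
Variable s : R.
Hypothesis s1 : 1 <= s.
Let N : R := n.+2%:R + s.

(** Mass that the kernel gives, between radii r and de, to a set whose volume in the ball of radius
    a is a^(d+1). It is the integral of N t^(-s), hence a logarithm when s = 1. *)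
Definition kernel_mass (r de : R) : R :=
  if s == 1 then N * (ln de - ln r) else N / (s - 1) * (r `^ (1 - s) - de `^ (1 - s)).

Lemma dpow_scale (a : R) : 0 < a -> dpow N a * a ^+ n.+3 = N * a `^ (- s).
Proof.
move=> a0; rewrite /dpow -mulrA -powR_mulrn ?ltW// -powRD; last by rewrite (gt_eqF a0) implybT.
congr (_ * _ `^ _); rewrite /N -[n.+3%:R]natr1; ring.
Qed.

Lemma integral_kernel_mass r de : 0 < r -> r <= de ->
  (\int[leb]_(t in `[r, de]) (N * t `^ (- s))%:E = (kernel_mass r de)%:E)%E.
Proof.
move=> r0 rd; have pos t : r <= t <= de -> 0 < t by move=> /andP[h _]; exact: lt_le_trans h.
have cf t : r <= t <= de -> {for t, continuous (fun t => N * t `^ (- s))}.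
  by move=> /pos t0; apply: cvgM; [exact: cvg_cst | exact: continuous_powRl].
rewrite /kernel_mass; case: eqP => [s_1|/eqP s_1].
  have dF t : r <= t <= de -> is_derive t (1 : R) (fun t => N * ln t) (N * t `^ (- s)).
    move=> /pos t0; have H := is_derive1_ln t0; apply: is_derive_eq.
    by rewrite s_1 powR_inv1 ?ltW.
  by rewrite (@FTC_segment _ _ _ r de rd dF cf); congr (_%:E); ring.
have s10 : s - 1 != 0 by rewrite subr_eq0.
have dF t : r <= t <= de ->
    is_derive t (1 : R) (fun t => - (N / (s - 1)) * t `^ (1 - s)) (N * t `^ (- s)).
  move=> /pos t0; have H := is_derive1_powR (1 - s) t0; apply: is_derive_eq.
  rewrite /GRing.scale/= (_ : 1 - s - 1 = - s); last by ring.
  by field.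
by rewrite (@FTC_segment _ _ _ r de rd dF cf); congr (_%:E); ring.
Qed.

Lemma kernel_mass_ge0 r de : 0 < r -> r <= de -> 0 <= kernel_mass r de.
Proof.
move=> r0 rd; rewrite -lee_fin -integral_kernel_mass//; apply: integral_ge0 => t _.
by rewrite lee_fin mulr_ge0 ?powR_ge0// addr_ge0// (le_trans _ s1).
Qed.

(** The origin of [sigmas]: for s > 1 the coefficient N/(s-1) is d+1 times (d+s)/((d+1)(s-1)), and
    for s = 1 it is N = d+1 times the logarithm. The contribution of [de] goes into [B], which does
    not depend on r. *)
Lemma kernel_mass_sigma de : 0 < de ->
  exists B, forall r, 0 < r < 1 -> kernel_mass r de = (n.+3%:R) * sigmas (d := n.+2) s r + B.
Proof.
move=> de0; rewrite /kernel_mass /sigmas; case: eqP => [s_1|/eqP s_1].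
  exists (N * ln de) => r /andP[r0 r1]; rewrite ler0_norm; last by rewrite -ln1 ler_ln ?posrE// ltW.
  by rewrite /N s_1 natr1; ring.
exists (- (N / (s - 1) * de `^ (1 - s))) => r _.
have s10 : s - 1 != 0 by rewrite subr_eq0.
rewrite -[n.+3%:R]natr1 -/N.
have n0 : n.+2%:R + 1 != 0 :> R by rewrite natr1 pnatr_eq0.
by set D := n.+2%:R + 1 in n0 *; field; rewrite s10 n0.
Qed.

Lemma krE r t : kr (d := n.+2) s r t = (Num.max r t) `^ (- N).
Proof. by rewrite /kr; case: leP. Qed.

Lemma N1 : 1 <= N.
Proof. by rewrite /N (le_trans s1)// lerDr. Qed.

(** Integrate minus the derivative of a^(-N) from max(r, t) to de. Below r the kernel is flat, which
    is why only radii a >= r occur. *)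
Lemma kr_layer r de t : 0 < r -> r <= de -> t <= de ->
  ((kr (d := n.+2) s r t)%:E = (de `^ (- N))%:E +
   \int[leb]_a (dpow N a * (r <= a <= de)%R%:R * (t <= a)%R%:R)%:E)%E.
Proof.
move=> r0 rd td; rewrite krE.
have x0 : 0 < Num.max r t by rewrite lt_max r0.
have -> : (\int[leb]_a (dpow N a * (r <= a <= de)%R%:R * (t <= a)%R%:R)%:E =
    \int[leb]_(a in `[Num.max r t, de]) (dpow N a)%:E)%E.
  rewrite [RHS]integral_mkcond; apply: eq_integral => a _.
  rewrite patchE mem_setE in_itv/= ge_max.
  by case: (r <= a); case: (t <= a); case: (a <= de); rewrite /= ?mulr1 ?mulr0 ?mul0r.
rewrite integral_dpow_segment//; last by rewrite ge_max rd.
by rewrite -EFinD; congr (_%:E); ring.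
Qed.

Lemma kr_tail r de t : 0 < r -> r <= de -> de < t ->
  ((kr (d := n.+2) s r t)%:E = \int[leb]_a (dpow N a * (de <= a)%R%:R * (t <= a)%R%:R)%:E)%E.
Proof.
move=> r0 rd td; rewrite krE max_r; last by rewrite ltW// (le_lt_trans rd).
have t0 : 0 < t by apply: lt_trans td; exact: lt_le_trans rd.
rewrite -integral_dpow_halfline// ?N1// integral_mkcond; apply: eq_integral => a _.
rewrite patchE mem_setE in_itv/= andbT; case: (leP t a) => ta; last by rewrite mulr0.
by rewrite (le_trans (ltW td) ta) !mulr1.
Qed.

Lemma measurable_kr_norm r : measurable_fun setT (fun v : rVm R n.+2 => kr (d := n.+2) s r (eunorm v)).
Proof.
under eq_fun do rewrite krE.
apply: (@measurableT_comp _ _ _ _ _ _ (fun x : R => x `^ (- N))); first exact: measurable_powR.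
by apply: measurable_maxr; [exact: measurable_cst | exact: measurable_eunorm].
Qed.

Lemma kr_ge0 r t : 0 <= kr (d := n.+2) s r t.
Proof. by rewrite krE powR_ge0. Qed.

Section ball_masses.
Variable H : 'rV[R]_n.+2 -> R.
Hypothesis mH : measurable_fun setT (H : rVm R _ -> R).
Hypothesis H0 : forall v, 0 <= H v.

Lemma measurable_itv_ind (r de : R) : measurable_fun setT (fun a : R => ((r <= a <= de)%R%:R : R)).
Proof.
have -> : (fun a : R => ((r <= a <= de)%R%:R : R)) = \1_(`[r, de]%classic).
  by apply/funext => a; rewrite indicE mem_setE in_itv.
by apply: measurable_indic; exact: measurable_itv.
Qed.

Lemma measurable_cball_ind (a : R) : measurable_fun setT (fun v : rVm R n.+2 => ((eunorm v <= a)%R%:R : R)).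
Proof. by apply: measurable_fun_b2r; apply: measurable_fun_ler; [exact: measurable_eunorm | exact: measurable_cst]. Qed.

Lemma near_mass r de : 0 < r -> r <= de ->
  (\int[mu R n.+2]_v (H v * (eunorm v <= de)%R%:R * kr (d := n.+2) s r (eunorm v))%:E =
   (de `^ (- N))%:E * \int[mu R n.+2]_v (H v * (eunorm v <= de)%R%:R)%:E +
   \int[leb]_(a in `[r, de]) ((dpow N a)%:E * \int[mu R n.+2]_v (H v * (eunorm v <= a)%R%:R)%:E))%E.
Proof.
move=> r0 rd; pose Hd v := H v * (eunorm v <= de)%R%:R.
pose ka a := dpow N a * (r <= a <= de)%R%:R.
have N0 : 0 <= N by rewrite (le_trans _ N1).
have mHd : measurable_fun setT (Hd : rVm R _ -> R).
  by apply: measurable_funM => //; exact: measurable_cball_ind.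
have Hd0 v : 0 <= Hd v by rewrite mulr_ge0.
have mka : measurable_fun setT ka.
  by apply: measurable_funM; [exact: measurable_dpow | exact: measurable_itv_ind].
have ka0 a : 0 <= ka a by rewrite mulr_ge0// dpow_ge0.
have IB := integral_balls mHd Hd0 mka ka0.
transitivity (\int[mu R n.+2]_v ((de `^ (- N))%:E * (Hd v)%:E +
    (Hd v)%:E * \int[leb]_a (ka a * (eunorm v <= a)%R%:R)%:E))%E.
  apply: eq_integral => v _; rewrite -/(Hd v) /Hd.
  have [vd|vd] := leP (eunorm v) de; last by rewrite mulr0 mul0r mule0 mul0e adde0.
  rewrite mulr1 EFinM (kr_layer r0 rd vd) ge0_muleDr.
  - by rewrite [X in (X + _)%E]muleC.
  - by rewrite lee_fin powR_ge0.
  - by apply: integral_ge0 => a _; rewrite lee_fin mulr_ge0//; exact: ka0.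
have mL : measurable_fun setT (fun v : rVm R n.+2 => (Hd v)%:E * \int[leb]_a (ka a * (eunorm v <= a)%R%:R)%:E)%E.
  apply: emeasurable_funM; first exact/measurable_EFinP.
  apply: (@measurable_fun_fubini_tonelli_F _ _ (rVm R n.+2) (measurableTypeR R) R leb
    (fun p => (ka p.2 * (eunorm p.1 <= p.2)%R%:R)%:E)) => [|p]; last by rewrite lee_fin mulr_ge0.
  apply/measurable_EFinP; apply: measurable_funM; first exact: (measurableT_comp mka measurable_snd).
  apply: measurable_fun_b2r; apply: measurable_fun_ler; last exact: measurable_snd.
  exact: (measurableT_comp measurable_eunorm measurable_fst).
rewrite ge0_integralD//; last 3 first.
- by move=> v _; rewrite mule_ge0// lee_fin ?powR_ge0.
- by apply: emeasurable_funM; [exact: measurable_cst | exact/measurable_EFinP].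
- by move=> v _; rewrite mule_ge0 ?lee_fin// integral_ge0// => a _; rewrite lee_fin mulr_ge0.
congr (_ + _)%E.
  by rewrite ge0_integralZl//; [exact/measurable_EFinP | move=> v _; rewrite lee_fin | rewrite lee_fin powR_ge0].
rewrite IB [RHS]integral_mkcond; apply: eq_integral => a _.
rewrite patchE mem_setE in_itv/= /ka; case: ifP => h; last by rewrite mulr0 mul0e.
rewrite mulr1; congr (_ * _)%E; apply: eq_integral => v _; congr (_%:E).
rewrite /Hd -mulrA; congr (_ * _); case: (leP (eunorm v) a) => va; last by rewrite mulr0.
by rewrite (le_trans va)// ?mulr1//; case/andP: h.
Qed.

(** Insert the volume bounds into the superposition and use that [dpow N a * a ^+ n.+3] is N
    a^(-s). *)
Lemma near_mass_bounds r de j eta : 0 < r -> r <= de ->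
  (forall a, 0 < a <= de -> (((j - eta) * a ^+ n.+3)%:E <= \int[mu R n.+2]_v (H v * (eunorm v <= a)%R%:R)%:E <=
     ((j + eta) * a ^+ n.+3)%:E)%E) ->
  (((j - eta) * kernel_mass r de)%:E <=
   \int[mu R n.+2]_v (H v * (eunorm v <= de)%R%:R * kr (d := n.+2) s r (eunorm v))%:E <=
   ((j + eta) * (kernel_mass r de + de `^ (- N) * de ^+ n.+3))%:E)%E.
Proof.
move=> r0 rd hI; have de0 : 0 < de by exact: lt_le_trans rd.
have N0 : 0 <= N by rewrite (le_trans _ N1).
set I := (fun a => \int[mu R n.+2]_v (H v * (eunorm v <= a)%R%:R)%:E)%E.
have I0 a : (0 <= I a)%E by apply: integral_ge0 => v _; rewrite lee_fin mulr_ge0.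
have mI : measurable_fun setT (I : measurableTypeR R -> \bar R).
  apply: (@measurable_fun_fubini_tonelli_G _ _ (rVm R n.+2) (measurableTypeR R) R (mu R n.+2)
    (fun p => (H p.1 * (eunorm p.1 <= p.2)%R%:R)%:E)) => [|p]; last by rewrite lee_fin mulr_ge0.
  apply/measurable_EFinP; apply: measurable_funM; first exact: (measurableT_comp mH measurable_fst).
  apply: measurable_fun_b2r; apply: measurable_fun_ler; last exact: measurable_snd.
  exact: (measurableT_comp measurable_eunorm measurable_fst).
have c0 : 0 <= j + eta.
  have := hI de; rewrite de0 lexx => /(_ isT)/andP[_ h].
  by have := le_trans (I0 de) h; rewrite lee_fin pmulr_lge0// exprn_gt0.
have mpow (c : R) : measurable_fun `[r, de] (fun t : measurableTypeR R => (c%:E * (N * t `^ (- s))%:E)%E).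
  apply: measurable_funTS; apply: emeasurable_funM; first exact: measurable_cst.
  by apply/measurable_EFinP; apply: measurable_funM; [exact: measurable_cst | exact: measurable_powR].
have mDI : measurable_fun `[r, de] (fun a : measurableTypeR R => ((dpow N a)%:E * I a)%E).
  apply: measurable_funTS; apply: emeasurable_funM => //.
  by apply/measurable_EFinP; exact: measurable_dpow.
have massE c : 0 <= c -> ((c * kernel_mass r de)%:E = \int[leb]_(t in `[r, de]) (c%:E * (N * t `^ (- s))%:E))%E.
  move=> c_ge0; rewrite EFinM -integral_kernel_mass// ge0_integralZl//.
    apply/measurable_EFinP; apply: measurable_funTS.
    by apply: measurable_funM; [exact: measurable_cst | exact: measurable_powR].
  by move=> t _; rewrite lee_fin mulr_ge0// powR_ge0.
have bnd a c : 0 < a -> (c%:E * (N * a `^ (- s))%:E = (dpow N a)%:E * (c * a ^+ n.+3)%:E)%E.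
  by move=> a0; rewrite -dpow_scale// -!EFinM; congr (_%:E); ring.
have D0 : (0 <= \int[leb]_(a in `[r, de]) ((dpow N a)%:E * I a))%E.
  by apply: integral_ge0 => a _; rewrite mule_ge0// lee_fin dpow_ge0.
rewrite near_mass// -/(I de) -/I; apply/andP; split.
  (* If [j - eta] is negative the lower bound is trivial, all masses being nonnegative. *)
  have [c'0|c'0] := leP 0 (j - eta); last first.
    apply: le_trans (_ : 0 <= _)%E; first by rewrite lee_fin (mulr_le0_ge0 (ltW c'0) (kernel_mass_ge0 r0 rd)).
    by rewrite adde_ge0// mule_ge0// lee_fin powR_ge0.
  apply: le_trans (_ : \int[leb]_(a in `[r, de]) ((dpow N a)%:E * I a) <= _)%E; last first.
    by rewrite leeDr// mule_ge0// lee_fin powR_ge0.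
  rewrite massE//; apply: ge0_le_integral => //.
  - by move=> t _; rewrite -EFinM lee_fin !mulr_ge0// powR_ge0.
  - exact: mpow.
  - move=> a; rewrite /= in_itv/= => /andP[ra ad]; have a0 : 0 < a by exact: lt_le_trans ra.
    rewrite bnd// lee_wpmul2l ?lee_fin ?dpow_ge0//.
    by have /andP[] : _ && _ := hI a (introT andP (conj a0 ad)).
have -> : (j + eta) * (kernel_mass r de + de `^ (- N) * de ^+ n.+3) =
  (j + eta) * (de `^ (- N) * de ^+ n.+3) + (j + eta) * kernel_mass r de by ring.
rewrite EFinD; apply: leeD.
  rewrite mulrCA EFinM lee_wpmul2l ?lee_fin ?powR_ge0//.
  by have := hI de; rewrite de0 lexx => /(_ isT)/andP[].
rewrite massE//; apply: ge0_le_integral => //.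
- by move=> t _; apply: mule_ge0; [rewrite lee_fin; exact: dpow_ge0 | exact: I0].
- exact: mpow.
move=> a; rewrite /= in_itv/= => /andP[ra ad]; have a0 : 0 < a by exact: lt_le_trans ra.
rewrite bnd// lee_wpmul2l ?lee_fin ?dpow_ge0//.
by have /andP[] : _ && _ := hI a (introT andP (conj a0 ad)).
Qed.

(** Away from the origin the crude volume bound by that of the whole ball is enough:
    [dpow N a * a ^+ n.+2] equals N/s times [dpow s a], integrable at infinity. The bound is
    independent of r. *)
Lemma far_mass r de C : 0 < r -> r <= de -> (forall v, H v <= C) ->
  (\int[mu R n.+2]_v (H v * (de < eunorm v)%R%:R * kr (d := n.+2) s r (eunorm v))%:E <=
   (C * ball_vol n.+2 * (N / s * de `^ (- s)))%:E)%E.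
Proof.
move=> r0 rd HC; have de0 : 0 < de by exact: lt_le_trans rd.
have N0 : 0 <= N by rewrite (le_trans _ N1).
have C0 : 0 <= C by exact: le_trans (H0 0) (HC 0).
have bv0 : 0 <= ball_vol n.+2 :> R by exact: ball_vol_ge0.
set bv := ball_vol n.+2 in bv0 *.
pose ka a := dpow N a * (de <= a)%R%:R.
have mka : measurable_fun setT ka.
  apply: measurable_funM; first exact: measurable_dpow.
  by apply: measurable_fun_b2r; apply: measurable_fun_ler; [exact: measurable_cst | exact: measurable_id].
have ka0 a : 0 <= ka a by rewrite mulr_ge0// dpow_ge0.
have IB := integral_balls mH H0 mka ka0.
have mB : measurable_fun setT (fun v : rVm R n.+2 => ((H v)%:E * \int[leb]_a (ka a * (eunorm v <= a)%R%:R)%:E)%E).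
  apply: emeasurable_funM; first exact/measurable_EFinP.
  apply: (@measurable_fun_fubini_tonelli_F _ _ (rVm R n.+2) (measurableTypeR R) R leb
    (fun p => (ka p.2 * (eunorm p.1 <= p.2)%R%:R)%:E)) => [|p]; last by rewrite lee_fin mulr_ge0.
  apply/measurable_EFinP; apply: measurable_funM; first exact: (measurableT_comp mka measurable_snd).
  apply: measurable_fun_b2r; apply: measurable_fun_ler; last exact: measurable_snd.
  exact: (measurableT_comp measurable_eunorm measurable_fst).
apply: (@le_trans _ _ (\int[mu R n.+2]_v ((H v)%:E * \int[leb]_a (ka a * (eunorm v <= a)%R%:R)%:E))%E).
  apply: ge0_le_integral => //.
  - by move=> v _; rewrite lee_fin !mulr_ge0// kr_ge0.
  - apply/measurable_EFinP; apply: measurable_funM; last exact: measurable_kr_norm.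
    apply: measurable_funM => //.
    by apply: measurable_fun_b2r; apply: measurable_fun_ltr; [exact: measurable_cst | exact: measurable_eunorm].
  - move=> v _; case: (ltP de (eunorm v)) => vd; last first.
      rewrite mulr0 mul0r mule_ge0 ?lee_fin// integral_ge0// => a _.
      by rewrite lee_fin mulr_ge0.
    by rewrite mulr1 EFinM (kr_tail r0 rd vd).
rewrite IB.
have -> : (C * bv * (N / s * de `^ (- s)))%:E =
    (\int[leb]_(a in `[de, +oo[) ((C * bv * (N / s))%:E * (dpow s a)%:E))%E.
  rewrite ge0_integralZl//.
  - by rewrite integral_dpow_halfline// -EFinM; congr (_%:E); ring.
  - by apply/measurable_EFinP; apply: measurable_funTS; exact: measurable_dpow.
  - by move=> a _; rewrite lee_fin dpow_ge0// (le_trans _ s1).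
  - rewrite lee_fin; apply: mulr_ge0; first by rewrite mulr_ge0.
    by apply: divr_ge0 => //; exact: le_trans s1.
rewrite [leRHS]integral_mkcond; apply: ge0_le_integral => //.
- by move=> a _; rewrite mule_ge0 ?lee_fin// integral_ge0// => v _; rewrite lee_fin mulr_ge0.
- apply: emeasurable_funM; first exact/measurable_EFinP.
  apply: (@measurable_fun_fubini_tonelli_G _ _ (rVm R n.+2) (measurableTypeR R) R (mu R n.+2)
    (fun p => (H p.1 * (eunorm p.1 <= p.2)%R%:R)%:E)) => [|p]; last by rewrite lee_fin mulr_ge0.
  apply/measurable_EFinP; apply: measurable_funM; first exact: (measurableT_comp mH measurable_fst).
  apply: measurable_fun_b2r; apply: measurable_fun_ler; last exact: measurable_snd.
  exact: (measurableT_comp measurable_eunorm measurable_fst).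
- apply/(measurable_restrictT _ _).1 => //; apply: measurable_funTS.
  apply: emeasurable_funM; first exact: measurable_cst.
  by apply/measurable_EFinP; exact: measurable_dpow.
move=> a _; rewrite patchE mem_setE in_itv/= andbT /ka; case: ifP => da; last by rewrite mulr0 mul0e.
have a0 : 0 < a by exact: lt_le_trans da.
rewrite mulr1.
apply: (@le_trans _ _ ((dpow N a)%:E * (C%:E * (ball_vol n.+2 * a ^+ n.+2)%:E))%E).
  rewrite lee_wpmul2l ?lee_fin ?dpow_ge0// -(volume_cball_ge0 _ (ltW a0)) -ge0_integralZl//.
    apply: ge0_le_integral => //.
    - by move=> v _; rewrite lee_fin mulr_ge0.
    - apply/measurable_EFinP; apply: measurable_funM => //; exact: measurable_cball_ind.
    - apply: emeasurable_funM; first exact: measurable_cst.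
      by apply/measurable_EFinP; exact: measurable_cball_ind.
    - by move=> v _; rewrite -EFinM lee_fin ler_wpM2r.
  by apply/measurable_EFinP; exact: measurable_cball_ind.
rewrite -!EFinM lee_fin le_eqVlt; apply/orP; left; apply/eqP.
have -> : dpow N a = N * (a `^ (- s - 1) * a ^- n.+2).
  rewrite /dpow -powR_mulrn ?ltW// -powRN -powRD ?(gt_eqF a0) ?implybT//.
  by congr (_ * _ `^ _); rewrite /N; ring.
rewrite -/bv /dpow; have : a ^+ n.+2 != 0 by rewrite expf_neq0// lt0r_neq0.
have : s != 0 by rewrite lt0r_neq0// (lt_le_trans _ s1).
by move: (a ^+ n.+2) => A s0 A0; field; rewrite s0 A0.
Qed.

End ball_masses.
End radial_kernel.

Section econt.
Context {R : realType} {n : nat}.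
Implicit Types (F H : 'rV[R]_n -> R) (v : 'rV[R]_n).

Lemma econtP F v : econt F v <-> {for v, continuous F}.
Proof.
split=> [cF|cF e e0].
  apply/(@cvgrPdist_lt _ _ _ _ (nbhs_filter v)) => e e0; have [r r0 h] := cF e e0.
  have nr : 0 < r / (n%:R + 1) by rewrite divr_gt0// ltr_wpDl.
  have : \forall y \near v, `|v - y| < r / (n%:R + 1).
    by apply/nbhs_ballP; exists (r / (n%:R + 1)) => // y; rewrite mx_norm_ball.
  apply: filterS => y vy; rewrite distrC; apply: h.
  apply: le_trans (ler_eunorm_norm _) _; rewrite -normrN opprB.
  apply: le_trans (_ : n%:R * (r / (n%:R + 1)) <= _); first by rewrite ler_wpM2l// ltW.
  rewrite mulrCA; apply: ler_piMr; first exact: ltW.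
  by rewrite ler_pdivrMr ?mul1r; [rewrite lerDl | rewrite ltr_wpDl].
have /(_ e e0)/(nbhs_ballP v)[r /= r0 h] := (@cvgrPdist_lt _ _ _ _ (nbhs_filter v) F (F v)).1 cF.
exists (r / 2); first by rewrite divr_gt0.
move=> y yv; rewrite distrC; apply: h; rewrite mx_norm_ball /= -normrN opprB.
by apply: le_lt_trans (ler_norm_eunorm _) _; apply: le_lt_trans yv _; lra.
Qed.

Lemma econt_comp F v (phi : R -> R) : econt F v -> {for F v, continuous phi} ->
  econt (phi \o F) v.
Proof.
move=> cF cphi e e0; move/cvgrPdist_lt : cphi => /(_ e e0)/nbhs_ballP[d /= d0 hd].
have [r r0 hr] := cF d d0; exists r => // y /hr h.
by rewrite distrC; apply: hd; rewrite /ball/= distrC.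
Qed.

Lemma econtD F H v : econt F v -> econt H v -> econt (fun v => F v + H v) v.
Proof.
move=> cF cH e e0; have e20 : 0 < e / 2 by rewrite divr_gt0.
have [r r0 hr] := cF _ e20; have [t t0 ht] := cH _ e20.
exists (Num.min r t); first by rewrite lt_min r0.
move=> y; rewrite le_min => /andP[/hr h1 /ht h2].
rewrite opprD addrACA; apply: le_lt_trans (ler_normD _ _) _; lra.
Qed.

Lemma econt_eunorm v : econt (@eunorm R n) v.
Proof.
by move=> e e0; exists (e / 2); [rewrite divr_gt0 | move=> y h;
  apply: le_lt_trans (ler_eunorm_dist _ _) _; apply: le_lt_trans h _; lra].
Qed.

Lemma econt_measurable F : (forall v, econt F v) -> measurable_fun setT (F : rVm R n -> R).
Proof. by move=> cF; apply: continuous_measurable_rV => v; exact/econtP. Qed.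

Lemma econt_qpart (q : 'rV[R]_n -> R) c : (forall v, econt q v) ->
  forall v, econt (fun v => Num.max (q v - c * eunorm v ^+ 2) 0) v.
Proof.
move=> cq v.
have c1 : econt (fun v => q v + (fun x => - (c * x ^+ 2)) (eunorm v)) v.
  apply: econtD => //; apply: (@econt_comp _ _ (fun x => - (c * x ^+ 2))); first exact: econt_eunorm.
  by apply: cvgN; apply: cvgM; [exact: cvg_cst | exact: exprn_continuous].
move=> e e0; have [r r0 hr] := c1 e e0; exists r => // y /hr; apply: le_lt_trans.
move: (q y - _) (q v - _) => a b.
by rewrite !maxEle; case: (leP a 0); case: (leP b 0) => h1 h2; rewrite ler_norml ?subrr ?normr0 ?subr0 ?sub0r;
  have := ler_norm (a - b); have := ler_norm (b - a); rewrite (distrC b a); lra.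
Qed.

End econt.

Lemma sigmas_large (R : realType) (d : nat) (s A : R) : 1 <= s ->
  exists2 r1, 0 < r1 & forall r, 0 < r < r1 -> A <= sigmas (d := d) s r.
Proof.
move=> s1; rewrite /sigmas; case: eqP => [_|/eqP s_1].
  exists (expR (- `|A|)); first exact: expR_gt0.
  move=> r /andP[r0 r1]; apply: le_trans (ler_norm A) _.
  have : ln r < - `|A| by rewrite -(expRK (- `|A|)) ltr_ln ?posrE ?expR_gt0.
  by rewrite -(normrN (ln r)) => h; apply: le_trans (ler_norm _); lra.
have s10 : 0 < s - 1 by rewrite subr_gt0 lt_neqAle eq_sym s_1.
pose c := (d%:R + s) / (d%:R + 1) / (s - 1).
have c0 : 0 < c.
  have d1 : 0 < d%:R + s by rewrite ltr_wpDl// (lt_le_trans _ s1).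
  have d2 : 0 < d%:R + 1 :> R by rewrite ltr_wpDl.
  by rewrite /c !divr_gt0.
have [|r1 /= r10 h] := powR_cvg0 s10 (t := [set y | `|y| < c / (`|A| + 1)]) _.
  apply/nbhs_ballP; exists (c / (`|A| + 1)); first by rewrite /= divr_gt0// ltr_wpDl.
  by move=> y; rewrite /ball/= sub0r normrN.
exists r1 => // r /andP[r0 rr1].
have := h r; rewrite /ball_ /= sub0r normrN gtr0_norm// => /(_ rr1 r0).
have p0 : 0 < r `^ (s - 1) by exact: powR_gt0.
rewrite gtr0_norm// ltr_pdivlMr; last by rewrite ltr_wpDl.
rewrite -ltr_pdivlMl// => hA.
have -> : (d%:R + s) / (d%:R + 1) * r `^ (1 - s) / (s - 1) = (r `^ (s - 1))^-1 * c.
  by rewrite -powRN opprB /c; ring.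
by apply: le_trans (ler_norm A) _; lra.
Qed.

Section asymptotics.
Context {R : realType}.
Variable n : nat.
Variable s : R.
Hypothesis s1 : 1 <= s.
Variables (G q : 'rV[R]_n.+2 -> R) (C Cq : R).
Hypothesis mG : measurable_fun setT (G : rVm R _ -> R).
Hypothesis G0 : forall v, 0 <= G v <= C.
Hypothesis G00 : G 0 = 0.
Hypothesis cG : forall v, v != 0 -> econt G v.
Hypothesis hG : forall a v, 0 < a -> G (a *: v) = G v.
Hypothesis cq : forall v, econt q v.
Hypothesis hq : forall a v, 0 < a -> q (a *: v) = a ^+ 2 * q v.
Hypothesis qC : forall v, `|q v| <= Cq * eunorm v ^+ 2.
Variables (M : 'M[R]_n.+2) (nu : 'rV[R]_n.+2).
Hypothesis oM : M *m M^T = 1%:M.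
Hypothesis eM : e0 n.+1 *m M = nu.

Local Notation N := (n.+2%:R + s).
Local Notation kr := (kr (d := n.+2) s).
Local Notation sigma := (sigmas (d := n.+2) s).
Local Notation mu := (mu R n.+2).

Let C0 : 0 <= C. Proof. by have /andP[h /(le_trans h)] := G0 0. Qed.

(** Split at radius r: inside, the kernel is constant; outside, [far_mass] applies with [de] equal
    to r. *)
Lemma integrable_kernel (H : 'rV[R]_n.+2 -> R) r : 0 < r ->
  measurable_fun setT (H : rVm R _ -> R) -> (forall v, `|H v| <= G v) ->
  mu.-integrable setT (EFin \o (fun v : rVm R n.+2 => H v * kr r (eunorm v))).
Proof.
move=> r0 mH HG.
have mk : measurable_fun setT (fun v : rVm R n.+2 => kr r (eunorm v)) by exact: measurable_kr_norm.
have mGk : measurable_fun setT (fun v : rVm R n.+2 => G v * kr r (eunorm v)) by exact: measurable_funM.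
have k0 t : 0 <= kr r t by exact: kr_ge0.
have Gp v : 0 <= G v by have /andP[] := G0 v.
apply: (@le_integrable _ _ _ mu setT _ _ (EFin \o (fun v : rVm R n.+2 => G v * kr r (eunorm v)))) => //.
  by apply/measurable_EFinP; exact: measurable_funM.
  by move=> v _; rewrite lee_fin !normrM ler_wpM2r// (ger0_norm (Gp v)).
have mle : measurable_fun setT (fun v : rVm R n.+2 => ((eunorm v <= r)%R%:R : R)).
  by apply: measurable_fun_b2r; apply: measurable_fun_ler; [exact: measurable_eunorm | exact: measurable_cst].
have mlt : measurable_fun setT (fun v : rVm R n.+2 => ((r < eunorm v)%R%:R : R)).
  by apply: measurable_fun_b2r; apply: measurable_fun_ltr; [exact: measurable_cst | exact: measurable_eunorm].
have i1 : mu.-integrable setT (EFin \o (fun v : rVm R n.+2 => G v * (eunorm v <= r)%R%:R * kr r (eunorm v))).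
  apply: (@integrable_ball_dom _ _ _ (C * r `^ (- N)) r); first exact: ltW.
    by apply: measurable_funM => //; exact: measurable_funM.
  move=> v; have [vr|_] := leP (eunorm v) r; last by rewrite !mulr0 mul0r normr0.
  rewrite !mulr1 ger0_norm ?mulr_ge0// krE max_l//.
  by rewrite ler_wpM2r ?powR_ge0//; have /andP[] := G0 v.
have i2 : mu.-integrable setT (EFin \o (fun v : rVm R n.+2 => G v * (r < eunorm v)%R%:R * kr r (eunorm v))).
  apply/integrableP; split.
    by apply/measurable_EFinP; apply: measurable_funM => //; exact: measurable_funM.
  under eq_integral do rewrite /= ger0_norm ?mulr_ge0//.
  apply: le_lt_trans (ltry _); apply: (far_mass s1 mG Gp r0 (lexx r) (C := C)) => v.
  by have /andP[] := G0 v.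
have := integrableD measurableT i1 i2; apply: eq_integrable => // v _ /=.
rewrite -EFinD; congr (_%:E); rewrite -!mulrDl -mulrDr ltNge.
by case: (_ <= _); rewrite /= ?addr0 ?add0r mulr1.
Qed.

(** The slab asymptotics require a nonnegative width. Taking the positive part leaves the slab
    unchanged, since |l.v| < y already forces y > 0. *)
Definition qpart (c : R) v : R := Num.max (q v - c * eunorm v ^+ 2) 0.

Lemma qpart_bound c v : 0 <= qpart c v <= (Cq + `|c|) * eunorm v ^+ 2.
Proof.
rewrite /qpart le_max lexx orbT /= ge_max; apply/andP; split; last first.
  by rewrite mulr_ge0 ?sqr_ge0// addr_ge0//; have := le_trans (normr_ge0 _) (qC (e0 n.+1)); rewrite eunorm_e0 expr1n mulr1.
rewrite mulrDl; apply: lerD; first exact: le_trans (ler_norm _) (qC v).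
by rewrite -mulNr ler_wpM2r ?sqr_ge0// -normrN ler_norm.
Qed.

Lemma qpart_scale c a v : 0 < a -> qpart c (a *: v) = a ^+ 2 * qpart c v.
Proof.
move=> a0; rewrite /qpart hq// eunormZ exprMn real_normK ?num_real//.
have -> : a ^+ 2 * q v - c * (a ^+ 2 * eunorm v ^+ 2) = a ^+ 2 * (q v - c * eunorm v ^+ 2) by ring.
by rewrite -{1}(mulr0 (a ^+ 2)) -maxr_pMr// ?exprn_ge0 ?ltW.
Qed.

End asymptotics.

(** With y = q(v) and x = e |v|^2, this compares the difference of the widths of the two slabs with
    q(v). *)
Lemma max0_sub_ge (R : realType) (x y : R) : 0 <= x ->
  y - 2 * x <= Num.max (y - x) 0 - Num.max (- y + 2 * x) 0.
Proof. by move=> x0; rewrite !maxEle; case: ifP => a1; case: ifP => a2; lra. Qed.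

(** * The kernel integral bounded below by slab masses *)

Section lower_bound.
Context {R : realType}.
Variable n : nat.
Variable s : R.
Hypothesis s1 : 1 <= s.
Variables (G q : 'rV[R]_n.+2 -> R) (C Cq : R).
Hypothesis mG : measurable_fun setT (G : rVm R _ -> R).
Hypothesis G0 : forall v, 0 <= G v <= C.
Hypothesis G00 : G 0 = 0.
Hypothesis cG : forall v, v != 0 -> econt G v.
Hypothesis hG : forall a v, 0 < a -> G (a *: v) = G v.
Hypothesis cq : forall v, econt q v.
Hypothesis hq : forall a v, 0 < a -> q (a *: v) = a ^+ 2 * q v.
Hypothesis qC : forall v, `|q v| <= Cq * eunorm v ^+ 2.
Variables (M : 'M[R]_n.+2) (nu : 'rV[R]_n.+2).
Hypothesis oM : M *m M^T = 1%:M.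
Hypothesis eM : e0 n.+1 *m M = nu.

Local Notation N := (n.+2%:R + s).
Local Notation kr := (kr (d := n.+2) s).
Local Notation sigma := (sigmas (d := n.+2) s).
Local Notation muV := (mu R n.+2).

Lemma integrable_slab_lim (p : 'rV[R]_n.+2 -> R) Cp :
  measurable_fun setT (p : rVm R _ -> R) -> (forall v, `|p v| <= Cp * eunorm v ^+ 2) ->
  (mu R n.+1).-integrable setT (EFin \o (fun z : rVm R n.+1 =>
    2 * p (vcons 0 z *m M) * G (vcons 0 z *m M) * (eunorm z <= 1)%R%:R)).
Proof.
move=> mp pC.
have mv0 : measurable_fun setT (fun z : rVm R n.+1 => vcons (0 : R) z *m M).
  apply: (measurableT_comp (measurable_mulmx M)); exact: measurable_vconsr.
apply: (@integrable_ball_dom _ _ _ (2 * `|Cp| * `|C|) 1) => //.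
  apply: measurable_funM; last first.
    by apply: measurable_fun_b2r; apply: measurable_fun_ler; [exact: measurable_eunorm | exact: measurable_cst].
  apply: measurable_funM; last exact: (measurableT_comp mG mv0).
  by apply: measurable_funM; [exact: measurable_cst | exact: (measurableT_comp mp mv0)].
move=> z; set v := vcons _ _ *m _; have /andP[g0 gC] := G0 v; have hC := pC v.
have nv : eunorm v = eunorm z.
  by rewrite /v eunorm_orth// eunorm_vcons expr0n/= add0r sqrtr_sqr ger0_norm ?eunorm_ge0.
case: (leP (eunorm z) 1) => z1; last by rewrite !mulr0 normr0.
rewrite !mulr1 !normrM (ger0_norm (ler0n _ 2)) (ger0_norm g0) -!mulrA ler_pM2l//; apply: ler_pM => //.
  apply: le_trans hC _; rewrite (le_trans (ler_norm _))// normrM ler_piMr//.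
  by rewrite ger0_norm ?sqr_ge0// expr_le1// ?eunorm_ge0// nv.
exact: le_trans gC (ler_norm _).
Qed.

(** Inside the ball of radius [de] the phase is bounded below by the difference of two slab
    indicators, whose kernel masses are close to j1 and j2 times [kernel_mass]; outside it is at
    least -1. The error eta is shared in three equal parts between the tolerance e, the slab
    asymptotics h, and the terms bounded in r. *)
Lemma kernel_lower_bound (om : R -> 'rV[R]_n.+2 -> R) :
  (forall r, 0 < r -> measurable_fun setT (om r : rVm R _ -> R)) ->
  (forall r v, 0 < r -> `|om r v| <= 1) ->
  (forall e, 0 < e -> exists2 de, 0 < de & exists2 r0, 0 < r0 & forall r, 0 < r < r0 ->
    exists2 l, eunorm (l - nu) <= e & forall v, v != 0 -> eunorm v <= de ->
      (`|edot l v| < q v - e * eunorm v ^+ 2)%R%:R -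
      (`|edot l v| < - q v + 2 * e * eunorm v ^+ 2)%R%:R <= om r v) ->
  forall eta, 0 < eta -> exists2 r1, 0 < r1 & forall r, 0 < r < r1 ->
    (n.+3%:R * slab_lim G q M - eta) * sigma r <=
    Rintegral muV setT (fun v => om r v * G v * kr r (eunorm v)).
Proof.
move=> mom om1 hom eta eta0.
have Gp v : 0 <= G v by have /andP[] := G0 v.
have C0 : 0 <= C by have /andP[h /(le_trans h)] := G0 0.
(* The slab constant for the width |v|^2; it measures the price of the tolerance e |v|^2. *)
pose T := slab_lim G (fun v => eunorm v ^+ 2) M.
have T0 : 0 <= T.
  apply: Rintegral_ge0 => z _; by rewrite !mulr_ge0 ?eunorm_ge0.
pose n3 : R := n.+3%:R.
have n30 : 0 < n3 by rewrite ltr0n.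
(* Chosen so that n3 times 2 e T is at most eta/3; [T + 1] is used because [T] may vanish. Likewise
   n3 times 2 h will be eta/3. *)
pose e := eta / (n3 * 2 * (T + 1) * 3).
have e_gt0 : 0 < e by rewrite divr_gt0// !mulr_gt0// ltr_wpDl.
pose h := eta / (n3 * 2 * 3).
have h_gt0 : 0 < h by rewrite divr_gt0// !mulr_gt0.
have cqN v : econt (fun v => - q v) v by apply: (econt_comp (phi := fun x => - x)) => //; exact: opp_continuous.
have hqN a v : 0 < a -> - q (a *: v) = a ^+ 2 * - q v by move=> /hq ->; rewrite mulrN.
have qCN v : `|- q v| <= Cq * eunorm v ^+ 2 by rewrite normrN.
pose p1 := qpart q e; pose p2 := qpart (fun v => - q v) (- (2 * e)).
have cp1 v : econt p1 v by exact: econt_qpart.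
have cp2 v : econt p2 v by exact: econt_qpart.
have mp1 := econt_measurable cp1; have mp2 := econt_measurable cp2.
have mq := econt_measurable cq.
have [d1 d1_gt0 L1] := slab_ball_limit mG mp1 G0 (qpart_bound qC e) cG cp1 hG (fun a v => @qpart_scale _ _ _ hq e a v) oM eM h_gt0.
have [d2 d2_gt0 L2] := slab_ball_limit mG mp2 G0 (qpart_bound qCN (- (2 * e))) cG cp2 hG (fun a v => @qpart_scale _ _ _ hqN (- (2 * e)) a v) oM eM h_gt0.
set j1 := slab_lim G p1 M in L1; set j2 := slab_lim G p2 M in L2.
(* Besides the tolerance, [e'] bounds the distance from l to nu, which must suit both slab
   asymptotics. *)
pose e' := Num.min e (Num.min d1 d2).
have e'_gt0 : 0 < e' by rewrite !lt_min e_gt0 d1_gt0.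
have [d0 d0_gt0 [r0 r0_gt0 hr]] := hom e' e'_gt0.
pose de := Num.min d0 (Num.min d1 d2).
have de_gt0 : 0 < de by rewrite !lt_min d0_gt0 d1_gt0.
have [ded0 ded1 ded2] : [/\ de <= d0, de <= d1 & de <= d2] by rewrite !ge_min !lexx !orbT.
clearbody de.
have j12 : slab_lim G q M - 2 * e * T <= j1 - j2.
  have iq := integrable_slab_lim mq qC.
  have mN : measurable_fun setT (fun v : rVm R n.+2 => eunorm v ^+ 2) by apply: measurable_funX; exact: measurable_eunorm.
  have iT : _ := @integrable_slab_lim (fun v => eunorm v ^+ 2) 1 mN _.
  have {}iT := iT (fun v => _); have {}iT := iT ltac:(move=> v; rewrite mul1r ger0_norm// sqr_ge0//).
  have ab (p : 'rV[R]_n.+2 -> R) c : (forall v, 0 <= p v <= c * eunorm v ^+ 2) -> forall v, `|p v| <= c * eunorm v ^+ 2.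
    by move=> hp v; have /andP[a b] := hp v; rewrite ger0_norm.
  have i1 := integrable_slab_lim mp1 (ab _ _ (qpart_bound qC e)).
  have i2 := integrable_slab_lim mp2 (ab _ _ (qpart_bound qCN (- (2 * e)))).
  have iT2 := integrableZl measurableT (2 * e) iT.
  rewrite /j1 /j2 /slab_lim -(RintegralB measurableT i1 i2) /T /slab_lim -(RintegralZl (2 * e) measurableT iT) -(RintegralB measurableT iq iT2).
  apply: le_Rintegral => //; [exact: (integrableB measurableT iq iT2) | exact: (integrableB measurableT i1 i2) |].
  move=> z _; set v := vcons _ _ *m _; set b := ((eunorm z <= 1)%R%:R : R).
  have b0 : 0 <= 2 * G v * b by rewrite !mulr_ge0.
  have -> : 2 * q v * G v * b - 2 * e * (2 * eunorm v ^+ 2 * G v * b) = (q v - 2 * e * eunorm v ^+ 2) * (2 * G v * b) by ring.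
  have -> : 2 * p1 v * G v * b - 2 * p2 v * G v * b = (p1 v - p2 v) * (2 * G v * b) by ring.
  apply: ler_wpM2r => //; rewrite /p1 /p2 /qpart mulNr opprK.
  have : 0 <= e * eunorm v ^+ 2 by rewrite mulr_ge0 ?sqr_ge0 ?ltW.
  by rewrite -mulrA; exact: max0_sub_ge.
have [B hB] := kernel_mass_sigma n s de_gt0.
pose X := de `^ (- N) * de ^+ n.+3.
pose BF := C * ball_vol n.+2 * (N / s * de `^ (- s)).
(* All the terms that do not depend on r; sigma will exceed 3 |K0|/eta. *)
pose K0 := (j1 - j2 - 2 * h) * B - (j2 + h) * X - BF.
have [rs rs_gt0 hs] := sigmas_large n.+2 (3 / eta * `|K0|) s1.
exists (Num.min r0 (Num.min de (Num.min 1 rs))); first by rewrite !lt_min r0_gt0 de_gt0 rs_gt0 ltr01.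
move=> r /andP[r_gt0]; rewrite !lt_min => /and4P[rr0 rde r_1 rrs].
have [l ln hl] := hr r (introT andP (conj r_gt0 rr0)).
have le' : eunorm (l - nu) <= d1 /\ eunorm (l - nu) <= d2.
  by split; apply: le_trans ln _; rewrite !ge_min lexx ?orbT.
have ml (p : 'rV[R]_n.+2 -> R) : measurable_fun setT (p : rVm R _ -> R) ->
    measurable_fun setT (fun v : rVm R n.+2 => G v * (`|edot l v| < p v)%R%:R).
  move=> mp; apply: measurable_funM => //; apply: measurable_fun_b2r; apply: measurable_fun_ltr => //.
  by apply: measurableT_comp => //; apply: measurable_edot; [exact: measurable_cst | exact: measurable_id].
pose H1 v := G v * (`|edot l v| < p1 v)%R%:R.
pose H2 v := G v * (`|edot l v| < p2 v)%R%:R.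
have H1p v : 0 <= H1 v by rewrite mulr_ge0.
have H2p v : 0 <= H2 v by rewrite mulr_ge0.
have NB1 := near_mass_bounds s1 (ml _ mp1) H1p r_gt0 (ltW rde)
  (fun a ha => L1 l a (introT andP (conj (proj1 (andP ha)) (le_trans (proj2 (andP ha)) ded1))) (proj1 le')).
have NB2 := near_mass_bounds s1 (ml _ mp2) H2p r_gt0 (ltW rde)
  (fun a ha => L2 l a (introT andP (conj (proj1 (andP ha)) (le_trans (proj2 (andP ha)) ded2))) (proj2 le')).
have FB := far_mass s1 mG Gp r_gt0 (ltW rde) (fun v => proj2 (andP (G0 v))).
have mcb : measurable_fun setT (fun v : rVm R n.+2 => ((eunorm v <= de)%R%:R : R)) by exact: measurable_cball_ind.
have mfb : measurable_fun setT (fun v : rVm R n.+2 => ((de < eunorm v)%R%:R : R)).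
  by apply: measurable_fun_b2r; apply: measurable_fun_ltr; [exact: measurable_cst | exact: measurable_eunorm].
have bb (a : R) (b c : bool) : 0 <= a -> `|a * b%:R * c%:R| <= a.
  by move=> a0; rewrite ger0_norm ?mulr_ge0//; case: b; case: c; rewrite ?mulr1 ?mulr0 ?mul0r.
have i1 := integrable_kernel s1 mG G0 r_gt0 (measurable_funM (ml _ mp1) mcb) (fun v => bb _ _ _ (Gp v)).
have i2 := integrable_kernel s1 mG G0 r_gt0 (measurable_funM (ml _ mp2) mcb) (fun v => bb _ _ _ (Gp v)).
have i3 := integrable_kernel (H := fun v => G v * (de < eunorm v)%R%:R) s1 mG G0 r_gt0 (measurable_funM mG mfb)
  ltac:(by move=> v; have := bb (G v) (de < eunorm v) true (Gp v); rewrite mulr1).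
have io := integrable_kernel s1 mG G0 r_gt0 (measurable_funM (mom r r_gt0) mG)
  ltac:(by move=> v; rewrite normrM (ger0_norm (Gp v)); apply: ler_piMl => //; exact: om1).
have i12 := integrableB measurableT i1 i2.
have i123 := integrableB measurableT i12 i3.
have key := le_Rintegral measurableT i123 io.
have : forall v, setT v -> H1 v * (eunorm v <= de)%R%:R * kr r (eunorm v) - H2 v * (eunorm v <= de)%R%:R * kr r (eunorm v)
    - G v * (de < eunorm v)%R%:R * kr r (eunorm v) <= om r v * G v * kr r (eunorm v).
  move=> v _; have k0 : 0 <= kr r (eunorm v) by exact: kr_ge0.
  rewrite -!mulrBl; apply: ler_wpM2r => //.
  (* The hypothesis on the phase says nothing at the origin, but there [G] vanishes. *)
  have [->|v0] := eqVneq v 0; first by rewrite /H1 /H2 G00 !(mul0r, mulr0) !subr0.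
  rewrite /H1 /H2 -mulrBr; have /andP[] : -1 <= om r v <= 1 by rewrite -ler_norml om1.
  have [vd|vd] := leP (eunorm v) de; last first.
    by rewrite !mulr0 sub0r mulr1 => h1 _; rewrite -mulN1r; exact: ler_wpM2r.
  rewrite mulr0 subr0 mulr1 => _ _; rewrite [leRHS]mulrC; apply: ler_wpM2l => //.
  (* Since [e'] is at most [e], the slab added here is narrower, and the one subtracted is wider,
     than those of the hypothesis. *)
  apply: le_trans (hl v v0 (le_trans vd ded0)); apply: lerB.
    have : (`|edot l v| < p1 v) -> (`|edot l v| < q v - e' * eunorm v ^+ 2).
      rewrite /p1 /qpart lt_max [`|_| < 0]ltNge normr_ge0 orbF => /lt_le_trans; apply.
      by rewrite lerD2l lerN2 ler_wpM2r ?sqr_ge0// ge_min lexx.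
    by case: (_ < _) => //= ->.
  have : (`|edot l v| < - q v + 2 * e' * eunorm v ^+ 2) -> (`|edot l v| < p2 v).
    rewrite /p2 /qpart lt_max => /lt_le_trans ->//.
    by rewrite mulNr opprK lerD2l ler_wpM2r ?sqr_ge0// ler_pM2l// ge_min lexx.
  by case: (_ < - _ + _) => //= ->.
move=> /key; rewrite RintegralB// RintegralB//.
have f1 := integrable_fin_num measurableT i1; have f2 := integrable_fin_num measurableT i2.
have f3 := integrable_fin_num measurableT i3.
have : (j1 - h) * kernel_mass n s r de <= Rintegral muV setT (fun v => H1 v * (eunorm v <= de)%R%:R * kr r (eunorm v)).
  by rewrite -lee_fin /Rintegral fineK//; have /andP[] := NB1.
have : Rintegral muV setT (fun v => H2 v * (eunorm v <= de)%R%:R * kr r (eunorm v)) <= (j2 + h) * (kernel_mass n s r de + X).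
  by rewrite -lee_fin /Rintegral fineK//; have /andP[] := NB2.
have : Rintegral muV setT (fun v => G v * (de < eunorm v)%R%:R * kr r (eunorm v)) <= BF.
  by rewrite -lee_fin /Rintegral fineK.
set D1 := Rintegral muV setT (fun v => H1 v * _ * _).
set D2 := Rintegral muV setT (fun v => H2 v * _ * _).
set D3 := Rintegral muV setT (fun v => G v * _ * _).
rewrite hB ?r_gt0//.
have := hs r (introT andP (conj r_gt0 rrs)).
rewrite -/n3; set S := sigma r; set J := slab_lim G q M in j12 *.
set KK := Rintegral _ _ _.
move=> hS h3 h2 h1 hK.
have S0 : 0 <= S by apply: le_trans hS; rewrite mulr_ge0// ltW// divr_gt0.
have hK0 : - (eta / 3 * S) <= K0.
  have : `|K0| <= eta / 3 * S by rewrite -ler_pdivrMl ?divr_gt0// invf_div.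
  by rewrite ler_norml => /andP[].
have hc : n3 * J - eta * 2 / 3 <= (j1 - j2 - 2 * h) * n3.
  have -> : n3 * J - eta * 2 / 3 = (J - eta / (n3 * 3) - eta / (n3 * 3)) * n3.
    by field; rewrite gt_eqF.
  rewrite ler_pM2r//.
  have -> : 2 * h = eta / (n3 * 3) by rewrite /h; field; rewrite gt_eqF.
  have : 2 * e * T <= eta / (n3 * 3).
    rewrite /e.
    have -> : 2 * (eta / (n3 * 2 * (T + 1) * 3)) * T = eta / (n3 * 3) * (T / (T + 1)).
      by field; rewrite !gt_eqF// ltr_wpDl.
    apply: ler_piMr; first by rewrite ltW// divr_gt0// mulr_gt0.
    by rewrite ler_pdivrMr ?ltr_wpDl// mul1r lerDl.
  by move=> h4; apply: lerB => //; apply: le_trans j12; rewrite lerD2l lerN2.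
have hcS := ler_wpM2r S0 hc.
have E1 : (j1 - h) * (n3 * S + B) - (j2 + h) * (n3 * S + B + X) - BF = (j1 - j2 - 2 * h) * n3 * S + K0.
  by rewrite /K0; ring.
have E2 : (n3 * J - eta) * S = (n3 * J - eta * 2 / 3) * S - eta / 3 * S by field.
apply: le_trans hK; rewrite E2; apply: le_trans (_ : (j1 - j2 - 2 * h) * n3 * S + K0 <= _).
  exact: lerD.
rewrite -E1; apply: lerB => //; exact: lerB.
Qed.

End lower_bound.

(** * Second-order expansions and local structure of the approximating sets *)

Section calculus.
Context {R : realType}.

Lemma derivable_line d (F : 'rV[R]_d -> R) (x v : 'rV[R]_d) (t : R) :
  derivable F (x + t *: v) v ->
  is_derive t (1 : R) (fun t : R => F (x + t *: v)) ('D_v F (x + t *: v)).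
Proof.
move=> dF.
have E : (fun h : R => h^-1 *: (((fun t : R => F (x + t *: v)) \o shift t) (h *: (1 : R)) - F (x + t *: v))) =
    (fun h : R => h^-1 *: ((F \o shift (x + t *: v)) (h *: v) - F (x + t *: v))).
  apply/funext => h; rewrite /=; congr (_ *: (F _ - _)).
  by rewrite [h%:A]mulr1 scalerDl addrCA.
by apply: DeriveDef; rewrite /derivable /derive E.
Qed.

Variable d : nat.
Implicit Types (F : 'rV[R]_d -> R) (x y v h : 'rV[R]_d).

Lemma ler_eunorm_coord x y : (forall i, `|x ord0 i| <= `|y ord0 i|) -> eunorm x <= eunorm y.
Proof.
move=> xy; rewrite /eunorm ler_wsqrtr// /edot; apply: ler_sum => i _.
by rewrite -!expr2 -[leLHS]real_normK ?num_real// -[leRHS]real_normK ?num_real// lerXn2r// nnegrE.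
Qed.

Definition C1 F := forall i, (forall x, derivable F x (ebase i)) /\ continuous (fun x => 'D_(ebase i) F x).

Lemma MVT01 (f df : R -> R) : (forall t : R, is_derive t (1 : R) f (df t)) ->
  exists2 c, 0 < c < 1 & f 1 - f 0 = df c.
Proof.
move=> fd; have cf : {within `[0, 1], continuous f}.
  by apply: derivable_within_continuous => t _; have [] := fd t.
have [c c01 ->] := MVT ltr01 (fun t _ => fd t) cf.
by exists c; [move: c01; rewrite in_itv | rewrite subr0 mulr1].
Qed.

(** Move one coordinate at a time and apply the mean value theorem on each segment: only partial
    derivatives are at hand. The intermediate points deviate from [x] by coordinates no larger than
    those of [h]. *)
Lemma C1_increment F : C1 F -> forall x h, exists xi : 'I_d -> 'rV[R]_d,
  (forall i, eunorm (xi i - x) <= eunorm h) /\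
  F (x + h) - F x = \sum_i h ord0 i * 'D_(ebase i) F (xi i).
Proof.
move=> cF x h.
pose P (k : nat) : 'rV[R]_d := x + \row_j (if (j < k)%N then h ord0 j else 0).
have step (i : 'I_d) : exists xi : 'rV[R]_d, eunorm (xi - x) <= eunorm h /\
    F (P i.+1) - F (P i) = h ord0 i * 'D_(ebase i) F xi.
  pose phi t := F (P i + t *: ebase i).
  have dphi (t : R) : is_derive t (1 : R) (fun t => phi (h ord0 i * t)) ('D_(ebase i) F (P i + (h ord0 i * t) *: ebase i) * h ord0 i).
    apply: (@is_derive1_comp _ phi (fun t => h ord0 i * t)).
      by apply: derivable_line; have [] := cF i.
    by apply: is_derive_eq; rewrite /GRing.scale/= mulr1.
  have [c /andP[c0 c1] E] := MVT01 dphi.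
  exists (P i + (h ord0 i * c) *: ebase i); split; last first.
    rewrite mulrC -E /phi mulr1 mulr0 scale0r addr0; congr (F _ - _).
    rewrite /P -addrA; congr (_ + _); apply/rowP => j; rewrite !mxE ltnS.
    have [<-|ij] := eqVneq i j; first by rewrite leqnn ltnn add0r mulr1.
    by rewrite mulr0 addr0 leq_eqVlt (_ : (j == i :> nat) = false)//; apply/negbTE; rewrite eq_sym.
  have -> : P i + (h ord0 i * c) *: ebase i - x = \row_j (if (j < i)%N then h ord0 j else 0) + (h ord0 i * c) *: ebase i.
    by rewrite /P addrAC [x + _]addrC addrK.
  apply: ler_eunorm_coord => j; rewrite !mxE.
  have [->|ij] := eqVneq i j.
    by rewrite ltnn add0r mulr1 normrM ler_piMr// gtr0_norm// ltW.
  by rewrite mulr0 addr0; case: ifP => // _; rewrite normr0.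
have [xi hxi] := choice step.
exists xi; split; first by move=> i; have [] := hxi i.
have Pd : P d = x + h.
  by congr (_ + _); apply/rowP => j; rewrite mxE ltn_ord.
have P0 : P 0%N = x by rewrite /P [X in _ + X](_ : _ = 0) ?addr0//; apply/rowP => j; rewrite !mxE.
rewrite -Pd -[in F x]P0 -(telescope_sumr (fun k => F (P k)) (leq0n d)) big_mkord.
by apply: eq_bigr => i _; have [] := hxi i.
Qed.

Lemma C1_econt F i : C1 F -> forall x, econt (fun x => 'D_(ebase i) F x) x.
Proof. by move=> cF x; apply/econtP; have [_] := cF i; apply. Qed.

Lemma econt_unif (I : finType) (f : I -> 'rV[R]_d -> R) x : (forall i, econt (f i) x) ->
  forall e, 0 < e -> exists2 r, 0 < r & forall i y, eunorm (y - x) <= r -> `|f i y - f i x| < e.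
Proof.
move=> cf e e0; have /choice[r hr] : forall i, exists r, 0 < r /\ forall y, eunorm (y - x) <= r -> `|f i y - f i x| < e.
  by move=> i; have [r r0 h] := cf i e e0; exists r.
exists (\big[Num.min/1]_i r i); first by apply: lt_bigmin => // i _; have [] := hr i.
move=> i y h; have [_] := hr i; apply; apply: le_trans h _; exact: bigmin_le_cond.
Qed.

(** Continuous partial derivatives give derivatives in every direction. This links [isC2], stated
    along the basis, to the tangential and second directional derivatives of the theorem. *)
Lemma C1_is_derive F : C1 F -> forall x v,
  is_derive x v F (\sum_i v ord0 i * 'D_(ebase i) F x).
Proof.
move=> cF x v; set L := \sum_i _.
have cv : h^-1 *: ((F \o shift x) (h *: v) - F x) @[h --> (0 : R)^'] --> L.
  apply/cvgrPdist_le => e e0.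
  pose c := \sum_i `|v ord0 i|.
  have c0 : 0 <= c by apply: sumr_ge0.
  have ec : 0 < e / (c + 1) by rewrite divr_gt0// ltr_wpDl.
  have [r r0 hr] := econt_unif (fun i => C1_econt i cF x) ec.
  have rv : 0 < r / (eunorm v + 1) by rewrite divr_gt0// ltr_wpDl// eunorm_ge0.
  near=> t.
  have t0 : t != 0 by near: t; exact: nbhs_dnbhs_neq.
  have tr : `|t| <= r / (eunorm v + 1).
    by near: t; apply: dnbhs0_le.
  have [xi [hxi E]] := C1_increment cF x (t *: v).
  rewrite /= [t *: v + x]addrC E /L /GRing.scale/= mulr_sumr -sumrB.
  apply: le_trans (ler_norm_sum _ _ _) _.
  apply: le_trans (_ : \sum_i `|v ord0 i| * (e / (c + 1)) <= _).
    apply: ler_sum => i _; rewrite !mxE mulrA mulrA mulVf// mul1r -mulrBr normrM ler_wpM2l//.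
    rewrite distrC ltW//; apply: hr; apply: le_trans (hxi i) _; rewrite eunormZ.
    apply: le_trans (ler_wpM2r (eunorm_ge0 _) tr) _.
    rewrite -mulrA [_^-1 * _]mulrC; apply: ler_piMr; first exact: ltW.
    by rewrite ler_pdivrMr ?ltr_wpDl ?eunorm_ge0// mul1r lerDl.
  rewrite -mulr_suml -/c mulrCA; apply: ler_piMr; first exact: ltW.
  by rewrite ler_pdivrMr ?ltr_wpDl// mul1r lerDl.
apply: DeriveDef; first by apply/cvg_ex; exists L.
exact: cvg_lim.
Unshelve. all: by end_near.
Qed.

Lemma isC2_C1 F : isC2 F -> C1 F.
Proof. by move=> [_ h] i; have [a [b _]] := h i. Qed.

Lemma isC2_C1' F i : isC2 F -> C1 (fun x => 'D_(ebase i) F x).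
Proof. by move=> [_ h] j; have [_ [_ k]] := h i; exact: k. Qed.

Definition hess F y (u : 'rV[R]_d) : R :=
  \sum_i \sum_j u ord0 i * (u ord0 j * 'D_(ebase j) (fun x => 'D_(ebase i) F x) y).

Lemma isC2_derive2 F y u : isC2 F ->
  is_derive y u (fun x => 'D_u F x) (hess F y u).
Proof.
move=> cF.
have -> : (fun x => 'D_u F x) = \sum_i (fun x => u ord0 i *: 'D_(ebase i) F x).
  apply/funext => x; rewrite fct_sumE; have [_ ->] := C1_is_derive (isC2_C1 cF) x u.
  by [].
rewrite /hess; apply: is_derive_sum => i; rewrite -mulr_sumr.
have H := C1_is_derive (isC2_C1' i cF) y u.
exact: is_deriveZ.
Qed.

(** Restriction to the segment, followed by the Lagrange form of the remainder in one variable. *)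
Lemma taylor2 F : isC2 F -> forall y u, exists2 c, 0 <= c <= 1 &
  F (y + u) = F y + \sum_i u ord0 i * 'D_(ebase i) F y + hess F (y + c *: u) u / 2.
Proof.
move=> cF y u.
pose phi t := F (y + t *: u); pose phi1 t := 'D_u F (y + t *: u).
pose phi2 t := hess F (y + t *: u) u.
have d1 (t : R) : is_derive t (1 : R) phi (phi1 t).
  by apply: derivable_line; have [] := C1_is_derive (isC2_C1 cF) (y + t *: u) u.
have d2 (t : R) : is_derive t (1 : R) phi1 (phi2 t).
  have [h1 h2] := isC2_derive2 (y + t *: u) u cF.
  have := @derivable_line d (fun x => 'D_u F x) y u t h1; rewrite h2; apply.
(* With this [K] the auxiliary function below vanishes at 0 and at 1. Its derivative vanishes at
   some [c1], and a second use of the mean value theorem identifies 2 K as a second derivative. *)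
pose K := phi 1 - phi 0 - phi1 0.
have dA (t : R) : is_derive t (1 : R) (fun t => phi t - phi 0 - t * phi1 0 - K * t ^+ 2) (phi1 t - phi1 0 - 2 * K * t).
  have H := is_derive_expn 1 t.
  by apply: is_derive_eq; rewrite /GRing.scale/=; ring.
have [c1 /andP[c1_gt0 c1_lt1] E1] := MVT01 dA.
have E1' : phi1 c1 - phi1 0 = 2 * K * c1.
  apply/eqP; rewrite -subr_eq0 -E1; apply/eqP; rewrite /K; ring.
have cf : {within `[0, c1], continuous phi1}.
  by apply: derivable_within_continuous => t _; have [] := d2 t.
have [c2 c2i E2] := MVT c1_gt0 (fun t _ => d2 t) cf.
move: c2i; rewrite in_itv/= => /andP[c2_gt0 c2_lt].
have K2 : phi2 c2 = 2 * K.
  by apply: (mulIf (lt0r_neq0 c1_gt0)); rewrite -E1' E2 subr0.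
exists c2; first by rewrite ltW//= ltW// (lt_trans c2_lt).
rewrite -/(phi2 c2) K2 mulrC mulKf ?pnatr_eq0// /K /phi scale1r scale0r addr0.
have -> : phi1 0 = \sum_i u ord0 i * 'D_(ebase i) F y.
  by rewrite /phi1 scale0r addr0; have [_ ->] := C1_is_derive (isC2_C1 cF) y u.
by rewrite addrC; ring.
Qed.

Lemma isC2_coord (Phi : 'rV[R]_d -> 'rV[R]_d) k : isC2 Phi -> isC2 (fun x => Phi x ord0 k) /\
  (forall i x, 'D_(ebase i) (fun x => Phi x ord0 k) x = ('D_(ebase i) Phi x) ord0 k) /\
  (forall i j x, 'D_(ebase j) (fun x => 'D_(ebase i) (fun x => Phi x ord0 k) x) x =
     ('D_(ebase j) (fun x => 'D_(ebase i) Phi x) x) ord0 k).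
Proof.
move=> [cP hP].
have cc (f : 'rV[R]_d -> 'rV[R]_d) : continuous f -> continuous (fun x => f x ord0 k).
  move=> cf x; apply: (@continuous_comp _ _ _ f (fun y : 'rV[R]_d => y ord0 k)); first exact: cf.
  exact: coord_continuous.
have D1 i x : 'D_(ebase i) (fun x => Phi x ord0 k) x = ('D_(ebase i) Phi x) ord0 k.
  by have [h _] := hP i; rewrite derive_mx// mxE.
have D1' i : (fun x => 'D_(ebase i) (fun x => Phi x ord0 k) x) = (fun x => ('D_(ebase i) Phi x) ord0 k).
  by apply/funext => x; exact: D1.
have D2 i j x : 'D_(ebase j) (fun x => 'D_(ebase i) (fun x => Phi x ord0 k) x) x =
     ('D_(ebase j) (fun x => 'D_(ebase i) Phi x) x) ord0 k.
  by rewrite D1'; have [_ [_ /(_ j)[h _]]] := hP i; rewrite [in RHS]derive_mx// mxE.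
split; last by split.
split; first exact: cc.
move=> i; have [h1 [h2 h3]] := hP i; split.
  by move=> x; exact: ((derivable_mxP Phi x (ebase i)).1 (h1 x)).
split; first by rewrite D1'; exact: cc.
move=> j; have [h4 h5] := h3 j; rewrite D1'; split.
  by move=> x; exact: ((derivable_mxP (fun y => 'D_(ebase i) Phi y) x (ebase j)).1 (h4 x)).
have -> : (fun x => 'D_(ebase j) (fun x0 => ('D_(ebase i) Phi x0) ord0 k) x) = (fun x => ('D_(ebase j) (fun y => 'D_(ebase i) Phi y) x) ord0 k).
  by apply/funext => x; rewrite -D2 D1'.
exact: cc.
Qed.

End calculus.

Section hessian_bounds.
Context {R : realType} {d : nat}.
Local Notation D := (d%:R : R).
Implicit Types (F : 'rV[R]_d -> R) (x y u a b : 'rV[R]_d).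

Local Notation dd F i j y := ('D_(ebase j) (fun x => 'D_(ebase i) F x) y).

Lemma ler_double_sum (f : 'I_d -> 'I_d -> R) c : (forall i j, `|f i j| <= c) ->
  `|\sum_i \sum_j f i j| <= D ^+ 2 * c.
Proof.
move=> fc; apply: le_trans (ler_norm_sum _ _ _) _.
apply: le_trans (_ : \sum_(i < d) D * c <= _); last first.
  by rewrite sumr_const card_ord -[leLHS]mulr_natl mulrA.
apply: ler_sum => i _; apply: le_trans (ler_norm_sum _ _ _) _.
apply: le_trans (_ : \sum_(i < d) c <= _); first by apply: ler_sum.
by rewrite sumr_const card_ord -[leLHS]mulr_natl.
Qed.

Lemma hess_bound F y u c : (forall i j, `|dd F i j y| <= c) ->
  `|hess F y u| <= D ^+ 2 * (c * eunorm u ^+ 2).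
Proof.
move=> Fc; apply: ler_double_sum => i j.
rewrite !normrM mulrA mulrC ler_pM ?mulr_ge0// expr2 ler_pM//; exact: ler_coord_eunorm.
Qed.

Lemma hess_diff_point F y y' u c : (forall i j, `|dd F i j y - dd F i j y'| <= c) ->
  `|hess F y u - hess F y' u| <= D ^+ 2 * (c * eunorm u ^+ 2).
Proof.
move=> Fc; rewrite /hess -sumrB; under eq_bigr do rewrite -sumrB.
apply: ler_double_sum => i j.
rewrite -!mulrBr !normrM mulrA mulrC ler_pM ?mulr_ge0// expr2 ler_pM//; exact: ler_coord_eunorm.
Qed.

Lemma hess_diff_vec F y a b c : (forall i j, `|dd F i j y| <= c) ->
  `|hess F y a - hess F y b| <= D ^+ 2 * (c * (eunorm (a - b) * (eunorm a + eunorm b))).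
Proof.
move=> Fc; rewrite /hess -sumrB; under eq_bigr do rewrite -sumrB.
apply: ler_double_sum => i j.
set X := dd F i j y.
have -> : a ord0 i * (a ord0 j * X) - b ord0 i * (b ord0 j * X) =
    X * ((a - b) ord0 i * a ord0 j + (a - b) ord0 j * b ord0 i).
  by rewrite !mxE; ring.
rewrite normrM; apply: ler_pM => //; first exact: Fc.
rewrite mulrDr; apply: le_trans (ler_normD _ _) _.
by rewrite !normrM; apply: lerD; apply: ler_pM => //; exact: ler_coord_eunorm.
Qed.

End hessian_bounds.

(** * Maps close to the identity in C^2 *)

Section near_identity.
Context {R : realType} {d : nat}.
Local Notation D := (d%:R : R).
Variables (Phi : 'rV[R]_d -> 'rV[R]_d) (ka : R).
Hypothesis C2Phi : isC2 Phi.
Hypothesis Phi1 : forall x i, eunorm ('D_(ebase i) Phi x - ebase i) <= ka.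
Hypothesis Phi2 : forall x i j, eunorm ('D_(ebase j) (fun y => 'D_(ebase i) Phi y) x) <= ka.

Lemma ler_eunorm_coords (x : 'rV[R]_d) c : (forall i, `|x ord0 i| <= c) -> eunorm x <= D * c.
Proof.
move=> xc; apply: le_trans (ler_eunorm_sum _) _.
apply: le_trans (_ : \sum_(i < d) c <= _); first by apply: ler_sum.
by rewrite sumr_const card_ord -[leLHS]mulr_natl.
Qed.

Lemma near_id_increment x u : eunorm (Phi (x + u) - Phi x - u) <= D ^+ 2 * ka * eunorm u.
Proof.
rewrite expr2 -!mulrA; apply: ler_eunorm_coords => k.
have [cF [D1 _]] := isC2_coord k C2Phi.
have [xi [_ E]] := C1_increment (isC2_C1 cF) x u.
have -> : (Phi (x + u) - Phi x - u) ord0 k = \sum_i u ord0 i * ('D_(ebase i) Phi (xi i) - ebase i) ord0 k.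
  rewrite !mxE E; under [in RHS]eq_bigr do rewrite !mxE mulrBr.
  rewrite sumrB; congr (_ - _); first by apply: eq_bigr => i _; rewrite D1.
  rewrite (bigD1 k)//= eqxx mulr1 big1 ?addr0// => i /negbTE ->; by rewrite mulr0.
apply: le_trans (ler_norm_sum _ _ _) _.
apply: le_trans (_ : \sum_(i < d) ka * eunorm u <= _); last first.
  by rewrite sumr_const card_ord -[leLHS]mulr_natl.
apply: ler_sum => i _; rewrite normrM mulrC; apply: ler_pM => //; last exact: ler_coord_eunorm.
exact: le_trans (ler_coord_eunorm _ _) (Phi1 _ _).
Qed.

Definition jacobian (x : 'rV[R]_d) : 'M[R]_d := \matrix_i 'D_(ebase i) Phi x.

Lemma near_id_taylor x u :
  eunorm (Phi (x + u) - Phi x - u *m jacobian x) <= D ^+ 3 * ka * eunorm u ^+ 2.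
Proof.
rewrite exprS -!mulrA; apply: ler_eunorm_coords => k.
have [cF [D1 D2]] := isC2_coord k C2Phi.
have [c _ E] := taylor2 cF x u.
have -> : (Phi (x + u) - Phi x - u *m jacobian x) ord0 k = hess (fun x => Phi x ord0 k) (x + c *: u) u / 2.
  rewrite !mxE E.
  have -> : \sum_j u ord0 j * jacobian x j k = \sum_i u ord0 i * 'D_(ebase i) (fun x0 => Phi x0 ord0 k) x.
    apply: eq_bigr => i _; rewrite D1; congr (_ * _).
    by have := congr1 (fun v : 'rV[R]_d => v ord0 k) (rowK (fun i => 'D_(ebase i) Phi x) i); rewrite mxE.
  ring.
rewrite normrM [`|2^-1|]ger0_norm//; apply: le_trans (_ : `|hess (fun x => Phi x ord0 k) (x + c *: u) u| <= _).
  by apply: ler_piMr => //; lra.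
rewrite mulrA -expr2; apply: hess_bound => i j; rewrite D2.
exact: le_trans (ler_coord_eunorm _ _) (Phi2 _ _ _).
Qed.

(** The transposed Jacobian differs from the identity by at most 1/2 in operator norm, so it is
    injective, hence invertible. *)
Lemma jacobian_solve x (b : 'rV[R]_d) : D * ka <= 1 / 2 ->
  exists2 l, l *m (jacobian x)^T = b & eunorm (l - b) <= D * ka * eunorm l.
Proof.
move=> Dk.
have B (v : 'rV[R]_d) : eunorm (v - v *m (jacobian x)^T) <= D * ka * eunorm v.
  rewrite -mulrA; apply: ler_eunorm_coords => i.
  have -> : (v - v *m (jacobian x)^T) ord0 i = - edot v ('D_(ebase i) Phi x - ebase i).
    rewrite edotBr opprB !mxE; congr (_ - _).
      rewrite /edot (bigD1 i)//= mxE eqxx mulr1 big1 ?addr0// => j ji.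
      by rewrite mxE eq_sym (negbTE ji) mulr0.
    apply: eq_bigr => j _; rewrite mxE; congr (_ * _).
    by have := congr1 (fun v : 'rV[R]_d => v ord0 j) (rowK (fun i => 'D_(ebase i) Phi x) i); rewrite mxE.
  rewrite normrN mulrC; apply: le_trans (CauchySchwarz_eu _ _) _.
  by rewrite ler_wpM2l ?eunorm_ge0.
have uA : (jacobian x)^T \in unitmx.
  rewrite -row_free_unit; apply: inj_row_free => v v0.
  have := B v; rewrite v0 subr0 => h.
  have n0 := eunorm_ge0 v.
  apply: eunorm_eq0; apply/eqP; rewrite eq_le n0 andbT.
  have := ler_wpM2r n0 Dk; lra.
exists (b *m invmx (jacobian x)^T); first by rewrite mulmxKV.
by have := B (b *m invmx (jacobian x)^T); rewrite mulmxKV.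
Qed.

End near_identity.

(** * Second-order expansion of the defining function near the common boundary point *)

Section local_structure.
Context {R : realType} {n : nat}.
Local Notation d := n.+1.
Local Notation D := (d%:R : R).
Variables (E : set 'rV[R]_d) (Er : R -> set 'rV[R]_d) (x nu : 'rV[R]_d) (rho : R) (f : 'rV[R]_d -> R).
Hypothesis nu1 : eunorm nu = 1.
Hypothesis rho0 : 0 < rho.
Hypothesis C2f : isC2 f.
Hypothesis f0 : f 0 = 0.
Hypothesis df0 : forall z, edot z nu = 0 -> derive f 0 z = 0.
Hypothesis subE : local_subgraph E x nu rho f.
Local Notation P := (projperp nu).

Lemma projperpD u v : P (u + v) = P u + P v.
Proof. by rewrite /projperp edotDl scalerDl opprD addrACA. Qed.

Lemma projperpB u v : P (u - v) = P u - P v.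
Proof. by rewrite projperpD /projperp edotNl scaleNr -opprD. Qed.

Lemma edot_projperp_nu u : edot (P u) nu = 0.
Proof. by rewrite /projperp edotBl edotZl -eunormE nu1 expr1n mulr1 subrr. Qed.

Lemma edot_projperp u v : edot (P u) v = edot u (P v).
Proof. by rewrite /projperp edotBl edotBr edotZl edotZr (edotC nu v) mulrC. Qed.

Lemma eunorm_projperp u : eunorm (P u) <= eunorm u.
Proof.
rewrite -(@ler_pXn2r _ 2)// ?nnegrE ?eunorm_ge0// !eunormE.
have -> : edot (P u) (P u) = edot u u - edot u nu ^+ 2.
  rewrite [X in edot X _]/projperp edotBl edotZl (edotC nu) edot_projperp_nu mulr0 subr0.
  by rewrite /projperp edotBr edotZr expr2.
by rewrite gerBl sqr_ge0.
Qed.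

Definition grad y : 'rV[R]_d := \row_i 'D_(ebase i) f y.

Lemma sum_grad (u y : 'rV[R]_d) : \sum_i u ord0 i * 'D_(ebase i) f y = edot u (grad y).
Proof. by apply: eq_bigr => i _; rewrite mxE. Qed.

(** Only tangential derivatives are known to vanish at 0, so it is the projected gradient that is
    zero. *)
Lemma projperp_grad0 : P (grad 0) = 0.
Proof.
apply: edot_eq0; rewrite -[X in edot _ X]/(P (grad 0)) -edot_projperp.
have h : 'D_(P (P (grad 0))) f 0 = 0 by apply: df0; exact: edot_projperp_nu.
have [_ ] := C1_is_derive (isC2_C1 C2f) 0 (P (P (grad 0))); rewrite h sum_grad => /esym h2.
exact: h2.
Qed.

Definition curv (w : 'rV[R]_d) : R := - (hess f 0 (P w) / 2).

(** A defining function of [E] near [x]: nonnegative on [E], negative outside. *)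
Definition defect (y : 'rV[R]_d) : R := f (P (y - x)) - edot (y - x) nu.

(** The expansion is made at the preimage y of x, with displacement u there and w in the image. The
    linear term is -l.(u J) by the choice of [l], and u J is w up to a second-order error. The
    Hessian at a nearby point is compared with that at 0, giving [e1]; then Pu is compared with Pw,
    giving [H]. All errors are expressed through |w| by |u| <= 2 |w|. *)
Lemma defect_increment (y u : 'rV[R]_d) (Phi : 'rV[R]_d -> 'rV[R]_d) (ka e1 H : R) (l w : 'rV[R]_d) :
  isC2 Phi ->
  (forall x i, eunorm ('D_(ebase i) Phi x - ebase i) <= ka) ->
  (forall x i j, eunorm ('D_(ebase j) (fun y => 'D_(ebase i) Phi y) x) <= ka) ->
  0 <= ka -> D ^+ 2 * ka <= 1 / 2 ->
  Phi y = x -> defect y = 0 -> Phi (y + u) = x + w ->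
  l *m (jacobian Phi y)^T = nu - P (grad (P (y - x))) ->
  (forall c i j, 0 <= c <= 1 ->
     `|'D_(ebase j) (fun x => 'D_(ebase i) f x) (P (y - x) + c *: P u) - 'D_(ebase j) (fun x => 'D_(ebase i) f x) 0| <= e1) ->
  (forall i j, `|'D_(ebase j) (fun x => 'D_(ebase i) f x) 0| <= H) ->
  `|defect (y + u) + edot l w + curv w| <=
    (4 * eunorm l * D ^+ 3 * ka + 4 * D ^+ 2 * e1 + 12 * D ^+ 4 * H * ka) * eunorm w ^+ 2.
Proof.
move=> C2P P1 P2 ka0 kaD Py Dy Pyu hl he1 hH.
have I1 := near_id_increment C2P P1 y u; rewrite Pyu Py [x + w]addrC addrK in I1.
have n0 := eunorm_ge0 u; have m0 := eunorm_ge0 w.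
have I1' : eunorm (w - u) <= 1 / 2 * eunorm u by apply: le_trans I1 _; exact: ler_wpM2r.
have uw : eunorm u <= 2 * eunorm w.
  have := ler_eunormD w (u - w); rewrite addrC subrK -(eunormN (u - w)) opprB; lra.
have u2 : eunorm u ^+ 2 <= 4 * eunorm w ^+ 2.
  have -> : 4 * eunorm w ^+ 2 = (2 * eunorm w) ^+ 2 by ring.
  by rewrite lerXn2r// nnegrE mulr_ge0.
have I2 := near_id_taylor C2P P2 y u; rewrite Pyu Py [x + w]addrC addrK in I2.
set J := jacobian Phi y in hl I2.
have [c c01 T] := taylor2 C2f (P (y - x)) (P u).
have E1 : defect (y + u) = edot (P u) (grad (P (y - x))) + hess f (P (y - x) + c *: P u) (P u) / 2 - edot u nu.
  rewrite -[LHS]subr0 -Dy /defect (addrAC y u) (projperpD (y - x) u) T sum_grad (edotDl (y - x) u nu); ring.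
have E2 : edot (P u) (grad (P (y - x))) - edot u nu = - edot l (u *m J).
  have -> : edot l (u *m J) = edot (l *m J^T) u by rewrite !edot_mxE trmx_mul mulmxA.
  by rewrite hl edotBl edot_projperp (edotC nu) (edotC _ u) opprB.
have -> : defect (y + u) + edot l w + curv w = edot l (w - u *m J) +
    (hess f (P (y - x) + c *: P u) (P u) - hess f 0 (P u)) / 2 + (hess f 0 (P u) - hess f 0 (P w)) / 2.
  rewrite E1 /curv edotBr; move: E2; set A := edot (P u) _ => E2.
  have -> : A = edot u nu - edot l (u *m J) by rewrite -E2; ring.
  by move: (hess f 0 (P w)) (hess f 0 (P u)) (hess f (_ + _) (P u)) (edot u nu) (edot l (u *m J))
    (edot l w) => b1 b2 b3 b4 b5 b6; ring.
have D0 : 0 <= D by [].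
have b1 : `|edot l (w - u *m J)| <= 4 * eunorm l * D ^+ 3 * ka * eunorm w ^+ 2.
  apply: le_trans (CauchySchwarz_eu _ _) _.
  have -> : 4 * eunorm l * D ^+ 3 * ka * eunorm w ^+ 2 = eunorm l * (D ^+ 3 * ka * (4 * eunorm w ^+ 2)) by ring.
  apply: ler_wpM2l; first exact: eunorm_ge0.
  by apply: le_trans I2 _; apply: ler_wpM2l => //; rewrite mulr_ge0// exprn_ge0.
have half (a b : R) : `|a| <= b -> `|a / 2| <= b.
  move=> ab; rewrite normrM [`|2^-1|]ger0_norm//; apply: le_trans ab.
  by apply: ler_piMr => //; lra.
have e10 : 0 <= e1 by apply: le_trans (he1 0 ord0 ord0 _) => //; rewrite lexx ler01.
have H0 : 0 <= H by apply: le_trans (hH ord0 ord0).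
have pu : eunorm (P u) ^+ 2 <= 4 * eunorm w ^+ 2.
  by apply: le_trans u2; rewrite lerXn2r// ?nnegrE ?eunorm_ge0// eunorm_projperp.
have b2 : `|(hess f (P (y - x) + c *: P u) (P u) - hess f 0 (P u)) / 2| <= 4 * D ^+ 2 * e1 * eunorm w ^+ 2.
  apply: half; apply: le_trans (hess_diff_point _ (fun i j => he1 c i j c01)) _.
  have -> : 4 * D ^+ 2 * e1 * eunorm w ^+ 2 = D ^+ 2 * (e1 * (4 * eunorm w ^+ 2)) by ring.
  by rewrite ler_wpM2l ?exprn_ge0// ler_wpM2l.
have b3 : `|(hess f 0 (P u) - hess f 0 (P w)) / 2| <= 12 * D ^+ 4 * H * ka * eunorm w ^+ 2.
  apply: half; apply: le_trans (hess_diff_vec _ _ hH) _.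
  have -> : 12 * D ^+ 4 * H * ka * eunorm w ^+ 2 = D ^+ 2 * (H * (D ^+ 2 * ka * (2 * eunorm w) * (6 * eunorm w))) by ring.
  rewrite ler_wpM2l ?exprn_ge0// ler_wpM2l//.
  apply: ler_pM; rewrite ?eunorm_ge0 ?addr_ge0 ?eunorm_ge0//.
    rewrite -projperpB; apply: le_trans (eunorm_projperp _) _.
    rewrite -eunormN opprB; apply: le_trans I1 _.
    by rewrite ler_wpM2l// mulr_ge0// exprn_ge0.
  have := eunorm_projperp u; have := eunorm_projperp w; lra.
apply: le_trans (ler_normD _ _) _; rewrite [leRHS]mulrDl; apply: lerD => //.
by apply: le_trans (ler_normD _ _) _; rewrite [leRHS]mulrDl; apply: lerD.
Qed.

End local_structure.

Section level_sets.
Context {R : realType} {n : nat}.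
Local Notation d := n.+1.
Local Notation D := (d%:R : R).

Lemma ball_interior (S : set 'rV[R]_d) x t : 0 < t ->
  (forall y, eunorm (y - x) <= t -> S y) -> (interior S) x.
Proof.
move=> t0 h; rewrite /interior.
have : open_nbhs x [set y : 'rV[R]_d | eunorm (y - x) < t].
  by split; [exact: open_ball_eu | rewrite /= subrr eunorm0].
by move/open_nbhs_nbhs; apply: filterS => y /ltW; exact: h.
Qed.

Lemma class_frakC_closed (S : set 'rV[R]_d) : class_frakC S -> closed S.
Proof. by move=> [[U [_ ->]] _]; exact: closed_closure. Qed.

Lemma projperp_lipschitz (nu u v : 'rV[R]_d) : eunorm nu = 1 ->
  eunorm (projperp nu u - projperp nu v) <= eunorm (u - v).
Proof. by move=> nu1; rewrite -projperpB; exact: eunorm_projperp. Qed.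

Lemma defect_econt x nu (f : 'rV[R]_d -> R) y : eunorm nu = 1 -> isC2 f ->
  econt (defect x nu f) y.
Proof.
move=> nu1 [cf _]; apply: econtD.
  have /econtP cfy := cf (projperp nu (y - x)).
  move=> e e0; have [r r0 h] := cfy e e0; exists r => // z zy; apply: h.
  apply: le_trans (projperp_lipschitz _ _ nu1) _.
  by rewrite opprB addrA subrK.
move=> e e0; exists (e / 2); first by rewrite divr_gt0.
move=> z zy; rewrite -opprD normrN -edotBl opprB addrA subrK.
apply: le_lt_trans (CauchySchwarz_eu _ _) _; rewrite nu1 mulr1; lra.
Qed.

Lemma C2_econt_vec (Psi : 'rV[R]_d -> 'rV[R]_d) x : isC2 Psi ->
  forall e, 0 < e -> exists2 r, 0 < r & forall y, eunorm (y - x) <= r -> eunorm (Psi y - Psi x) <= e.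
Proof.
move=> cP e e0.
have D0 : 0 < e / D by rewrite divr_gt0// ltr0n.
have cK k : econt (fun y => Psi y ord0 k) x.
  by apply/econtP; have [[c _] _] := isC2_coord k cP; exact: c.
have [r r0 h] := econt_unif cK D0.
exists r => // y yx; have -> : e = D * (e / D) by rewrite mulrC divfK// pnatr_eq0.
by apply: ler_eunorm_coords => k; rewrite !mxE ltW//; exact: h.
Qed.

Variables (E : set 'rV[R]_d) (x nu : 'rV[R]_d) (rho : R) (f : 'rV[R]_d -> R).
Hypothesis nu1 : eunorm nu = 1.
Hypothesis C2f : isC2 f.
Hypothesis subE : local_subgraph E x nu rho f.

Lemma defect_mem y : eunorm (y - x) < rho -> E y <-> 0 <= defect x nu f y.
Proof. by move=> /subE ->; rewrite subr_ge0. Qed.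

(** The point y is in [E], as the image is closed. Were the defect positive, a neighbourhood of y
    would lie in [E], and by continuity of the inverse its image would contain a neighbourhood of
    [Phi y], which is a boundary point. *)
Lemma defect_zero (Phi Psi : 'rV[R]_d -> 'rV[R]_d) y : isC2 Psi ->
  cancel Phi Psi -> cancel Psi Phi -> eunorm (y - x) < rho ->
  bdry (Phi @` E) (Phi y) -> closed (Phi @` E) -> defect x nu f y = 0.
Proof.
move=> cPsi K1 K2 yx [clx nix] closedE.
have [y' Ey' Pyy'] : (Phi @` E) (Phi y) by exact: closure_sub_closed closedE _ _ clx.
have Ey : E y by rewrite -(K1 y) -Pyy' K1.
have /defect_mem dy := yx; apply/eqP; rewrite eq_le (dy.1 Ey) andbT leNgt; apply/negP => pos.
apply: nix.
have [r r0 h] := defect_econt x y nu1 C2f pos.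
have m0 : 0 < Num.min r ((rho - eunorm (y - x)) / 2).
  by rewrite lt_min r0 divr_gt0// subr_gt0.
have [t t0 ht] := C2_econt_vec (Phi y) cPsi m0.
apply: (ball_interior t0) => z /ht; rewrite K1 le_min => /andP[zr zrho].
exists (Psi z); last exact: K2.
apply/defect_mem.
  have := ler_eunormD (Psi z - y) (y - x); rewrite addrA subrK; lra.
have := h _ zr; rewrite ltr_norml => /andP[]; lra.
Qed.

End level_sets.

Section local_structure.
Context {R : realType} {n : nat}.
Local Notation d := n.+1.
Local Notation D := (d%:R : R).
Variables (E : set 'rV[R]_d) (Er : R -> set 'rV[R]_d) (x nu : 'rV[R]_d) (rho : R) (f : 'rV[R]_d -> R).
Hypothesis nu1 : eunorm nu = 1.
Hypothesis rho0 : 0 < rho.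
Hypothesis C2f : isC2 f.
Hypothesis f0 : f 0 = 0.
Hypothesis df0 : forall z, edot z nu = 0 -> derive f 0 z = 0.
Hypothesis subE : local_subgraph E x nu rho f.
Hypothesis clEr : forall r, 0 < r -> closed (Er r).
Hypothesis bdEr : forall r, 0 < r -> bdry (Er r) x.
Hypothesis cvE : conv_frakC Er E.
Local Notation P := (projperp nu).

(** Once [Phi r] is close enough to the identity, [defect_increment] applies at the preimage of [x],
    where the defect is zero because [x] is on the boundary of [Er r]. The sign of the defect
    decides membership. *)
Lemma local_structure e : 0 < e -> exists2 de, 0 < de & exists2 r0, 0 < r0 &
  forall r, 0 < r < r0 -> exists2 l, eunorm (l - nu) <= e &
    forall w, eunorm w <= de ->
      (Er r (x + w) -> edot l w + curv nu f w <= e * eunorm w ^+ 2) /\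
      (~ Er r (x + w) -> - (e * eunorm w ^+ 2) <= edot l w + curv nu f w).
Proof.
move=> e0; have [Phi [diffeo near_id]] := cvE.
have D1 : 1 <= D by rewrite ler1n.
have D0 : 0 < D by rewrite ltr0n.
pose hs (ij : 'I_d * 'I_d) y := 'D_(ebase ij.2) (fun x => 'D_(ebase ij.1) f x) y.
pose H := \sum_ij `|hs ij 0|.
have H0 : 0 <= H by apply: sumr_ge0.
have hH i j : `|hs (i, j) 0| <= H.
  by rewrite /H (bigD1 (i, j))//= lerDl; apply: sumr_ge0.
have e1_gt0 : 0 < e / (12 * D ^+ 2) by rewrite divr_gt0// mulr_gt0// exprn_gt0.
have [ij|r2 r2_gt0 h2] := econt_unif (f := hs) (x := 0) _ e1_gt0.
  exact: (C1_econt _ (isC2_C1' _ C2f)).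
have e2_gt0 : 0 < Num.min 1 (e / 2) / D by rewrite divr_gt0// lt_min ltr01 divr_gt0.
have [r1 r1_gt0 h1] := econt_unif (fun i => C1_econt i (isC2_C1 C2f) 0) e2_gt0.
pose rr := Num.min r1 (Num.min r2 rho).
have rr_gt0 : 0 < rr by rewrite !lt_min r1_gt0 r2_gt0.
have [rr1 rr2 rrr] : [/\ rr <= r1, rr <= r2 & rr <= rho] by rewrite !ge_min !lexx !orbT.
clearbody rr.
(* The first bound yields |u| <= 2 |w| and the invertibility of the Jacobian. The next two bring one
   error term each of [defect_increment] below e/3, given |l| <= 4; [H] may be zero, whence [H + 1].
   The last keeps the preimage of [x] well inside the chart. *)
pose ka := Num.min (1 / (2 * D ^+ 2)) (Num.min (e / (48 * D ^+ 3)) (Num.min (e / (36 * D ^+ 4 * (H + 1))) (rr / 4))).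
have ka_gt0 : 0 < ka.
  by rewrite !lt_min !divr_gt0// ?mulr_gt0 ?exprn_gt0// ltr_wpDl.
have [k1 k2 k3 k4] : [/\ ka <= 1 / (2 * D ^+ 2), ka <= e / (48 * D ^+ 3),
    ka <= e / (36 * D ^+ 4 * (H + 1)) & ka <= rr / 4] by rewrite !ge_min !lexx !orbT.
clearbody ka.
have DD m : D <= D ^+ m.+1 by rewrite exprS; apply: ler_peMr; [exact: ltW | exact: exprn_ege1].
have kD2 : D ^+ 2 * ka <= 1 / 2.
  by move: k1; rewrite ler_pdivlMr ?mulr_gt0 ?exprn_gt0//; lra.
have kD : D * ka <= 1 / 2.
  by apply: le_trans kD2; rewrite ler_wpM2r ?(ltW ka_gt0)//; exact: (DD 1%N).
have kD3 : 48 * (D ^+ 3 * ka) <= e.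
  by move: k2; rewrite ler_pdivlMr ?mulr_gt0 ?exprn_gt0//; lra.
have kDe : 48 * (D * ka) <= e.
  apply: le_trans kD3; rewrite ler_pM2l// ler_wpM2r ?(ltW ka_gt0)//; exact: (DD 2%N).
have kD4 : 36 * (D ^+ 4 * (H * ka)) <= e.
  move: k3; rewrite ler_pdivlMr; last by rewrite !mulr_gt0 ?exprn_gt0// ltr_wpDl.
  apply: le_trans; have -> : ka * (36 * D ^+ 4 * (H + 1)) = 36 * (D ^+ 4 * (H * ka)) + 36 * (D ^+ 4 * ka) by ring.
  by rewrite lerDl !mulr_ge0 ?exprn_ge0 ?ltW.
(* Then |u| <= rr/4, and y is within rr/4 of x, so y + u stays within rr/2. *)
exists (rr / 8); first by rewrite divr_gt0.
have [r0 [r0_gt0 hr0]] := near_id ka ka_gt0.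
exists r0 => // r /andP[r_gt0 rr0].
have [[C2P [Psi [C2Psi [K1 K2]]]] PE] := diffeo r r_gt0.
have hP := hr0 r r_gt0 rr0; move: (Phi r) C2P K1 K2 PE hP => F C2F K1 K2 PE hF.
have F0 z : eunorm (F z - z) <= ka by have [] := hF z.
have F1 z i : eunorm ('D_(ebase i) F z - ebase i) <= ka by have [_ []] := hF z.
have F2 z i j : eunorm ('D_(ebase j) (fun y => 'D_(ebase i) F y) z) <= ka by have [_ [_]] := hF z.
(* The diffeomorphism need not fix [x]: the boundary of [E] passes through [y], not through a known
   fixed point. *)
pose y := Psi x; have Fy : F y = x by exact: K2.
have yx : eunorm (y - x) <= ka by rewrite -[X in _ - X]Fy -eunormN opprB.
have yrho : eunorm (y - x) < rho by lra.
have dy : defect x nu f y = 0.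
  apply: (defect_zero nu1 C2f subE C2Psi K1 K2 yrho); rewrite PE ?Fy; [exact: bdEr | exact: clEr].
have z0 : eunorm (P (y - x)) <= ka by apply: le_trans (eunorm_projperp nu1 _) yx.
have g0 : eunorm (P (grad f (P (y - x)))) <= Num.min 1 (e / 2).
  rewrite -[P (grad f _)]subr0 -(projperp_grad0 nu1 C2f df0) -projperpB.
  apply: le_trans (eunorm_projperp nu1 _) _.
  have -> : Num.min 1 (e / 2) = D * (Num.min 1 (e / 2) / D) by field; rewrite gt_eqF.
  apply: ler_eunorm_coords => i; rewrite !mxE ltW//; apply: h1; rewrite subr0; lra.
move: g0; rewrite le_min => /andP[g01 g0e].
have [l hl lb] := jacobian_solve F1 y (nu - P (grad f (P (y - x)))) kD.
have ln := eunorm_ge0 l.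
have l4 : eunorm l <= 4.
  have b2 : eunorm (nu - P (grad f (P (y - x)))) <= 2.
    by apply: le_trans (ler_eunormD _ _) _; rewrite eunormN nu1; lra.
  have := ler_eunormD (l - (nu - P (grad f (P (y - x))))) (nu - P (grad f (P (y - x)))).
  rewrite subrK; have := ler_wpM2r ln kD; lra.
exists l.
  have := ler_eunormD (l - (nu - P (grad f (P (y - x))))) ((nu - P (grad f (P (y - x)))) - nu).
  rewrite addrA subrK addrAC subrr add0r eunormN.
  have : D * ka * eunorm l <= D * ka * 4 by rewrite ler_wpM2l// mulr_ge0 ?ltW.
  lra.
move=> w wd; pose u := Psi (x + w) - y.
have yu : y + u = Psi (x + w) by rewrite addrC subrK.
have Fyu : F (y + u) = x + w by rewrite yu K2.
have uw : eunorm u <= 2 * eunorm w.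
  have := near_id_increment C2F F1 y u; rewrite Fyu Fy [x + w]addrC addrK.
  have := ler_eunormD w (u - w); rewrite [w + _]addrC subrK -(eunormN (u - w)) opprB.
  have := ler_wpM2r (eunorm_ge0 u) kD2; lra.
have yurho : eunorm (y + u - x) < rho.
  by rewrite addrAC; apply: le_lt_trans (ler_eunormD _ _) _; lra.
have mem : Er r (x + w) <-> 0 <= defect x nu f (y + u).
  rewrite -(defect_mem subE yurho) -PE; split.
    by move=> [Y EY FY]; rewrite yu -FY K1.
  by move=> EY; exists (y + u).
have := @defect_increment R n x nu f nu1 C2f y u F ka (e / (12 * D ^+ 2)) H l w C2F F1 F2 (ltW ka_gt0) kD2 Fy dy Fyu hl _ (fun i j => hH i j).
have -> : (4 * eunorm l * D ^+ 3 * ka + 4 * D ^+ 2 * (e / (12 * D ^+ 2)) + 12 * D ^+ 4 * H * ka) =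
   4 * (eunorm l * (D ^+ 3 * ka)) + e / 3 + 12 * (D ^+ 4 * (H * ka)).
  by field; rewrite gt_eqF.
move=> bound; have {}bound : `|defect x nu f (y + u) + edot l w + curv nu f w| <= e * eunorm w ^+ 2.
  apply: le_trans (bound _) _.
    move=> c i j /andP[c0 c1]; rewrite ltW//; apply: (h2 (i, j)); rewrite subr0.
    apply: le_trans (ler_eunormD _ _) _; rewrite eunormZ ger0_norm//.
    have pu : c * eunorm (P u) <= eunorm u.
      apply: le_trans (eunorm_projperp nu1 u); apply: ler_piMl => //; exact: eunorm_ge0.
    lra.
  rewrite ler_wpM2r ?sqr_ge0//.
  have : eunorm l * (D ^+ 3 * ka) <= 4 * (D ^+ 3 * ka).
    by rewrite ler_wpM2r// mulr_ge0 ?exprn_ge0 ?ltW.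
  lra.
move: bound; rewrite ler_norml => /andP[lo hi]; split.
  move=> /mem dp; lra.
move=> nE; have : defect x nu f (y + u) < 0 by rewrite ltNge; apply/negP => /mem.
lra.
Qed.

End local_structure.

(** * Angular integrals *)

Section radial.
Context {R : realType}.
Local Notation leb := (@lebesgue_measure R).

Lemma eunorm_normalize n (v : 'rV[R]_n) : 0 < eunorm v -> eunorm ((eunorm v)^-1 *: v) = 1.
Proof. by move=> v0; rewrite eunormZ ger0_norm ?invr_ge0 ?eunorm_ge0// mulVf// gt_eqF. Qed.

Section nonneg.
Variables (n : nat) (psi : 'rV[R]_n -> R) (B : R).
Hypothesis cpsi : sph_cont psi.
Hypothesis psi0 : forall x, eunorm x = 1 -> 0 <= psi x <= B.

Local Notation U := (unit_radial psi).

Lemma unit_radial_ge0 v : 0 <= U v.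
Proof.
rewrite /unit_radial; case: (boolP (0 < eunorm v <= 1)) => [/andP[v0 _]|_]; last by rewrite mulr0.
by rewrite mulr1; have /andP[] := psi0 (eunorm_normalize v0).
Qed.

Lemma unit_radial_scale a v : 0 < a <= 1 ->
  U (a *: v) * (eunorm (a *: v) <= a)%R%:R = U v.
Proof.
move=> /andP[a0 a1]; rewrite /unit_radial eunormZ (gtr0_norm a0).
rewrite pmulr_rgt0// -{5}(mulr1 a) (ler_pM2l a0).
have -> : (a * eunorm v)^-1 *: (a *: v) = (eunorm v)^-1 *: v.
  by rewrite scalerA invfM mulrAC mulVf ?gt_eqF// mul1r.
case: (ltP 0 (eunorm v)) => v0 /=; last by rewrite !mulr0 mul0r.
have [v1|v1] := leP (eunorm v) 1; last by rewrite !mulr0.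
by rewrite mulr1 (le_trans _ a1)// ler_piMr// ltW.
Qed.

Lemma integral_unit_radial_ball a : 0 < a <= 1 ->
  (\int[mu R n]_v (U v * (eunorm v <= a)%R%:R)%:E = (a ^+ n)%:E * \int[mu R n]_v (U v)%:E)%E.
Proof.
move=> a01; have [a0 a1] := andP a01.
have mF : measurable_fun setT (fun v : rVm R n => (U v * (eunorm v <= a)%R%:R)%:E).
  apply/measurable_EFinP; apply: measurable_funM; first exact: measurable_unit_radial.
  by apply: measurable_fun_b2r; apply: measurable_fun_ler; [exact: measurable_eunorm | exact: measurable_cst].
have F0 v : (0 <= (U v * (eunorm v <= a)%R%:R)%:E)%E by rewrite lee_fin mulr_ge0 ?unit_radial_ge0.
have := mu_scale (lt0r_neq0 a0) mF F0.
under eq_integral do rewrite unit_radial_scale//.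
by rewrite (gtr0_norm a0) => ->; rewrite muleA -EFinM mulfV ?mul1e// expf_neq0// gt_eqF.
Qed.

Lemma homogeneous_moment_ge0 :
  Rintegral (mu R n) setT (fun v => eunorm v ^+ 2 * U v) =
  n%:R / n.+2%:R * Rintegral (mu R n) setT U.
Proof.
have bU x : eunorm x = 1 -> `|psi x| <= B by move=> /psi0/andP[a b]; rewrite ger0_norm.
have iU := integrable_unit_radial cpsi bU.
have mU := measurable_unit_radial cpsi.
have mN : measurable_fun setT (fun v : rVm R n => eunorm v ^+ 2) by apply: measurable_funX; exact: measurable_eunorm.
have U1 v : (1 < eunorm v) -> U v = 0.
  by move=> v1; rewrite /unit_radial (leNgt _ 1) v1 andbF mulr0.
have i2 : (mu R n).-integrable setT (EFin \o (fun v : rVm R n => eunorm v ^+ 2 * U v)).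
  apply: (le_integrable measurableT _ _ iU); first by apply/measurable_EFinP; exact: measurable_funM.
  move=> v _; rewrite lee_fin normrM; have [v1|v1] := leP (eunorm v) 1; last by rewrite U1// normr0 mulr0.
  by apply: ler_piMl => //; rewrite ger0_norm ?sqr_ge0// expr_le1// eunorm_ge0.
pose ka (a : R) := 2 * a * (0 <= a <= 1)%R%:R.
have mka : measurable_fun setT ka.
  by apply: measurable_funM; [exact: measurable_funM | exact: measurable_itv_ind].
have ka0 a : 0 <= ka a.
  by rewrite /ka; case: (boolP (0 <= a <= 1)) => [/andP[a0 _]|_]; rewrite ?mulr0// mulr1 mulr_ge0.
have IB := integral_balls mU unit_radial_ge0 mka ka0.
set IU := Rintegral _ _ U; set I2 := Rintegral _ _ _.
(* 1 - |v|^2 is the integral of 2 a over [|v|, 1], and U is homogeneous of degree 0 on each ball *)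
have E1 : IU - I2 = 2 / n.+2%:R * IU.
  apply: EFin_inj; rewrite /IU /I2 -RintegralB//.
  rewrite EFinM /Rintegral !fineK; last 2 first.
  - exact: integrable_fin_num.
  - by apply: integrable_fin_num => //; exact: (integrableB measurableT iU i2).
  transitivity (\int[mu R n]_v ((U v)%:E * \int[leb]_a (ka a * (eunorm v <= a)%R%:R)%:E))%E.
    apply: eq_integral => v _; have : eunorm v <= 1 \/ 1 < eunorm v by case: leP; [left|right].
    rewrite -/(unit_radial psi v); case=> v1; last by rewrite U1// mulr0 subr0 mul0e.
    have -> : (\int[leb]_a (ka a * (eunorm v <= a)%R%:R)%:E = (1 - eunorm v ^+ 2)%:E)%E.
      have dF (t : R) : eunorm v <= t <= 1 -> is_derive t (1 : R) (fun t : R => t ^+ 2) (2 * t).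
        by move=> _; have := is_derive_expn 1 t; rewrite expr1.
      have cf (t : R) : eunorm v <= t <= 1 -> {for t, continuous (fun t : R => 2 * t)}.
        by move=> _; apply: cvgM; [exact: cvg_cst | exact: cvg_id].
      have := FTC_segment v1 dF cf; rewrite expr1n => <-.
      rewrite [RHS]integral_mkcond; apply: eq_integral => t _; rewrite patchE mem_setE in_itv/= /ka.
      have [vt|_] := leP (eunorm v) t; last by rewrite mulr0.
      by rewrite (le_trans (eunorm_ge0 _) vt)/= mulr1; case: (t <= 1); rewrite ?mulr1 ?mulr0.
    by rewrite -EFinM; congr (_%:E); ring.
  rewrite IB.
  transitivity (\int[leb]_(a in `[0%R, 1%R]) (fine (\int[mu R n]_v (U v)%:E) * 2 * a ^+ n.+1)%:E)%E.
    rewrite [RHS]integral_mkcond; apply: eq_integral => a _; rewrite patchE mem_setE in_itv/= /ka.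
    case: ifP => [/andP[a0 a1]|_]; last by rewrite mulr0 mul0e.
    have [->|an0] := eqVneq a 0; first by rewrite !(mulr0, mul0r) mul0e expr0n/= mulr0.
    rewrite integral_unit_radial_ball ?lt_def ?an0 ?a0// mulr1.
    rewrite -{1}(fineK (integrable_fin_num measurableT iU)) -!EFinM; congr (_%:E).
    by rewrite exprS; ring.
  rewrite integral_powers//; last by rewrite mulr_ge0// fine_ge0// integral_ge0// => v _; rewrite lee_fin unit_radial_ge0.
  rewrite expr1n mulr1 -(fineK (integrable_fin_num measurableT iU)) -EFinM; congr (_%:E) => /=.
  by ring.
have -> : I2 = IU - 2 / n.+2%:R * IU by rewrite -E1; ring.
have -> : n%:R = n.+2%:R - 2 :> R by rewrite -natr1 -natr1; ring.
have : n.+2%:R != 0 :> R by rewrite pnatr_eq0.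
by move: (n.+2%:R : R) => N N0; field.
Qed.

End nonneg.

Lemma sph_contD n (f h : 'rV[R]_n -> R) : sph_cont f -> sph_cont h -> sph_cont (fun x => f x + h x).
Proof.
move=> cf ch x x1 e e0; have e20 : 0 < e / 2 by rewrite divr_gt0.
have [r r0 hr] := cf x x1 _ e20; have [t t0 ht] := ch x x1 _ e20.
exists (Num.min r t); first by rewrite lt_min r0.
move=> y [y1]; rewrite le_min => /andP[yr yt].
have := hr y (conj y1 yr); have := ht y (conj y1 yt) => h1 h2.
by rewrite opprD addrACA; apply: le_lt_trans (ler_normD _ _) _; lra.
Qed.

Lemma sph_cont_cst n (c : R) : sph_cont (fun _ : 'rV[R]_n => c).
Proof. by move=> x _ e e0; exists 1 => // y _; rewrite subrr normr0. Qed.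

(** In polar coordinates the factor is the quotient of the integrals of t^(n+1) and t^(n-1) over
    [0, 1]. A signed function is written as the difference of two nonnegative ones by adding the
    constant |B|. *)
Lemma homogeneous_moment n (psi : 'rV[R]_n -> R) (B : R) : sph_cont psi ->
  (forall x, eunorm x = 1 -> `|psi x| <= B) ->
  Rintegral (mu R n) setT (fun v => eunorm v ^+ 2 * unit_radial psi v) =
  n%:R / n.+2%:R * Rintegral (mu R n) setT (unit_radial psi).
Proof.
move=> cpsi bpsi.
pose f1 x := psi x + `|B|; pose f2 (x : 'rV[R]_n) := `|B|.
have c2 : sph_cont f2 by exact: sph_cont_cst.
have c1 : sph_cont f1 by apply: sph_contD.
have b1 x : eunorm x = 1 -> 0 <= f1 x <= B + `|B|.
  by move=> /bpsi h; have := le_trans h (ler_norm B); move: h; rewrite !ler_norml /f1 => /andP[h1 h2] /andP[h3 h4]; apply/andP; split; lra.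
have b2 x : eunorm x = 1 -> 0 <= f2 x <= `|B| by rewrite /f2 normr_ge0 lexx.
have ab (p : 'rV[R]_n -> R) c : (forall x, eunorm x = 1 -> 0 <= p x <= c) -> forall x, eunorm x = 1 -> `|p x| <= c.
  by move=> h x /h /andP[h1 h2]; rewrite ger0_norm.
have i1 := integrable_unit_radial c1 (ab _ _ b1).
have i2 := integrable_unit_radial c2 (ab _ _ b2).
have sq p c : sph_cont p -> (forall x, eunorm x = 1 -> `|p x| <= c) ->
    (mu R n).-integrable setT (EFin \o (fun v : rVm R n => eunorm v ^+ 2 * unit_radial p v)).
  move=> cp bp; apply: (le_integrable measurableT _ _ (integrable_unit_radial cp bp)).
    apply/measurable_EFinP; apply: measurable_funM; last exact: measurable_unit_radial.
    by apply: measurable_funX; exact: measurable_eunorm.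
  move=> v _; rewrite lee_fin normrM /unit_radial.
  case: (boolP (_ && _)) => [/andP[_ v1]|_]; last by rewrite !mulr0 normr0 mulr0.
  by apply: ler_piMl => //; rewrite ger0_norm ?sqr_ge0// expr_le1// eunorm_ge0.
have s1 := sq _ _ c1 (ab _ _ b1); have s2 := sq _ _ c2 (ab _ _ b2).
have UE v : unit_radial psi v = unit_radial f1 v - unit_radial f2 v by rewrite /unit_radial /f1 /f2; ring.
have -> : Rintegral (mu R n) setT (unit_radial psi) =
    Rintegral (mu R n) setT (unit_radial f1) - Rintegral (mu R n) setT (unit_radial f2).
  by rewrite -(RintegralB measurableT i1 i2); apply: eq_Rintegral => v _; rewrite -UE.
rewrite mulrBr -(homogeneous_moment_ge0 c1 b1) -(homogeneous_moment_ge0 c2 b2) -RintegralB//.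
by apply: eq_Rintegral => v _; rewrite UE mulrBr.
Qed.

End radial.

Section angular.
Context {R : realType} {n : nat}.
Variable g : 'rV[R]_n -> R.
Hypothesis cg : {within unit_sphere, continuous g}.

Lemma within_sph_cont : sph_cont g.
Proof.
move=> x x1 e e0.
have := (subspace_continuousP _ _).1 cg x x1.
move/cvgrPdist_lt => /(_ e e0); rewrite /within /=.
move=> /(nbhs_ballP x)[r /= r0 h]; exists (r / 2); first by rewrite divr_gt0.
move=> y [y1 yx]; rewrite distrC; apply: h => //; rewrite mx_norm_ball /= -normrN opprB.
by apply: le_lt_trans (ler_norm_eunorm _) _; apply: le_lt_trans yx _; lra.
Qed.

Lemma sphere_bounded : exists B, forall x, eunorm x = 1 -> `|g x| <= B.
Proof.
have bS : \forall M \near +oo, globally (unit_sphere : set 'rV[R]_n) [set x | `|x| <= M].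
  near=> M => x /= x1; apply: le_trans (ler_norm_eunorm x) _.
  by rewrite x1; near: M; apply: nbhs_pinfty_ge; exact: num_real.
have clS : closed (unit_sphere : set 'rV[R]_n).
  apply: (@preimage_closed 'rV[R]_n R (@eunorm R n) [set t : R | t = 1]); last exact: closed_eq.
  by move=> y _; exact: eunorm_continuous.
have cS := bounded_closed_compact bS clS.
have /compact_bounded := continuous_compact cg cS.
move=> /pinfty_ex_gt0[B _ hB]; exists B => x x1; apply: hB; by exists x.
Unshelve. all: by end_near.
Qed.

End angular.

Section radial_extension.
Context {R : realType} {n : nat}.
Variables (g : 'rV[R]_n -> R) (B : R).
Hypothesis cg : sph_cont g.
Hypothesis gB : forall x, eunorm x = 1 -> 0 <= g x <= B.
Hypothesis B0 : 0 <= B.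

(** It vanishes at the origin, where the value of [g] is arbitrary; elsewhere it is the angular
    factor of [kgs]. *)
Definition radial_ext v : R := g ((eunorm v)^-1 *: v) * (0 < eunorm v)%R%:R.

Lemma measurable_radial_ext : measurable_fun setT (radial_ext : rVm R n -> R).
Proof.
apply: measurable_funM; first exact: measurable_radial.
by apply: measurable_fun_b2r; apply: measurable_fun_ltr; [exact: measurable_cst | exact: measurable_eunorm].
Qed.

Lemma radial_ext_bound v : 0 <= radial_ext v <= B.
Proof.
rewrite /radial_ext; case: (ltP 0 (eunorm v)) => v0; last by rewrite mulr0 lexx.
by rewrite mulr1 gB// eunorm_normalize.
Qed.

Lemma radial_ext0 : radial_ext 0 = 0.
Proof. by rewrite /radial_ext eunorm0 ltxx mulr0. Qed.

Lemma radial_ext_scale a v : 0 < a -> radial_ext (a *: v) = radial_ext v.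
Proof.
move=> a0; rewrite /radial_ext eunormZ (gtr0_norm a0) pmulr_rgt0// scalerA invfM.
by rewrite mulrAC mulVf ?gt_eqF// mul1r.
Qed.

Lemma radial_ext_econt v : v != 0 -> econt radial_ext v.
Proof.
move=> v0 e e0; have nv : 0 < eunorm v by rewrite eunorm_gt0.
have [r r0 h] := cg (eunorm_normalize nv) e0.
have m0 : 0 < Num.min (eunorm v / 2) (r * eunorm v / 2) by rewrite lt_min !divr_gt0// mulr_gt0.
exists (Num.min (eunorm v / 2) (r * eunorm v / 2)) => // y; rewrite le_min => /andP[y1 y2].
have ny : 0 < eunorm y.
  have := ler_eunormD y (v - y); rewrite addrC subrK -(eunormN (v - y)) opprB; lra.
rewrite /radial_ext ny nv !mulr1; apply: h; split; first exact: eunorm_normalize.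
have -> : (eunorm y)^-1 *: y - (eunorm v)^-1 *: v =
    (eunorm v)^-1 *: ((y - v) + ((eunorm v - eunorm y) / eunorm y) *: y).
  rewrite scalerDr scalerBr scalerA addrAC -scalerDl; congr (_ *: _ - _).
  by field; rewrite !gt_eqF.
rewrite eunormZ ger0_norm ?invr_ge0 ?(ltW nv)// ler_pdivrMl//.
apply: le_trans (ler_eunormD _ _) _; rewrite eunormZ normrM normfV (gtr0_norm ny) divfK ?gt_eqF//.
by have := ler_eunorm_dist v y; rewrite -(eunormN (v - y)) opprB; lra.
Qed.

End radial_extension.

Section curvature_form.
Context {R : realType} {n : nat}.
Local Notation d := n.+1.
Variables (nu : 'rV[R]_d) (f : 'rV[R]_d -> R).
Hypothesis nu1 : eunorm nu = 1.

Lemma projperpZ a (u : 'rV[R]_d) : projperp nu (a *: u) = a *: projperp nu u.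
Proof. by rewrite /projperp edotZl scalerBr scalerA. Qed.

Lemma hessZ y a (u : 'rV[R]_d) : hess f y (a *: u) = a ^+ 2 * hess f y u.
Proof.
rewrite /hess mulr_sumr; apply: eq_bigr => i _; rewrite mulr_sumr; apply: eq_bigr => j _.
by rewrite !mxE; ring.
Qed.

Lemma le_double_sum (a : 'I_d -> 'I_d -> R) i j : (forall i j, 0 <= a i j) ->
  a i j <= \sum_i \sum_j a i j.
Proof.
move=> a0; rewrite (bigD1 i)//= (bigD1 j)//= -addrA lerDl.
by rewrite addr_ge0// ?sumr_ge0// => k _; rewrite sumr_ge0.
Qed.

Definition hess_sup y : R := \sum_i \sum_j `|'D_(ebase j) (fun x => 'D_(ebase i) f x) y|.

Lemma le_hess_sup y i j : `|'D_(ebase j) (fun x => 'D_(ebase i) f x) y| <= hess_sup y.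
Proof. exact: (@le_double_sum (fun i j => `|'D_(ebase j) (fun x => 'D_(ebase i) f x) y|)). Qed.

Lemma curvZ a v : curv nu f (a *: v) = a ^+ 2 * curv nu f v.
Proof. by rewrite /curv projperpZ hessZ; ring. Qed.

Lemma curv_bound v : `|curv nu f v| <= d%:R ^+ 2 * hess_sup 0 * eunorm v ^+ 2.
Proof.
have h0 : 0 <= hess_sup 0 by apply: le_trans (le_hess_sup 0 ord0 ord0).
rewrite /curv normrN normrM [`|2^-1|]ger0_norm//.
apply: le_trans (_ : `|hess f 0 (projperp nu v)| <= _); first by apply: ler_piMr => //; lra.
apply: le_trans (hess_bound _ (le_hess_sup 0)) _.
rewrite -mulrA ler_wpM2l ?exprn_ge0// ler_wpM2l// lerXn2r ?nnegrE ?eunorm_ge0//.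
exact: eunorm_projperp.
Qed.

Lemma hess_econt y v : econt (hess f y) v.
Proof.
move=> e e0; pose c := d%:R ^+ 2 * hess_sup y * (2 * eunorm v + 1).
have h0 : 0 <= hess_sup y by apply: le_trans (le_hess_sup y ord0 ord0).
have c0 : 0 <= c by rewrite !mulr_ge0 ?exprn_ge0// addr_ge0// mulr_ge0// eunorm_ge0.
exists (Num.min 1 (e / (c + 1))); first by rewrite lt_min ltr01 divr_gt0// ltr_wpDl.
move=> z; rewrite le_min => /andP[z1 ze].
apply: le_lt_trans (hess_diff_vec _ _ (le_hess_sup y)) _.
have zv : eunorm z + eunorm v <= 2 * eunorm v + 1.
  by have := ler_eunormD (z - v) v; rewrite subrK; lra.
apply: le_lt_trans (_ : c * (e / (c + 1)) < _).
  have -> : c * (e / (c + 1)) = d%:R ^+ 2 * (hess_sup y * (e / (c + 1) * (2 * eunorm v + 1))) by rewrite {1}/c; ring.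
  apply: ler_wpM2l; first by rewrite exprn_ge0.
  apply: ler_wpM2l => //; apply: ler_pM => //; rewrite ?addr_ge0 ?eunorm_ge0//.
by rewrite mulrCA gtr_pMr// ltr_pdivrMr ?ltr_wpDl// mul1r ltrDl.
Qed.

Lemma curv_econt v : econt (curv nu f) v.
Proof.
move=> e e0; have [r r0 h] := hess_econt 0 (projperp nu v) e0.
exists r => // z zv; have := h (projperp nu z) (le_trans (projperp_lipschitz _ _ nu1) zv).
have -> : curv nu f z - curv nu f v = (hess f 0 (projperp nu v) - hess f 0 (projperp nu z)) / 2.
  by rewrite /curv; move: (hess _ _ _) (hess _ _ _) => a b; ring.
rewrite normrM [`|2^-1|]ger0_norm// => h1.
apply: le_lt_trans h1; rewrite distrC; apply: ler_piMr => //; lra.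
Qed.

End curvature_form.

(** * Passage to the limit *)

Lemma integral_invariant (R : realType) n (T : 'rV[R]_n -> 'rV[R]_n) (psi : 'rV[R]_n -> R) :
  (forall F, measurable_fun setT (F : rVm R n -> \bar R) -> (forall v, 0 <= F v)%E ->
    (\int[mu R n]_v F (T v) = \int[mu R n]_v F v)%E) ->
  measurable_fun setT (psi : rVm R n -> R) ->
  (\int[mu R n]_v (psi (T v))%:E = \int[mu R n]_v (psi v)%:E)%E.
Proof.
move=> hT mpsi.
have mE : measurable_fun setT (EFin \o (psi : rVm R n -> R)) by exact/measurable_EFinP.
have hp := hT _ (measurable_funepos mE) (funepos_ge0 _).
have hn := hT _ (measurable_funeneg mE) (funeneg_ge0 _).
have E1 := integralE (mu R n) setT (EFin \o (psi : rVm R n -> R)).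
have E2 := integralE (mu R n) setT (EFin \o ((psi \o T) : rVm R n -> R)).
rewrite -[LHS]/(\int[mu R n]_v (EFin \o (psi \o T)) v)%E -[RHS]/(\int[mu R n]_v (EFin \o psi) v)%E.
rewrite E1 E2 -hp -hn; congr (_ - _)%E; apply: eq_integral => v _.
  by rewrite !funeposE.
by rewrite !funenegE.
Qed.

(** The booleans record whether x + v and x - v belong to the set. If both do, then |a| <= N - Q < 2
    N - Q and the subtracted indicator is 1. If exactly one does, the right-hand side is 0 and |a|
    >= Q - N kills the first indicator. If neither does, the right-hand side is 1. *)
Lemma slab_dichotomy (R : realType) (a Q N : R) (b1 b2 : bool) : 0 < N ->
  (b1 -> a + Q <= N) -> (b2 -> - a + Q <= N) ->
  ((`|a| < Q - N)%R%:R : R) - (`|a| < - Q + 2 * N)%R%:R <= (1 - 2 * b1%:R + (1 - 2 * b2%:R)) / 2.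
Proof.
move=> N0; have [l1 l2] : a <= `|a| /\ - a <= `|a| by split; rewrite ?ler_norm// -normrN ler_norm.
case: b1 => h1; case: b2 => h2; rewrite /= ?mulr1 ?mulr0.
- have {}h1 := h1 isT; have {}h2 := h2 isT.
  have hn : `|a| <= N - Q by rewrite ler_norml; apply/andP; split; lra.
  have -> : `|a| < - Q + 2 * N by lra.
  have -> : (`|a| < Q - N) = false by apply/negbTE; rewrite -leNgt; have := normr_ge0 a; lra.
  by rewrite mulr0n mulr1n; lra.
- have {}h1 := h1 isT.
  have -> : (`|a| < Q - N) = false by apply/negbTE; rewrite -leNgt; lra.
  by rewrite mulr0n; have := ler0n R (`|a| < - Q + 2 * N)%R; lra.
- have {}h2 := h2 isT.
  have -> : (`|a| < Q - N) = false by apply/negbTE; rewrite -leNgt; lra.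
  by rewrite mulr0n; have := ler0n R (`|a| < - Q + 2 * N)%R; lra.
- have := ler0n R (`|a| < - Q + 2 * N)%R.
  by case: (_ < Q - N); rewrite ?mulr0n ?mulr1n; lra.
Qed.

(** * The nonlocal curvature as the integral of a symmetrised phase *)

Section nonlocal_curvature.
Context {R : realType} {n : nat}.
Local Notation d := n.+2.
Local Notation muV := (mu R d).
Variables (g : 'rV[R]_d -> R) (B s : R).
Hypothesis cg : sph_cont g.
Hypothesis gB : forall x, eunorm x = 1 -> 0 <= g x <= B.
Hypothesis geven : forall x, eunorm x = 1 -> g (- x) = g x.
Hypothesis B0 : 0 <= B.
Hypothesis s1 : 1 <= s.
Local Notation G := (radial_ext g).
Local Notation kr := (kr (d := d) s).

Definition phase (S : set 'rV[R]_d) (x v : 'rV[R]_d) : R := 1 - 2 * ((x + v)%R \in S)%:R.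

Definition sym_phase S x v : R := (phase S x v + phase S x (- v)) / 2.

Lemma phase_bound S x v : `|phase S x v| <= 1.
Proof. by rewrite /phase; case: (_ \in _) => /=; rewrite ler_norml; apply/andP; split; lra. Qed.

Lemma sym_phase_bound S x v : `|sym_phase S x v| <= 1.
Proof.
rewrite /sym_phase normrM [`|2^-1|]ger0_norm// ler_pdivrMr// mul1r.
apply: le_trans (ler_normD _ _) _; have := phase_bound S x v; have := phase_bound S x (- v); lra.
Qed.

Lemma measurable_phase S x : measurable S -> measurable_fun setT (phase S x : rVm R d -> R).
Proof.
move=> mS; apply: measurable_funB; first exact: measurable_cst.
apply: measurable_funM; first exact: measurable_cst.
rewrite (_ : (fun _ => _) = \1_[set v : rVm R d | S (x + v)]).
  apply: measurable_indic; rewrite -[X in measurable X]setTI.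
  have mx : measurable_fun setT (fun v : rVm R d => x + v).
    by apply: measurable_rVD; [exact: measurable_cst | exact: measurable_id].
  exact: mx.
by apply/funext => v; rewrite indicE; congr (nat_of_bool _)%:R; apply/idP/idP => /set_mem h; apply/mem_set.
Qed.

Lemma measurable_oppV : measurable_fun setT (fun v : rVm R d => - v).
Proof.
have : measurable_fun setT (fun v : rVm R d => (-1) *: v).
  by apply: measurable_rVZ; [exact: measurable_cst | exact: measurable_id].
by apply: eq_measurable_fun => v _; rewrite scaleN1r.
Qed.

Lemma measurable_sym_phase S x : measurable S -> measurable_fun setT (sym_phase S x : rVm R d -> R).
Proof.
move=> mS; apply: measurable_funM; last exact: measurable_cst.
apply: measurable_funD; first exact: measurable_phase.
exact: (measurableT_comp (measurable_phase x mS) measurable_oppV).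
Qed.

Lemma radial_ext_even v : G (- v) = G v.
Proof.
rewrite /radial_ext eunormN scalerN; case: (ltP 0 (eunorm v)) => v0; last by rewrite !mulr0.
by rewrite geven// eunorm_normalize.
Qed.

(** Translate by [x], then average with the reflected integral, equal to it because [g] is even. The
    translated integrand agrees with the phase integrand off the origin, a null set; this also
    supplies the integrability that [iintE] needs. *)
Lemma Kgs_sym_phase S x r : measurable S -> 0 < r ->
  Kgs g s r x S = Rintegral muV setT (fun v => sym_phase S x v * G v * kr r (eunorm v)).
Proof.
move=> mS r0.
have mG : measurable_fun setT (G : rVm R d -> R) by exact: measurable_radial_ext.
have bG := radial_ext_bound gB B0.
have Gp v : 0 <= G v by have /andP[] := bG v.
have mk := measurable_kr_norm (n := n) s r.
pose F (y : 'rV[R]_d) := (\1_(~` S) y - \1_S y) * kgs g s r (x - y).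
have mF : measurable_fun setT (F : rVm R d -> R).
  apply: measurable_funM.
    by apply: measurable_funB; apply: measurable_indic => //; exact: measurableC.
  have mx : measurable_fun setT (fun y : rVm R d => x - y).
    by apply: measurable_rVB; [exact: measurable_cst | exact: measurable_id].
  apply: measurable_funM; first exact: (measurableT_comp (measurable_radial cg) mx).
  exact: (measurableT_comp mk mx).
pose W v := phase S x v * G v * kr r (eunorm v).
have mP := measurable_phase x mS.
have mW : measurable_fun setT (W : rVm R d -> R).
  by apply: measurable_funM => //; exact: measurable_funM.
have iW : muV.-integrable setT (EFin \o (W : rVm R d -> R)).
  apply: (integrable_kernel s1 mG bG r0 (measurable_funM mP mG)) => v.
  by rewrite normrM (ger0_norm (Gp v)); apply: ler_piMl => //; exact: phase_bound.
have FW v : 0 < eunorm v -> F (v + x) = W v.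
  move=> v0; rewrite /F /W /phase /kgs [x + v]addrC.
  have -> : x - (v + x) = - v by rewrite opprD addrCA subrr addr0.
  rewrite eunormN scalerN geven ?eunorm_normalize// /radial_ext v0 mulr1 mulrA.
  congr (_ * _ * _); rewrite !indicE in_setC.
  by case: (_ \in S) => /=; ring.
have aeFW : {ae muV, forall v, setT v -> (F (v + x))%:E = (W v)%:E}.
  exists [set v | eunorm v = 0]; split; [exact: measurable_sphere | exact: mu_sphere |].
  move=> v /=; apply: contra_notP => v0 _; congr (_%:E); apply: FW.
  by rewrite lt_neqAle eunorm_ge0 andbT eq_sym; exact/eqP.
have mtr : measurable_fun setT (fun v : rVm R d => v + x).
  by apply: measurable_rVD; [exact: measurable_id | exact: measurable_cst].
have mFx : measurable_fun setT (fun v : rVm R d => F (v + x)) by exact: (measurableT_comp mF mtr).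
have mabs (H : rVm R d -> R) : measurable_fun setT H -> measurable_fun setT (fun y => `|(H y)%:E|%E).
  by move=> mH; have /measurable_EFinP := measurableT_comp (@normr_measurable R setT) mH.
have iF : muV.-integrable setT (EFin \o (F : rVm R d -> R)).
  apply/integrableP; split; first exact/measurable_EFinP.
  rewrite -(mu_translation x (mabs _ mF) (fun _ => abse_ge0 _)).
  have -> : (\int[muV]_v `|(F (v + x))%:E| = \int[muV]_v `|(W v)%:E|)%E.
    apply: ge0_ae_eq_integral => //.
    - exact: mabs mFx.
    - exact: mabs mW.
    - by apply: filterS aeFW => v h _; rewrite h.
  by have /integrableP[] := iW.
have -> : Kgs g s r x S = Rintegral muV setT W.
  rewrite /Kgs (iintE iF) /Rintegral; congr fine.
  rewrite -[LHS](integral_invariant (T := fun v => v + x) (fun F mF F0 => mu_translation x mF F0) mF).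
  by apply: ae_eq_integral => //; apply/measurable_EFinP.
have iW' : muV.-integrable setT (EFin \o (fun v : rVm R d => phase S x (- v) * G v * kr r (eunorm v))).
  apply: (integrable_kernel s1 mG bG r0 (measurable_funM (measurableT_comp mP measurable_oppV) mG)) => v.
  by rewrite /= normrM (ger0_norm (Gp v)); apply: ler_piMl => //; exact: phase_bound.
have WW : Rintegral muV setT (fun v => phase S x (- v) * G v * kr r (eunorm v)) = Rintegral muV setT W.
  rewrite /Rintegral; congr fine.
  rewrite -[RHS](integral_invariant (T := fun v => - v) (fun F mF F0 => mu_opp mF F0) mW).
  by apply: eq_integral => v _; rewrite /W radial_ext_even eunormN.
have -> : Rintegral muV setT W = 2^-1 * (Rintegral muV setT W + Rintegral muV setT (fun v => phase S x (- v) * G v * kr r (eunorm v))).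
  by rewrite WW; field.
rewrite -RintegralD// -RintegralZl//; last exact: (integrableD measurableT iW iW').
by apply: eq_Rintegral => v _; rewrite /W /sym_phase; ring.
Qed.

End nonlocal_curvature.

(** * The unit sphere of the tangent hyperplane, parametrised isometrically *)

Section tangent_sphere.
Context {R : realType} {n : nat}.
Variables (nu : 'rV[R]_n.+2) (M : 'M[R]_n.+2).
Hypothesis oM : M *m M^T = 1%:M.
Hypothesis eM : e0 n.+1 *m M = nu.

Definition tangent_embed (z : 'rV[R]_n.+1) : 'rV[R]_n.+2 := vcons 0 z *m M.

Lemma eunorm_tangent z : eunorm (tangent_embed z) = eunorm z.
Proof. by rewrite eunorm_orth// eunorm_vcons expr0n/= add0r sqrtr_sqr ger0_norm ?eunorm_ge0. Qed.

Lemma tangentB z w : tangent_embed z - tangent_embed w = tangent_embed (z - w).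
Proof. by rewrite /tangent_embed -mulmxBl sub_vcons subrr. Qed.

Lemma tangentZ a z : tangent_embed (a *: z) = a *: tangent_embed z.
Proof. by rewrite /tangent_embed scalemxAl scale_vcons mulr0. Qed.

Lemma tangent_isometry z w : eunorm (tangent_embed z - tangent_embed w) = eunorm (z - w).
Proof. by rewrite tangentB eunorm_tangent. Qed.

Lemma edot_tangent z : edot (tangent_embed z) nu = 0.
Proof. by rewrite -eM edot_orth// edot_vcons mul0r add0r edotC edot0l. Qed.

Lemma tangent_sphereE :
  [set xi | unit_sphere xi /\ edot xi nu = 0] = tangent_embed @` [set z | eunorm z = 1].
Proof.
apply/seteqP; split => [xi [xi1 xn]|_ [z z1 <-]]; last first.
  by split; [rewrite /unit_sphere/= eunorm_tangent | exact: edot_tangent].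
have xE : xi = (xi *m M^T) *m M by rewrite -mulmxA (mulmx1C oM) mulmx1.
have v0 : (xi *m M^T) ord0 ord0 = 0.
  move: xn; rewrite {1}xE -eM edot_orth// -{1}(vcons_eta (xi *m M^T)) edot_vcons edotC edot0l.
  by rewrite mulr1 addr0.
have tE : tangent_embed (vtail (xi *m M^T)) = xi.
  by rewrite /tangent_embed -{1}v0 vcons_eta -xE.
by exists (vtail (xi *m M^T)) => //=; rewrite -eunorm_tangent tE.
Qed.

Lemma sph_cont_tangent (h : 'rV[R]_n.+2 -> R) : sph_cont h -> sph_cont (h \o tangent_embed).
Proof.
move=> ch z z1 e e0; have [|r r0 hr] := ch (tangent_embed z) _ e e0; first by rewrite eunorm_tangent.
exists r => // w [w1 wz]; apply: hr; split; first by rewrite eunorm_tangent.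
by rewrite tangent_isometry.
Qed.

End tangent_sphere.

Lemma sph_contM (R : realType) n (f h : 'rV[R]_n -> R) :
  sph_cont f -> sph_cont h -> sph_cont (fun x => f x * h x).
Proof.
move=> cf ch x x1 e e0; pose a := `|f x| + 1; pose b := `|h x| + 1.
have a0 : 0 < a by rewrite /a ltr_wpDl.
have b0 : 0 < b by rewrite /b ltr_wpDl.
have [|r1 r10 h1] := cf x x1 (Num.min 1 (e / (2 * b))).
  by rewrite lt_min ltr01 divr_gt0// mulr_gt0.
have [|r2 r20 h2] := ch x x1 (e / (2 * a)); first by rewrite divr_gt0// mulr_gt0.
exists (Num.min r1 r2) => [|y [y1]]; first by rewrite lt_min r10.
rewrite le_min => /andP[yr1 yr2].
have := h1 y (conj y1 yr1); rewrite lt_min => /andP[f1 f2].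
have g2 := h2 y (conj y1 yr2).
have -> : f y * h y - f x * h x = f y * (h y - h x) + h x * (f y - f x) by ring.
have fya : `|f y| <= a by have := ler_normD (f y - f x) (f x); rewrite subrK /a; lra.
have t1 : `|f y * (h y - h x)| <= a * `|h y - h x| by rewrite normrM; apply: ler_wpM2r.
have t2 : `|h x * (f y - f x)| <= b * `|f y - f x|.
  by rewrite normrM; apply: ler_wpM2r => //; rewrite /b lerDl.
have u1 : a * `|h y - h x| < e / 2.
  have := g2; rewrite -(ltr_pM2l a0) => u; apply: (lt_le_trans u).
  by rewrite le_eqVlt; apply/orP; left; apply/eqP; field; rewrite gt_eqF.
have u2 : b * `|f y - f x| < e / 2.
  have := f2; rewrite -(ltr_pM2l b0) => u; apply: (lt_le_trans u).
  by rewrite le_eqVlt; apply/orP; left; apply/eqP; field; rewrite gt_eqF.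
apply: le_lt_trans (ler_normD _ _) _; lra.
Qed.

Section curvature_limit.
Context {R : realType} {n : nat}.
Local Notation d := n.+2.
Local Notation muV := (mu R d).
Variables (g : 'rV[R]_d -> R) (B : R) (nu : 'rV[R]_d) (M : 'M[R]_d) (f : 'rV[R]_d -> R).
Hypothesis cg : sph_cont g.
Hypothesis gB : forall x, eunorm x = 1 -> 0 <= g x <= B.
Hypothesis B0 : 0 <= B.
Hypothesis nu1 : eunorm nu = 1.
Hypothesis oM : M *m M^T = 1%:M.
Hypothesis eM : e0 n.+1 *m M = nu.
Local Notation G := (radial_ext g).
Local Notation q := (curv nu f).
Local Notation h := (fun xi => g xi * hess f 0 xi).

Lemma curv_tangent z : q (tangent_embed M z) = - (hess f 0 (tangent_embed M z) / 2).
Proof. by rewrite /curv /projperp (edot_tangent oM eM) scale0r subr0. Qed.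

Lemma sph_cont_angular : sph_cont h.
Proof.
apply: sph_contM => // x x1 e e0; have [r r0 hr] := hess_econt f 0 x e0.
by exists r => // y [_ yr]; exact: hr.
Qed.

Lemma angular_bound x : eunorm x = 1 -> `|h x| <= B * (d%:R ^+ 2 * hess_sup f 0).
Proof.
move=> x1; rewrite normrM; have /andP[g0 g1] := gB x1.
apply: ler_pM => //; first by rewrite ger0_norm.
apply: le_trans (hess_bound _ (le_hess_sup f 0)) _.
by rewrite x1 expr1n mulr1.
Qed.

(** The Hessian form has degree 2 and [G] has degree 0, which leaves the factor |z|^2 and the value
    on the sphere; the 2 cancels the 1/2 in [curv]. *)
Lemma slab_integrandE c (z : 'rV[R]_n.+1) :
  2 * (c * q (tangent_embed M z)) * G (tangent_embed M z) * (eunorm z <= 1)%R%:R =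
  eunorm z ^+ 2 * unit_radial (fun z => - c * (h \o tangent_embed M) z) z.
Proof.
rewrite curv_tangent /unit_radial /radial_ext eunorm_tangent//.
have [z0|z0] := ltP 0 (eunorm z); last by rewrite /= !mulr0 mul0r.
rewrite /= tangentZ hessZ; case: (_ <= 1); last by rewrite !mulr0.
by move: (hess _ _ _) (g _) => b a; field; rewrite gt_eqF.
Qed.

(** The moment identity is used in both directions, so that the constant is moved across the
    integral of [unit_radial] itself, whose integrability is known. *)
Lemma slab_lim_curvE c : slab_lim G (fun v => c * q v) M =
  - c * Rintegral (mu R n.+1) setT (fun z => eunorm z ^+ 2 * unit_radial (h \o tangent_embed M) z).
Proof.
have sc0 : sph_cont (h \o tangent_embed M) by exact: (sph_cont_tangent oM sph_cont_angular).
have sc : sph_cont (fun z => - c * (h \o tangent_embed M) z).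
  by apply: sph_contM => //; exact: sph_cont_cst.
have bd z : eunorm z = 1 -> `|(h \o tangent_embed M) z| <= B * (d%:R ^+ 2 * hess_sup f 0).
  by move=> z1; apply: angular_bound; rewrite eunorm_tangent.
have bdN z : eunorm z = 1 ->
    `|- c * (h \o tangent_embed M) z| <= `|c| * (B * (d%:R ^+ 2 * hess_sup f 0)).
  by move=> z1; rewrite normrM normrN; apply: ler_wpM2l => //; exact: bd.
rewrite (homogeneous_moment sc0 bd) mulrCA.
rewrite -RintegralZl//; last exact: (integrable_unit_radial sc0 bd).
have -> : Rintegral (mu R n.+1) setT (fun z => - c * unit_radial (h \o tangent_embed M) z) =
    Rintegral (mu R n.+1) setT (unit_radial (fun z => - c * (h \o tangent_embed M) z)).
  by apply: eq_Rintegral => z _; rewrite /unit_radial mulrA.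
rewrite -(homogeneous_moment sc bdN) /slab_lim; apply: eq_Rintegral => z _.
rewrite -[vcons 0 z *m M]/(tangent_embed M z); exact: slab_integrandE.
Qed.

(** The constants match: with d = n+2, the factor d+1 = n+3 cancels the denominator of the moment
    factor (n+1)/(n+3), and the remaining n+1 is the one that turns cone volume into Hausdorff
    measure in dimension n = d-2. *)
Lemma slab_lim_curvature : isC2 f ->
  (n.+3%:R * slab_lim G q M)%:E =
  oppe (haus_int n [set xi | unit_sphere xi /\ edot xi nu = 0]
        (fun xi => g xi * derive (fun y => derive f y xi) 0 xi)).
Proof.
move=> C2f.
have -> : (fun xi => g xi * derive (fun y => derive f y xi) 0 xi) = h.
  apply/funext => xi; congr (_ * _).
  by have := isC2_derive2 0 xi C2f => H; rewrite (@derive_val _ _ _ _ _ _ _ H).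
have bd z : eunorm z = 1 -> `|h (tangent_embed M z)| <= B * (d%:R ^+ 2 * hess_sup f 0).
  by move=> z1; apply: angular_bound; rewrite eunorm_tangent.
have sc := sph_cont_tangent oM sph_cont_angular.
rewrite (tangent_sphereE oM eM) (haus_int_cone (tangent_isometry oM) sc bd) -EFinN.
have qE : q = (fun v => 1 * q v) by apply/funext => v; rewrite mul1r.
rewrite qE slab_lim_curvE (homogeneous_moment sc bd); congr (_%:E).
have n3 : (n.+3%:R : R) != 0 by rewrite pnatr_eq0.
by move: (Rintegral _ _ _) n3; move: (n.+3%:R : R) => N I N0; field.
Qed.

End curvature_limit.

(** * Two-sided estimates for the approximating sets *)

Section blow_up.
Context {R : realType} {n : nat}.
Local Notation d := n.+2.
Local Notation muV := (mu R d).
Variables (g : 'rV[R]_d -> R) (B s : R) (Er : R -> set 'rV[R]_d) (E : set 'rV[R]_d).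
Variables (x nu : 'rV[R]_d) (rho : R) (f : 'rV[R]_d -> R) (M : 'M[R]_d).
Hypothesis cg : sph_cont g.
Hypothesis gB : forall x, eunorm x = 1 -> 0 <= g x <= B.
Hypothesis geven : forall x, eunorm x = 1 -> g (- x) = g x.
Hypothesis B0 : 0 <= B.
Hypothesis s1 : 1 <= s.
Hypothesis nu1 : eunorm nu = 1.
Hypothesis rho0 : 0 < rho.
Hypothesis C2f : isC2 f.
Hypothesis df0 : forall z, edot z nu = 0 -> derive f 0 z = 0.
Hypothesis subE : local_subgraph E x nu rho f.
Hypothesis clEr : forall r, 0 < r -> closed (Er r).
Hypothesis bdEr : forall r, 0 < r -> bdry (Er r) x.
Hypothesis cvE : conv_frakC Er E.
Hypothesis oM : M *m M^T = 1%:M.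
Hypothesis eM : e0 n.+1 *m M = nu.
Local Notation G := (radial_ext g).
Local Notation q := (curv nu f).

Lemma measurable_Er r : 0 < r -> measurable (Er r : set (rVm R d)).
Proof.
move=> r0; rewrite -[Er r]setCK; apply: measurableC; apply: open_measurable_rV.
by apply: closed_openC; exact: clEr.
Qed.

(** The sign -1 exchanges the set with its complement: [slab_dichotomy] is then applied to
    non-membership, and the second half of [local_structure], with the opposite signs, takes over
    the role of the first. *)
Lemma signed_slab_bound c e : c = 1 \/ c = -1 -> 0 < e ->
  exists2 de, 0 < de & exists2 r0, 0 < r0 & forall r, 0 < r < r0 ->
    exists2 l, eunorm (l - nu) <= e & forall v, v != 0 -> eunorm v <= de ->
      (`|edot l v| < c * q v - e * eunorm v ^+ 2)%R%:R -
      (`|edot l v| < - (c * q v) + 2 * e * eunorm v ^+ 2)%R%:R <= c * sym_phase (Er r) x v.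
Proof.
move=> hc e0.
have [de de0 [r0 r00 h]] := local_structure nu1 rho0 C2f df0 subE clEr bdEr cvE e0.
exists de => //; exists r0 => // r rr; have [l l1 hl] := h r rr.
exists l => // v v0 vd; rewrite -mulrA.
have N0 : 0 < e * eunorm v ^+ 2 by rewrite mulr_gt0// exprn_gt0// eunorm_gt0.
have [h1 h2] := hl v vd.
have [h3 h4] : (Er r (x - v) -> - edot l v + q v <= e * eunorm v ^+ 2) /\
    (~ Er r (x - v) -> - (e * eunorm v ^+ 2) <= - edot l v + q v).
  have := hl (- v); rewrite eunormN => /(_ vd).
  rewrite (_ : edot l (- v) = - edot l v); last by rewrite edotNr.
  by rewrite -scaleN1r curvZ sqrrN expr1n mul1r scaleN1r.
case: hc => ->.
  rewrite !mul1r /sym_phase /phase.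
  by apply: slab_dichotomy N0 _ _ => /set_mem; [exact: h1 | exact: h3].
have -> : -1 * sym_phase (Er r) x v =
    (1 - 2 * (x + v \notin Er r)%:R + (1 - 2 * (x - v \notin Er r)%:R)) / 2.
  rewrite /sym_phase /phase; case: (x + v \in Er r); case: (x - v \in Er r);
  by rewrite /= ?mulr0n ?mulr1n; field.
rewrite mulN1r -[`|edot l v|]normrN.
apply: slab_dichotomy N0 _ _ => /negP hv.
  have : ~ Er r (x + v) by move=> w; apply: hv; exact: mem_set.
  by move=> /h2; lra.
have : ~ Er r (x - v) by move=> w; apply: hv; exact: mem_set.
by move=> /h4; lra.
Qed.

Lemma Kgs_lower_bound c eta : c = 1 \/ c = -1 -> 0 < eta ->
  exists2 r1, 0 < r1 & forall r, 0 < r < r1 ->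
    (c * (n.+3%:R * slab_lim G q M) - eta) * sigmas (d := d) s r <= c * Kgs g s r x (Er r).
Proof.
move=> hc eta0.
have c1 : `|c| = 1 by case: hc => ->; rewrite ?normrN normr1.
have mG := measurable_radial_ext cg.
have cq v : econt (fun v => c * q v) v.
  move=> e e0; have [r r0 hr] := curv_econt f nu1 v e0.
  by exists r => // y yr; rewrite -mulrBr normrM c1 mul1r; exact: hr.
have hq a v : 0 < a -> c * q (a *: v) = a ^+ 2 * (c * q v).
  by move=> _; rewrite curvZ mulrCA.
have qC v : `|c * q v| <= d%:R ^+ 2 * hess_sup f 0 * eunorm v ^+ 2.
  by rewrite normrM c1 mul1r; exact: curv_bound.
have mom r : 0 < r -> measurable_fun setT ((fun v => c * sym_phase (Er r) x v) : rVm R d -> R).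
  by move=> r0; apply: measurable_funM; [exact: measurable_cst | apply: measurable_sym_phase; exact: measurable_Er].
have om1 r v : 0 < r -> `|c * sym_phase (Er r) x v| <= 1.
  by move=> _; rewrite normrM c1 mul1r; exact: sym_phase_bound.
have [r1 r10 hr] := kernel_lower_bound s1 mG (radial_ext_bound gB B0) (radial_ext0 g)
  (fun v v0 => radial_ext_econt cg v0) (fun a v a0 => radial_ext_scale g v a0)
  cq hq qC oM eM mom om1 (fun e e0 => signed_slab_bound hc e0) eta0.
exists r1 => // r rr; have r0 : 0 < r by have /andP[] := rr.
have := hr r rr.
(* Linearity in [c] allows the two signed estimates to be stated with the same limit. *)
have -> : slab_lim G (fun v => c * q v) M = c * slab_lim G q M.
  have qE : q = (fun v => 1 * q v) by apply/funext => v; rewrite mul1r.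
  rewrite (slab_lim_curvE f cg gB oM eM c) qE (slab_lim_curvE f cg gB oM eM 1).
  by ring.
rewrite mulrCA (Kgs_sym_phase cg gB geven B0 s1 x (measurable_Er r0) r0) => h.
have iK : muV.-integrable setT
    (EFin \o (fun v : rVm R d => sym_phase (Er r) x v * G v * kr (d := d) s r (eunorm v))).
  apply: (integrable_kernel s1 mG (radial_ext_bound gB B0) r0 (H := fun v => sym_phase (Er r) x v * G v)).
    by apply: measurable_funM => //; apply: measurable_sym_phase; exact: measurable_Er.
  move=> v; have /andP[G0 _] := radial_ext_bound gB B0 v.
  by rewrite normrM (ger0_norm G0); apply: ler_piMl => //; exact: sym_phase_bound.
rewrite -(RintegralZl _ measurableT iK).
apply: (le_trans h); rewrite le_eqVlt; apply/orP; left; apply/eqP.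
by apply: eq_Rintegral => v _; rewrite !mulrA.
Qed.

End blow_up.

Theorem theorem6p5 (R : realType) (d : nat) (g : 'rV[R]_d -> R) (s : R)
    (Er : R -> set 'rV[R]_d) (E : set 'rV[R]_d) (x : 'rV[R]_d) :
  (2 <= d)%N ->
  {within unit_sphere, continuous g} ->
  (forall xi, unit_sphere xi -> 0 < g xi) ->
  (forall xi, unit_sphere xi -> g (- xi) = g xi) ->
  1 <= s ->
  class_frakC E ->
  (forall r, 0 < r -> class_frakC (Er r)) ->
  conv_frakC Er E ->
  bdry E x ->
  (forall r, 0 < r -> bdry (Er r) x) ->
  forall (nu : 'rV[R]_d) (rho : R) (f : 'rV[R]_d -> R),
    eunorm nu = 1 -> 0 < rho -> isC2 f ->
    f 0 = 0 -> (forall z, edot z nu = 0 -> derive f 0 z = 0) ->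
    local_subgraph E x nu rho f ->
    (fun r => ((Kgs g s r x (Er r)) / sigmas (d := d) s r)%:E) @ 0^'+ -->
      oppe (haus_int (d - 2)%N [set xi | unit_sphere xi /\ edot xi nu = 0]
           (fun xi => g xi * derive (fun y => derive f y xi) 0 xi)).
Proof.
case: d g Er E x => [|[|n]] g Er E x //= _ cg gpos geven s1 _ CEr cvE _ bdEr.
move=> nu rho f nu1 rho0 C2f _ df0 subE.
have [B hB] := sphere_bounded cg.
have gB y : eunorm y = 1 -> 0 <= g y <= `|B|.
  move=> y1; rewrite ltW ?gpos//=; apply: le_trans (ler_norm B).
  exact: le_trans (ler_norm _) (hB _ y1).
have scg := within_sph_cont cg.
have clEr r : 0 < r -> closed (Er r) by move=> /CEr/class_frakC_closed.
have [M [oM eM]] := householder (eunorm_e0 n.+1) nu1.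
rewrite !subSS subn0 -(slab_lim_curvature scg gB oM eM C2f).
set L := _ * slab_lim _ _ _.
apply: cvg_EFin; first by near=> r.
apply/cvgrPdist_le => eta eta0 /=.
have lb c hc := Kgs_lower_bound (c := c) scg gB geven (normr_ge0 B) s1 nu1 rho0 C2f df0 subE clEr bdEr cvE oM eM hc eta0.
have [r1 r10 h1] := lb 1 (or_introl erefl).
have [r2 r20 h2] := lb (-1) (or_intror erefl).
(* For r below [r3] sigma is at least 1, hence positive, so that the estimates may be divided by
   it. *)
have [r3 r30 h3] := sigmas_large n.+2 1 s1.
near=> r.
have r0 : 0 < r by near: r; exact: nbhs_right_gt.
have rr1 : 0 < r < r1 by rewrite r0/=; near: r; exact: nbhs_right_lt.
have rr2 : 0 < r < r2 by rewrite r0/=; near: r; exact: nbhs_right_lt.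
have rr3 : 0 < r < r3 by rewrite r0/=; near: r; exact: nbhs_right_lt.
have := h1 r rr1; have := h2 r rr2; have := h3 r rr3; rewrite -/L.
move: (sigmas _ _) (Kgs _ _ _ _ _) => S K S1 k2 k1.
have S0 : 0 < S by lra.
rewrite ler_distl; apply/andP; split.
  by rewrite lerBlDl ler_pdivrMr//; lra.
rewrite -lerBlDr ler_pdivlMr//; lra.
Unshelve. all: by end_near.
Qed.
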